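(* Let $\mathbb F_2$ be the free group with free generators $g_1,g_2$, let $\{\sigma_n\}_{n\in\mathbb N}$ be a sequence of finite-dimensional unitary representations of $\mathbb F_2$ such that $\|\lambda(b)\|=\limsup_{n\to\infty}\|\sigma_n(b)\|$ for every $b\in\mathbb C[\mathbb F_2]$, where $\lambda$ is the regular representation, and let $\bar\sigma_n$ be the representation contragredient to $\sigma_n$. Let $a=\frac14(g_1+g_1^{-1}+g_2+g_2^{-1})\in\mathbb C[\mathbb F_2]$. Then: (i) $\|\Delta(a)\|_\lambda=1$ in $C^*_r(\mathbb F_2)\odot C^*_{\oplus_{n=1}^\infty\bar\sigma_n}(\mathbb F_2)$, where $\|\cdot\|_\lambda$ is the left asymptotic tensor $C^*$-norm; (ii) $\|\Delta(a)\|_\sigma=1$ in $C^*_r(\mathbb F_2)\odot C^*_r(\mathbb F_2)$, where $\|\cdot\|_\sigma$ is the symmetric asymptotic tensor $C^*$-norm.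
   Context: The existence of such a sequence $\{\sigma_n\}$ is due to Haagerup and Thorbj{\o}rnsen. For a unitary representation $\pi$ of $\mathbb F_2$, $C^*_\pi(\mathbb F_2)$ denotes the $C^*$-algebra generated by all $\pi(g)$, $g\in\mathbb F_2$; $C^*_r(\mathbb F_2)=C^*_\lambda(\mathbb F_2)$. $\odot$ is the algebraic tensor product. For representations $\pi,\pi'$ of $\mathbb F_2$, $\Delta:\mathbb C[\mathbb F_2]\to C^*_\pi(\mathbb F_2)\odot C^*_{\pi'}(\mathbb F_2)$ is the linear map induced by the diagonal homomorphism, $\Delta(g)=\pi(g)\otimes\pi'(g)$ for $g\in\mathbb F_2$. An asymptotic representation of a $C^*$-algebra $A$ is a family of maps $\varphi=(\varphi_t)_{t\in[0,\infty)}:A\to\mathbb B(H)$, $H$ a Hilbert space, such that $t\mapsto\varphi_t(a)$ is norm-continuous for each $a\in A$ and, for all $a,b\in A$ and $\mu\in\mathbb C$, the norms of $\varphi_t(a+\mu b)-\varphi_t(a)-\mu\varphi_t(b)$, $\varphi_t(ab)-\varphi_t(a)\varphi_t(b)$ and $\varphi_t(a^* )-\varphi_t(a)^*$ tend to $0$ as $t\to\infty$. For separable $C^*$-algebras $A,B$ and $c\in A\odot B$, the left asymptotic tensor $C^*$-norm (the subscript $\lambda$ here is not the regular representation) is $$\|c\|_\lambda=\sup_{\varphi,\psi}\limsup_{t\to\infty}\|(\varphi_t\otimes\psi)(c)\|,$$ the supremum over all asymptotic representations $\varphi=(\varphi_t)_{t\in[0,\infty)}:A\to\mathbb B(H)$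 and all representations $\psi:B\to\mathbb B(H)$. The symmetric asymptotic tensor $C^*$-norm is $$\|c\|_\sigma=\sup_{\varphi,\psi}\limsup_{t\to\infty}\|(\varphi_t\otimes\psi_t)(c)\|,$$ the supremum over all asymptotic representations $\varphi=(\varphi_t)$ of $A$ and $\psi=(\psi_t)$ of $B$. Here, for $c=\sum_i a_i\otimes b_i$, $(\varphi_t\otimes\psi_t)(c)=\sum_i\varphi_t(a_i)\otimes\psi_t(b_i)\in\mathbb B(H\otimes H)$ (and similarly with $\psi$ in place of $\psi_t$); the $\limsup$ does not depend on how $c$ is written as such a sum. *)

(* Defs.v *)
From HB Require Import structures.
From mathcomp Require Import all_boot all_order all_algebra.
From mathcomp Require Import sesquilinear complex.
From mathcomp.multinomials Require Import freeg.
From mathcomp Require Import all_classical all_reals all_analysis.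

Set Implicit Arguments.
Unset Strict Implicit.
Unset Printing Implicit Defensive.

Import Order.TTheory GRing.Theory Num.Theory.
Import numFieldNormedType.Exports.

Local Open Scope classical_set_scope.
Local Open Scope ring_scope.
Local Open Scope complex_scope.

(* [dot] is linear in its first argument. *)
HB.mixin Record isHilbert (R : realType) H
    of CompleteNormedModule R[i] H := {
  dot : H -> H -> R[i];
  dotP : forall (a : R[i]) (x y z : H),
    dot (a *: x + y) z = a * dot x z + dot y z;
  dotC : forall x y : H, dot y x = (dot x y)^*;
  dot_norm : forall x : H, dot x x = `|x| ^+ 2 }.

#[short(type="hilbertType")]
HB.structure Definition Hilbert (R : realType) :=
  { H of CompleteNormedModule R[i] H & isHilbert R H }.

Section BoundedOperators.
Context {R : realType}.

Section Def.
Context (V W : normedModType R[i]).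

Definition bop_pred : {pred V -> W} :=
  [pred f : V -> W | `[< linear f /\ continuous f >]].

Lemma bop_pred_submod : submod_closed bop_pred.
Proof.
split=> [|a f g /asboolP[lf cf] /asboolP[lg cg]]; apply/asboolP; split.
- by move=> a u v; rewrite /= scaler0 addr0.
- by move=> x; apply: cvg_cst.
- move=> b u v; rewrite !fctE lf lg /=.
  by rewrite !scalerDr !scalerA (mulrC a b) addrACA.
- by move=> x; apply: cvgD; [apply: cvgZl_tmp; apply: cf|apply: cg].
Qed.

HB.instance Definition _ :=
  GRing.isSubmodClosed.Build _ _ bop_pred bop_pred_submod.

Record bop := Bop { bop_fun :> V -> W; bopP : bop_fun \in bop_pred }.

HB.instance Definition _ := [isSub for bop_fun].
HB.instance Definition _ := [Choice of bop by <:].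
HB.instance Definition _ := [SubChoice_isSubLmodule of bop by <:].

Definition opnorm (f : V -> W) : R :=
  sup [set r : R | exists2 x : V, `|x| <= 1 & `|f x| = r%:C].

Definition lin_span (X : set V) : set V :=
  [set v | exists s : seq (R[i] * V),
     (forall p, p \in s -> X p.2) /\ v = \sum_(p <- s) p.1 *: p.2].

End Def.

Lemma bop_comp_subproof (U V W : normedModType R[i]) (S : bop V W)
  (T : bop U V) : S \o T \in @bop_pred U W.
Proof.
have /asboolP[lS cS] := bopP S; have /asboolP[lT cT] := bopP T.
apply/asboolP; split=> [a u v|x] /=; first by rewrite lT lS.
by apply: continuous_comp; [apply: cT|apply: cS].
Qed.

Definition bop_comp (U V W : normedModType R[i]) (S : bop V W) (T : bop U V) :
  bop U W := Bop (bop_comp_subproof S T).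

Lemma bop_id_subproof (V : normedModType R[i]) : idfun \in @bop_pred V V.
Proof. by apply/asboolP; split=> // x; apply: cvg_id. Qed.

Definition bop_id (V : normedModType R[i]) : bop V V :=
  Bop (bop_id_subproof V).

(* Such an operator exists and is unique by the Riesz representation theorem,
   so the default value 0 is never used. *)
Definition adj (H K : hilbertType R) (T : bop H K) : bop K H :=
  xget (0 : bop K H) [set S : bop K H | forall x y, dot (T x) y = dot x (S y)].

End BoundedOperators.

Arguments bop {R} V W.
Notation "''B' ( H )" := (bop H H) (at level 8, format "''B' ( H )").

Section TensorProducts.
Context {R : realType}.

(* V ⊙ W is realised inside the algebraic dual of the space of bilinear
   forms on V × W; over a field this is the algebraic tensor product. *)
Section Algebraic.
Context (V W : lmodType R[i]).

Definition tensor : Type := {bilinear V -> W -> R[i]^o} -> R[i]^o.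

HB.instance Definition _ := GRing.Lmodule.on tensor.

Definition pure_tensor (v : V) (w : W) : tensor := fun B => B v w.

End Algebraic.

(* (T, tau) is a model of the Hilbert space tensor product of H and K. *)
Definition hilbert_tensor (H K T : hilbertType R)
    (tau : {bilinear H -> K -> T}) : Prop :=
  (forall x x' y y',
     dot (tau x y) (tau x' y') = dot x x' * dot y y') /\
  closure (lin_span [set tau p.1 p.2 | p in [set: H * K]]) = [set: T].

(* When tau is a Hilbert tensor product there is exactly one such operator,
   usually written a ⊗ b. *)
Definition tensor_op (H K T : hilbertType R) (tau : {bilinear H -> K -> T})
    (a : 'B(H)) (b : 'B(K)) : 'B(T) :=
  xget 0 [set c : 'B(T) | forall x y, c (tau x y) = tau (a x) (b y)].

End TensorProducts.

Notation "v ⊙ w" := (pure_tensor v w) (at level 40) : ring_scope.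

Section CstarAlgebras.
Context {R : realType}.

Record cstar_subalgebra (H : hilbertType R) (A : set 'B(H)) : Prop := {
  cstar0 : A 0;
  cstar_lin : forall (mu : R[i]) a b, A a -> A b -> A (a + mu *: b);
  cstar_mul : forall a b, A a -> A b -> A (bop_comp a b);
  cstar_adj : forall a, A a -> A (adj a);
  cstar_closed : forall a,
    (forall e : R, 0 < e -> exists2 b, A b & opnorm (a - b) < e) -> A a }.

(* C*-algebras are concrete: norm-closed *-subalgebras A of B(H).  Maps out of
   A are total on B(H), but only their values on A are constrained. *)
Record representation (H K : hilbertType R) (A : set 'B(H))
    (psi : 'B(H) -> 'B(K)) : Prop := {
  rep_lin : forall (mu : R[i]) a b, A a -> A b ->
    psi (a + mu *: b) = psi a + mu *: psi b;
  rep_mul : forall a b, A a -> A b ->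
    psi (bop_comp a b) = bop_comp (psi a) (psi b);
  rep_adj : forall a, A a -> psi (adj a) = adj (psi a) }.

Record asymptotic_representation (H K : hilbertType R) (A : set 'B(H))
    (phi : R -> 'B(H) -> 'B(K)) : Prop := {
  asym_cts : forall a, A a -> forall t : R, 0 <= t ->
    opnorm (phi s a - phi t a)
      @[s --> within [set s | 0 <= s] (nbhs t)] --> (0 : R);
  asym_lin : forall (mu : R[i]) a b, A a -> A b ->
    opnorm (phi t (a + mu *: b) - phi t a - mu *: phi t b)
      @[t --> +oo] --> (0 : R);
  asym_mul : forall a b, A a -> A b ->
    opnorm (phi t (bop_comp a b) - bop_comp (phi t a) (phi t b))
      @[t --> +oo] --> (0 : R);
  asym_adj : forall a, A a ->
    opnorm (phi t (adj a) - adj (phi t a)) @[t --> +oo] --> (0 : R) }.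

Section Norms.
Context (H1 H2 : hilbertType R) (A : set 'B(H1)) (B : set 'B(H2)).

Definition tensor_decomposition (c : tensor 'B(H1) 'B(H2))
    (s : seq ('B(H1) * 'B(H2))) : Prop :=
  (forall p, p \in s -> A p.1 /\ B p.2) /\ c = \sum_(p <- s) p.1 ⊙ p.2.

(* The limsup does not depend on the decomposition s of c, nor on the model
   (T, tau) of the tensor square of H. *)
Definition left_asymptotic_norm (c : tensor 'B(H1) 'B(H2)) : \bar R :=
  ereal_sup [set r | exists (H T : hilbertType R) (tau : {bilinear H -> H -> T})
    (phi : R -> 'B(H1) -> 'B(H)) (psi : 'B(H2) -> 'B(H)) s,
    [/\ hilbert_tensor tau, asymptotic_representation A phi,
        representation B psi, tensor_decomposition c s &
        r = limf_esup (fun t : R =>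
              (opnorm (\sum_(p <- s) tensor_op tau (phi t p.1) (psi p.2)))%:E)
            (pinfty_nbhs R)]].

Definition symmetric_asymptotic_norm (c : tensor 'B(H1) 'B(H2)) : \bar R :=
  ereal_sup [set r | exists (H T : hilbertType R) (tau : {bilinear H -> H -> T})
    (phi : R -> 'B(H1) -> 'B(H)) (psi : R -> 'B(H2) -> 'B(H)) s,
    [/\ hilbert_tensor tau, asymptotic_representation A phi,
        asymptotic_representation B psi, tensor_decomposition c s &
        r = limf_esup (fun t : R =>
              (opnorm (\sum_(p <- s) tensor_op tau (phi t p.1) (psi t p.2)))%:E)
            (pinfty_nbhs R)]].

End Norms.
End CstarAlgebras.

Definition free_on2 (F : groupType) (g1 g2 : F) : Prop :=
  forall (G : groupType) (x1 x2 : G),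
    (exists f : {multiplicative F -> G}, f g1 = x1 /\ f g2 = x2) /\
    (forall f f' : {multiplicative F -> G},
       f g1 = f' g1 -> f g2 = f' g2 -> f =1 f').

Section GroupRepresentations.
Context {R : realType} {F : groupType}.

Record unitary_rep (H : hilbertType R) (pi : F -> 'B(H)) : Prop := {
  urep1 : pi 1%g = bop_id H;
  urepM : forall g h, pi (g * h)%g = bop_comp (pi g) (pi h);
  urepUl : forall g, bop_comp (adj (pi g)) (pi g) = bop_id H;
  urepUr : forall g, bop_comp (pi g) (adj (pi g)) = bop_id H }.

(* The group algebra of F enters only through its vector space structure, that
   of the free module {freeg F / R[i]}; fglift is linear extension. *)
Definition rep_ext (H : hilbertType R) (pi : F -> 'B(H))
    (b : {freeg F / R[i]}) : 'B(H) := fglift pi b.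

Definition cstar_of (H : hilbertType R) (pi : F -> 'B(H)) : set 'B(H) :=
  smallest (@cstar_subalgebra R H) (range pi).

Definition Delta (H1 H2 : hilbertType R) (pi : F -> 'B(H1))
    (pi' : F -> 'B(H2)) (b : {freeg F / R[i]}) : tensor 'B(H1) 'B(H2) :=
  fglift (fun g => pi g ⊙ pi' g) b.

(* delta is an orthonormal basis of H, which identifies H with l^2(F). *)
Definition left_regular (H : hilbertType R) (lambda : F -> 'B(H)) : Prop :=
  exists delta : F -> H,
    [/\ forall g h, dot (delta g) (delta h) = (g == h)%:R,
        closure (lin_span (range delta)) = [set: H] &
        forall g h, lambda g (delta h) = delta (g * h)%g].

Definition finite_dimensional (H : hilbertType R) : Prop :=
  exists2 X : set H, finite_set X & lin_span X = [set: H].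

(* p identifies K isometrically with the Banach dual of H. *)
Definition dual_pairing (H K : hilbertType R)
    (p : {bilinear K -> H -> R[i]^o}) : Prop :=
  [/\ forall f, continuous (p f : H -> R[i]^o),
      forall f, `|f| = (opnorm (p f : H -> R[i]^o))%:C &
      forall u : {linear H -> R[i]^o}, continuous u -> exists f, p f =1 u].

Definition contragredient (H K : hilbertType R) (pi : F -> 'B(H))
    (pi' : F -> 'B(K)) : Prop :=
  exists2 p : {bilinear K -> H -> R[i]^o}, dual_pairing p &
    forall g f x, p (pi' g f) x = p f (pi g^-1%g x).

Definition direct_sum (K : nat -> hilbertType R)
    (pi : forall n, F -> 'B(K n)) (H : hilbertType R) (rho : F -> 'B(H)) : Prop :=
  exists iota : forall n, {linear K n -> H},
    [/\ forall n x y, dot (iota n x) (iota n y) = dot x y,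
        forall m n x y, m != n -> dot (iota m x) (iota n y) = 0,
        closure (lin_span (\bigcup_n range (iota n))) = [set: H] &
        forall n g x, rho g (iota n x) = iota n (pi n g x)].

End GroupRepresentations.

(* Main.v *)
(* Upper bound: an asymptotic representation sends a unitary to asymptotic
   isometries, so any decomposition of [Delta a] whose legs are group elements
   gives limsup at most 1. Two decompositions of the same tensor differ by a
   null sum, and a null sum with a nonzero leg can be shortened.

   Lower bound: let [S_i] exchange [delta 1] and [delta g_i^-1] and fix the other
   basis vectors, and let [pi_z], [|z| = 1], be the representation of the free
   group with [pi_z g_i = lambda g_i ((1 + z) / 2 + (1 - z) / 2 S_i)]. Then
   [pi_1 = lambda], [pi_(-1)] fixes [delta 1], and [pi_z g] differs from
   [lambda g] by an operator of finite rank. Hence [pi_z (x) sigma_n] is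
   asymptotically bounded by the reduced norm: by Fell absorption away from the
   finitely many vectors moved by [pi_z], and on their span by the strong
   convergence of [sigma_n], where the loss of a constant is removed by passing
   to powers. By Fell absorption again, the loop [z |-> pi_z (x) sigma_n] can be
   conjugated so as to start and end at a representation independent of [n].
   Running through these loops successively yields a continuous family of
   representations of the free group which extends to an asymptotic
   representation of the reduced C*-algebra and contains [sigma_n] at time
   [n + 1/2]. Since [sigma_n (x) sigma'_n] has an invariant vector, [Delta a] has
   norm at least 1 at these times. *)
From HB Require Import structures.
Require Import Defs.
From mathcomp Require Import all_boot all_order all_algebra.
From mathcomp Require Import sesquilinear complex.
From mathcomp.multinomials Require Import freeg.
From mathcomp Require Import all_classical all_reals all_analysis.
From mathcomp Require Import ring lra.

Set Implicit Arguments.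
Unset Strict Implicit.
Unset Printing Implicit Defensive.

Import Order.TTheory GRing.Theory Num.Theory.
Import numFieldNormedType.Exports.

Local Open Scope classical_set_scope.
Local Open Scope ring_scope.
Local Open Scope complex_scope.

(** * Norms and bounded operators *)

(** The representation [sigma n] meets the reduced norm estimate only in the limit, so it need not
    extend to the reduced C*-algebra; it can enter only through a family continuous in time, which
    forces a path from each [n] to the next. The paths meet at [lambda] tensor 1, the one form that
    [lambda] tensor any unitary representation takes after Fell absorption. They visit [z = -1]
    because a fixed vector of [pi_(-1)] makes [pi_(-1)] tensor [sigma n] contain [sigma n].
    Everything is carried by the single space l^2(F). As F is countably infinite, a bijection from F
    x F to F turns l^2(F) into its own tensor square, and each finite-dimensional space embeds
    isometrically. The embedded [sigma n] is degenerate, and a copy of [lambda] on the complement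
    restores unitarity. In (i) the second leg is the constant representation given by [rho]. In (ii)
    it is a second asymptotic family, built from [sigma' n] and running in step with the first; the
    contragredients satisfy the same norm estimate because conjugating coefficients does not change
    norms under [lambda]. *)

Section RealNorm.
Context {R : realType}.

(** Norms of modules over [R[i]] take values in [R[i]]; [nr] is the same norm as a real number, on
    which real arithmetic can be used. *)
Definition nr (V : normedZmodType R[i]) (x : V) : R := complex.Re `|x|.

Section Zmod.
Context (V : normedZmodType R[i]).
Implicit Types x y z : V.

Lemma nrE x : `|x| = (nr x)%:C.
Proof. by rewrite /nr RRe_real // ger0_real //. Qed.

Lemma nr_ge0 x : 0 <= nr x.
Proof. by rewrite -ler0c -nrE. Qed.

Lemma nr_eq0 x : (nr x == 0) = (x == 0).
Proof.
rewrite -(normr_eq0 x) nrE; apply/eqP/eqP => [->//|].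
by move/complexI.
Qed.

Lemma nr0 : nr (0 : V) = 0.
Proof. by apply/eqP; rewrite nr_eq0. Qed.

Lemma nr0_eq x : nr x = 0 -> x = 0.
Proof. by move/eqP; rewrite nr_eq0 => /eqP. Qed.

Lemma nrD x y : nr (x + y) <= nr x + nr y.
Proof. by rewrite -lecR rmorphD /= -!nrE ler_normD. Qed.

Lemma nrN x : nr (- x) = nr x.
Proof. by rewrite /nr normrN. Qed.

Lemma nrB x y : nr (x - y) <= nr x + nr y.
Proof. by rewrite -(nrN y) nrD. Qed.

Lemma nr_dist x y : nr (x - y) = nr (y - x).
Proof. by rewrite -nrN opprB. Qed.

Lemma nr_triangle y x z : nr (x - z) <= nr (x - y) + nr (y - z).
Proof. by rewrite -[x - z](subrKA y) nrD. Qed.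

Lemma nr_le_dist x y : nr x <= nr y + nr (x - y).
Proof. by rewrite -[x in leLHS](subrK y) addrC nrD. Qed.

End Zmod.

Lemma nrM (a b : R[i]) : nr (a * b) = nr a * nr b.
Proof. by apply: complexI; rewrite rmorphM /= -!nrE normrM. Qed.

Lemma nrR (r : R) : nr (r%:C) = `|r|.
Proof. by rewrite /nr normc_def /= expr0n addr0 sqrtr_sqr. Qed.

Lemma nr1 : nr (1 : R[i]) = 1.
Proof. by rewrite -[1]/(1%:C) nrR normr1. Qed.

Lemma nr_Re (a : R[i]) : `|complex.Re a| <= nr a.
Proof.
by case: a => a b; rewrite /nr normc_def /= -sqrtr_sqr ler_wsqrtr // lerDl sqr_ge0.
Qed.

Lemma Re_le_nr (a : R[i]) : complex.Re a <= nr a.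
Proof. exact: le_trans (ler_norm _) (nr_Re a). Qed.

Lemma nr_sq (a : R[i]) : a * conjc a = (nr a ^+ 2)%:C.
Proof.
case: a => a b; rewrite /nr normc_def /= sqr_sqrtr ?addr_ge0 ?sqr_ge0//.
by apply/eqP; rewrite eq_complex /= !expr2; apply/andP; split; apply/eqP; ring.
Qed.

Lemma nrZ (V : normedModType R[i]) (a : R[i]) (x : V) : nr (a *: x) = nr a * nr x.
Proof. by apply: complexI; rewrite rmorphM /= -!nrE normrZ. Qed.

End RealNorm.

Section BoundedOps.
Context {R : realType}.
Implicit Types V W : normedModType R[i].

Lemma cvg_nr (T : Type) (Fi : set_system T) (FF : Filter Fi) V (f : T -> V) (l : V) :
  (forall e : R, 0 < e -> \forall x \near Fi, nr (f x - l) < e) <-> f @ Fi --> l.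
Proof.
split=> [h|h].
  apply/cvgrPdist_lt => e e0.
  have e1 : 0 < complex.Re e by move: e0; rewrite ltcE => /andP[].
  have ee : e = (complex.Re e)%:C by rewrite RRe_real // ger0_real // ltW.
  apply: filterS (h _ e1) => x hx.
  by rewrite ee distrC nrE ltcR.
move=> e e0.
have e1 : 0 < e%:C by rewrite ltcR.
move/cvgrPdist_lt : h => /(_ _ e1); apply: filterS => x.
by rewrite distrC nrE ltcR.
Qed.

Lemma closureP_nr V (A : set V) (x : V) :
  closure A x <-> forall e : R, 0 < e -> exists2 y, A y & nr (x - y) < e.
Proof.
split=> h.
  move=> e e0; have e1 : 0 < e%:C by rewrite ltcR.
  have [y [Ay]] := h _ (nbhsx_ballx x (e%:C) e1).
  by rewrite -ball_normE /= nrE ltcR; exists y.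
move=> B /nbhs_ballP[e /= e0 hB].
have e1 : 0 < complex.Re e by move: e0; rewrite ltcE => /andP[].
have ee : e = (complex.Re e)%:C by rewrite RRe_real // ger0_real // ltW.
have [y Ay hy] := h _ e1; exists y; split=> //; apply: hB.
by rewrite -ball_normE /= ee nrE ltcR.
Qed.

Lemma complete_nr (V : completeNormedModType R[i]) (u : nat -> V) :
  (forall e : R, 0 < e -> exists N, forall n m, (N <= n)%N -> (N <= m)%N ->
     nr (u n - u m) < e) ->
  exists l, forall e : R, 0 < e -> exists N, forall n, (N <= n)%N -> nr (u n - l) < e.
Proof.
move=> h.
have /cauchy_cvgP : cauchy (u @ \oo).
  apply/cauchyP => e e0.
  have e1 : 0 < complex.Re e by move: e0; rewrite ltcE => /andP[].
  have ee : e = (complex.Re e)%:C by rewrite RRe_real // ger0_real // ltW.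
  have [N hN] := h _ e1; exists (u N).
  exists N => // n /= Nn; rewrite -ball_normE /= ee nrE ltcR; exact: hN.
move=> /cvg_ex[l /cvg_nr hl]; exists l => e e0.
have [N _ hN] := hl _ e0; by exists N.
Qed.

Section Op.
Context (V W : normedModType R[i]).
Implicit Types (f g : bop V W).

Lemma bop_lin f : linear f. Proof. by have /asboolP[] := bopP f. Qed.

HB.instance Definition _ f := GRing.isLinear.Build R[i] V W *:%R f (bop_lin f).

Lemma bop_bounded f : exists2 M, 0 <= M & forall x, nr (f x) <= M * nr x.
Proof.
have /asboolP[_ cf] := bopP f.
have /linear_bounded_continuous/linear_boundedP := cf.
case=> M [Mr hM].
(* The summand [1] puts the witness above [M], and the absolute value makes it nonnegative. *)
have hM1 : M < (complex.Re M + 1 + `|complex.Re M|)%:C.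
  rewrite ltcE /= -[M in complex.Im M](RRe_real Mr) /= eqxx /=.
  have := normr_ge0 (complex.Re M); lra.
exists (complex.Re M + 1 + `|complex.Re M|).
  by have := ler_norm (- complex.Re M); rewrite normrN; lra.
by move=> x; have := hM _ hM1 x; rewrite !nrE -rmorphM lecR.
Qed.

Lemma opnorm_set f :
  has_sup [set r : R | exists2 x : V, `|x| <= 1 & `|f x| = r%:C].
Proof.
split; first by exists 0, 0; rewrite ?linear0 ?normr0.
have [M M0 hM] := bop_bounded f; exists M => r [x].
rewrite !nrE -[1]/(1%:C) lecR => x1 /complexI <-.
by apply: le_trans (hM x) _; rewrite -{2}[M]mulr1 ler_wpM2l.
Qed.

Lemma opnorm_unit f x : nr x <= 1 -> nr (f x) <= opnorm f.
Proof.
move=> x1; apply: sup_upper_bound; first exact: opnorm_set.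
by exists x; rewrite nrE // -[1]/(1%:C) lecR.
Qed.

Lemma opnorm_ge0 f : 0 <= opnorm f.
Proof. by have := @opnorm_unit f 0; rewrite linear0 !nr0 => /(_ ler01). Qed.

Lemma opnormP f x : nr (f x) <= opnorm f * nr x.
Proof.
have [->|x0] := eqVneq x 0; first by rewrite linear0 !nr0 mulr0.
have nx : 0 < nr x by rewrite lt_neqAle nr_ge0 eq_sym nr_eq0 x0.
have := @opnorm_unit f ((nr x)^-1%:C *: x).
rewrite linearZ /= !nrZ nrR ger0_norm ?invr_ge0 ?nr_ge0 //.
rewrite mulVf ?gt_eqF // lexx => /(_ isT).
by rewrite mulrC ler_pdivrMr.
Qed.

Lemma opnorm_le f M : 0 <= M -> (forall x, nr (f x) <= M * nr x) -> opnorm f <= M.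
Proof.
move=> M0 h; apply: ge_sup; first by case: (opnorm_set f).
move=> r [x]; rewrite !nrE -[1]/(1%:C) lecR => x1 /complexI <-.
by apply: le_trans (h x) _; rewrite -{2}[M]mulr1 ler_wpM2l.
Qed.

Lemma opnorm_le_nr f M x : opnorm f <= M -> nr (f x) <= M * nr x.
Proof.
by move=> h; apply: le_trans (opnormP f x) _; rewrite ler_wpM2r ?nr_ge0.
Qed.

Lemma bounded_bop (f : V -> W) (M : R) : linear f ->
  (forall x, nr (f x) <= M * nr x) -> f \in @bop_pred R V W.
Proof.
move=> lf hM; apply/asboolP; split=> // x.
apply/cvg_nr => e e0.
have : \forall y \near x, nr (y - x) < e / (`|M| + 1).
  have /cvg_nr : id @ x --> x by apply: cvg_id.
  by apply; rewrite divr_gt0 // ltr_wpDl.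
apply: filterS => y; rewrite ltr_pdivlMr ?ltr_wpDl // => hy.
have lfB : f y - f x = f (y - x) by rewrite addrC -scaleN1r -lf addrC scaleN1r.
rewrite lfB; apply: le_lt_trans (hM _) _; apply: le_lt_trans hy.
rewrite mulrC ler_wpM2l ?nr_ge0 //.
by apply: le_trans (ler_norm _) _; rewrite lerDl.
Qed.

Lemma mkbop (f : V -> W) (M : R) : linear f -> (forall x, nr (f x) <= M * nr x) ->
  exists g : bop V W, forall x, g x = f x.
Proof. by move=> lf hM; exists (Bop (bounded_bop lf hM)). Qed.

Lemma bopE f g : (forall x, f x = g x) -> f = g.
Proof. by move=> h; apply/val_inj/funext. Qed.

Lemma bop_addE f g x : (f + g) x = f x + g x. Proof. by []. Qed.
Lemma bop_oppE f x : (- f) x = - f x. Proof. by []. Qed.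
Lemma bop_scaleE a f x : (a *: f) x = a *: f x. Proof. by []. Qed.
Lemma bop_zeroE x : (0 : bop V W) x = 0. Proof. by []. Qed.
Lemma bop_sumE I (r : seq I) (P : pred I) (F : I -> bop V W) x :
  (\sum_(i <- r | P i) F i) x = \sum_(i <- r | P i) F i x.
Proof. by elim/big_rec2: _ => [//|i a b _ <-]. Qed.

Lemma opnorm0 : opnorm (0 : bop V W) = 0.
Proof.
apply/eqP; rewrite eq_le opnorm_ge0 andbT; apply: opnorm_le => // x.
by rewrite bop_zeroE nr0 mul0r.
Qed.

Lemma opnormD f g : opnorm (f + g) <= opnorm f + opnorm g.
Proof.
apply: opnorm_le => [|x]; first by rewrite addr_ge0 ?opnorm_ge0.
by apply: le_trans (nrD _ _) _; rewrite mulrDl lerD ?opnormP.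
Qed.

Lemma opnormZ_le a f : opnorm (a *: f) <= nr a * opnorm f.
Proof.
apply: opnorm_le => [|x]; first by rewrite mulr_ge0 ?nr_ge0 ?opnorm_ge0.
by rewrite bop_scaleE nrZ -mulrA ler_wpM2l ?nr_ge0 ?opnormP.
Qed.

Lemma opnormN f : opnorm (- f) = opnorm f.
Proof.
have h g : opnorm (- g) <= opnorm g.
  apply: opnorm_le => [|x]; first exact: opnorm_ge0.
  by rewrite bop_oppE nrN opnormP.
by apply/eqP; rewrite eq_le h /= -{1}[f]opprK h.
Qed.

Lemma opnormZ a f : opnorm (a *: f) = nr a * opnorm f.
Proof.
have [->|a0] := eqVneq a 0; first by rewrite scale0r opnorm0 nr0 mul0r.
apply/eqP; rewrite eq_le opnormZ_le /=.
have na : 0 < nr a by rewrite lt_neqAle nr_ge0 eq_sym nr_eq0 a0.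
rewrite -ler_pdivlMl // -{1}[f](scale1r) -(mulVf a0) -scalerA.
apply: le_trans (opnormZ_le _ _) _.
suff -> : nr a^-1 = (nr a)^-1 by [].
by apply: (mulfI (lt0r_neq0 na)); rewrite -nrM [a / a]mulfV // nr1 mulfV // gt_eqF.
Qed.

Lemma opnormB f g : opnorm (f - g) <= opnorm f + opnorm g.
Proof. by rewrite -(opnormN g) opnormD. Qed.

Lemma opnorm_dist f g : opnorm (f - g) = opnorm (g - f).
Proof. by rewrite -opnormN opprB. Qed.

Lemma opnorm_triangle g f h : opnorm (f - h) <= opnorm (f - g) + opnorm (g - h).
Proof. by rewrite -[f - h](subrKA g) opnormD. Qed.

Lemma opnorm_le_dist f g : opnorm f <= opnorm g + opnorm (f - g).
Proof. by rewrite -[f in leLHS](subrK g) addrC opnormD. Qed.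

Lemma opnorm_sum I (r : seq I) (P : pred I) (F : I -> bop V W) :
  opnorm (\sum_(i <- r | P i) F i) <= \sum_(i <- r | P i) opnorm (F i).
Proof.
elim/big_rec2: _ => [|i a b _ h]; first by rewrite opnorm0.
by apply: le_trans (opnormD _ _) _; rewrite lerD2l.
Qed.

Lemma opnorm0_eq f : opnorm f = 0 -> f = 0.
Proof.
move=> h; apply: bopE => x; apply: nr0_eq; apply/eqP.
by rewrite eq_le nr_ge0 andbT; have := opnormP f x; rewrite h mul0r.
Qed.

End Op.

Lemma opnorm_comp (U V W : normedModType R[i]) (f : bop V W) (g : bop U V) :
  opnorm (bop_comp f g) <= opnorm f * opnorm g.
Proof.
apply: opnorm_le => [|x]; first by rewrite mulr_ge0 ?opnorm_ge0.
apply: le_trans (opnormP f (g x)) _; rewrite -mulrA ler_wpM2l ?opnorm_ge0 //.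
exact: opnormP.
Qed.

End BoundedOps.

(** * Inner products and adjoints *)

Section HilbertSpace.
Context {R : realType}.

Lemma ReD (a b : R[i]) : complex.Re (a + b) = complex.Re a + complex.Re b.
Proof. by case: a => ? ?; case: b. Qed.
Lemma ReN (a : R[i]) : complex.Re (- a) = - complex.Re a.
Proof. by case: a. Qed.
Lemma ReZ (r : R) (a : R[i]) : complex.Re (r%:C * a) = r * complex.Re a.
Proof. by case: a => a b; rewrite /= mul0r subr0. Qed.
Lemma Re_conjc (a : R[i]) : complex.Re (conjc a) = complex.Re a.
Proof. by case: a. Qed.
Lemma Re_mulNi (a : R[i]) : complex.Re (- 'i * a) = complex.Im a.
Proof. by case: a => a b /=; rewrite oppr0 mul0r sub0r mulN1r opprK. Qed.
Lemma eq_ReIm (a b : R[i]) :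
  complex.Re a = complex.Re b -> complex.Im a = complex.Im b -> a = b.
Proof. by case: a => ? ?; case: b => ? ? /= -> ->. Qed.

Lemma conjcM (a b : R[i]) : conjc (a * b) = conjc a * conjc b.
Proof. exact: rmorphM. Qed.
Lemma conjcD (a b : R[i]) : conjc (a + b) = conjc a + conjc b.
Proof. exact: rmorphD. Qed.
Lemma conjcN (a : R[i]) : conjc (- a) = - conjc a.
Proof. exact: rmorphN. Qed.
Lemma realcM (a b : R) : (a * b)%:C = a%:C * b%:C.
Proof. exact: rmorphM. Qed.
Lemma realcD (a b : R) : (a + b)%:C = a%:C + b%:C.
Proof. exact: rmorphD. Qed.

Section Dot.
Context (H : hilbertType R).
Implicit Types x y z : H.

Lemma dotDl x y z : dot (x + y) z = dot x z + dot y z.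
Proof. by rewrite -{1}[x]scale1r dotP mul1r. Qed.
Lemma dot0l z : dot (0 : H) z = 0.
Proof. by have := dotDl 0 0 z; rewrite addr0 => /(congr1 (fun c => c - dot (0 : H) z)); rewrite addrK subrr. Qed.
Lemma dotZl a x z : dot (a *: x) z = a * dot x z.
Proof. by rewrite -[a *: x]addr0 dotP dot0l addr0. Qed.
Lemma dotNl x z : dot (- x) z = - dot x z.
Proof. by rewrite -scaleN1r dotZl mulN1r. Qed.
Lemma dotBl x y z : dot (x - y) z = dot x z - dot y z.
Proof. by rewrite dotDl dotNl. Qed.
Lemma dotDr x y z : dot z (x + y) = dot z x + dot z y.
Proof. by rewrite dotC dotDl conjcD -!dotC. Qed.
Lemma dot0r z : dot z (0 : H) = 0.
Proof. by rewrite dotC dot0l conjc0. Qed.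
Lemma dotZr a x z : dot z (a *: x) = conjc a * dot z x.
Proof. by rewrite dotC dotZl conjcM -dotC. Qed.
Lemma dotNr x z : dot z (- x) = - dot z x.
Proof. by rewrite dotC dotNl conjcN -dotC. Qed.
Lemma dotBr x y z : dot z (x - y) = dot z x - dot z y.
Proof. by rewrite dotDr dotNr. Qed.
Lemma dot_suml I (r : seq I) (P : pred I) (F : I -> H) z :
  dot (\sum_(i <- r | P i) F i) z = \sum_(i <- r | P i) dot (F i) z.
Proof. by elim/big_rec2: _ => [|i a b _ <-]; rewrite ?dot0l ?dotDl. Qed.
Lemma dot_sumr I (r : seq I) (P : pred I) (F : I -> H) z :
  dot z (\sum_(i <- r | P i) F i) = \sum_(i <- r | P i) dot z (F i).
Proof. by elim/big_rec2: _ => [|i a b _ <-]; rewrite ?dot0r ?dotDr. Qed.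

Lemma dot_nr x : dot x x = (nr x ^+ 2)%:C.
Proof. by rewrite dot_norm nrE rmorphXn. Qed.

Lemma nr_sqD x y :
  nr (x + y) ^+ 2 = nr x ^+ 2 + nr y ^+ 2 + 2 * complex.Re (dot x y).
Proof.
apply: complexI; rewrite -dot_nr dotDl !dotDr !dot_nr (dotC x y).
apply: eq_ReIm; case: (dot x y) => a b /=; ring.
Qed.

Lemma nr_sqB x y :
  nr (x - y) ^+ 2 = nr x ^+ 2 + nr y ^+ 2 - 2 * complex.Re (dot x y).
Proof. by rewrite nr_sqD nrN dotNr ReN mulrN. Qed.

Lemma CauchySchwarz x y : nr (dot x y) <= nr x * nr y.
Proof.
have [->|y0] := eqVneq y 0; first by rewrite dot0r !nr0 mulr0.
have ny : 0 < nr y by rewrite lt_neqAle nr_ge0 eq_sym nr_eq0 y0.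
rewrite -(ler_pXn2r (n := 2)) ?nnegrE ?mulr_ge0 ?nr_ge0 //.
pose a := (nr y ^- 2)%:C * dot x y.
have E : dot x (a *: y) = (nr y ^- 2 * nr (dot x y) ^+ 2)%:C.
  by rewrite dotZr conjcM conjc_real -mulrA (mulrC (conjc _)) nr_sq -realcM.
have := sqr_ge0 (nr (x - a *: y)).
rewrite nr_sqB nrZ E /a nrM nrR ger0_norm ?invr_ge0 ?exprn_ge0 ?nr_ge0 //=.
set d := nr (dot x y); rewrite [(nr x * _) ^+ 2]exprMn.
have -> : (nr y ^- 2 * d * nr y) ^+ 2 = nr y ^- 2 * d ^+ 2.
  by field; rewrite gt_eqF.
have -> : nr x ^+ 2 + nr y ^- 2 * d ^+ 2 - 2 * (nr y ^- 2 * d ^+ 2)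
   = nr x ^+ 2 - d ^+ 2 / nr y ^+ 2 by field; rewrite gt_eqF.
by rewrite subr_ge0 ler_pdivrMr ?exprn_gt0.
Qed.

Lemma dot_inj x y : (forall z, dot x z = dot y z) -> x = y.
Proof.
move=> h; apply/eqP; rewrite -subr_eq0 -nr_eq0 -sqrf_eq0; apply/eqP/complexI.
by rewrite -dot_nr dotBl h subrr.
Qed.

Lemma dot_injr x y : (forall z, dot z x = dot z y) -> x = y.
Proof. by move=> h; apply: dot_inj => z; rewrite dotC h -dotC. Qed.

Lemma parallelogram x y :
  nr (x + y) ^+ 2 + nr (x - y) ^+ 2 = 2 * (nr x ^+ 2 + nr y ^+ 2).
Proof. rewrite nr_sqD nr_sqB; ring. Qed.

(* Minimise the coercive functional |x|^2 - 2 Re (f x). *)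
Lemma riesz (f : H -> R[i]) (M : R) :
  (forall a x y, f (a *: x + y) = a * f x + f y) ->
  (forall x, nr (f x) <= M * nr x) -> exists z, forall x, f x = dot x z.
Proof.
move=> lf hM.
have fZ a x : f (a *: x) = a * f x.
  have f0 : f 0 = 0.
    have := lf 1 0 0; rewrite scaler0 addr0 mul1r.
    by move/(congr1 (fun c => c - f 0)); rewrite addrK subrr.
  by have := lf a x 0; rewrite f0 !addr0.
have fD x y : f (x + y) = f x + f y by rewrite -{1}[x]scale1r lf mul1r.
pose J x := nr x ^+ 2 - 2 * complex.Re (f x).
have Jlow x : - M ^+ 2 <= J x.
  rewrite /J; have := Re_le_nr (f x); have := hM x.
  have := sqr_ge0 (nr x - M); rewrite sqrrB; nra.
pose S := [set J x | x in [set: H]].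
have hS : has_inf S.
  by split; [exists (J 0), 0 | exists (- M ^+ 2) => _ [x _ <-]].
pose m := inf S.
have mJ x : m <= J x by apply: inf_lbound; [case: hS|exists x].
have exn n : exists x, J x < m + n.+1%:R^-1.
  have e0 : 0 < n.+1%:R^-1 :> R by rewrite invr_gt0 ltr0n.
  by have [_ [x _ <-] hx] := inf_adherent e0 hS; exists x.
have [u hu] := choice exn.
(* The parallelogram law, with [J] bounded below by [m] at the midpoint: near-minimisers are close
   to each other, so the minimising sequence [u] is Cauchy. *)
have Jpar x y : nr (x - y) ^+ 2 <= 2 * (J x + J y - 2 * m).
  have := mJ (2^-1%:C *: (x + y)).
  rewrite /J nrZ nrR ger0_norm ?invr_ge0 // fZ ReZ fD ReD exprMn.
  have := parallelogram x y.
  set A := nr (x + y) ^+ 2; set B := nr (x - y) ^+ 2.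
  set Rx := complex.Re (f x); set Ry := complex.Re (f y).
  have -> : (2^-1 : R) ^+ 2 = 4^-1 by field.
  lra.
have hsq (d e : R) : 0 <= d -> 0 < e -> d ^+ 2 < e ^+ 2 -> d < e.
  by move=> d0 e0; rewrite ltr_pXn2r ?nnegrE // ltW.
have [z hz] : exists z, forall e : R, 0 < e ->
    exists N, forall n, (N <= n)%N -> nr (u n - z) < e.
  apply: complete_nr => e e0.
  have e2 : 0 < e ^+ 2 / 4 by rewrite divr_gt0 ?exprn_gt0.
  have [N _ hN] := near_infty_natSinv_lt (PosNum e2).
  exists N => n p Nn Np; apply: hsq; rewrite ?nr_ge0 //.
  have := Jpar (u n) (u p); have := hu n; have := hu p.
  have := hN _ Nn; have := hN _ Np => /=.
  move: (n.+1%:R^-1) (p.+1%:R^-1) (J (u n)) (J (u p)) (nr _ ^+ 2) => a b c d q.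
  lra.
have Jz : J z <= m.
  apply/ler_addgt0Pr => e e0.
  pose c := 2 * nr z + 2 * `|M| + 2.
  have c0 : 0 < c by rewrite /c; have := nr_ge0 z; have := normr_ge0 M; lra.
  have e1 : 0 < Num.min 1 (e / (2 * c)) by rewrite lt_min ltr01 divr_gt0 ?mulr_gt0.
  have [N hN] := hz _ e1.
  have e2 : 0 < e / 2 by rewrite divr_gt0.
  have [N' _ hN'] := near_infty_natSinv_lt (PosNum e2).
  pose n := maxn N N'.
  have := hN n (leq_maxl _ _); have := hN' n (leq_maxr _ _) => /= h1.
  rewrite lt_min => /andP[h2 h3].
  have h4 : (2 * c) * nr (u n - z) < e by rewrite mulrC -ltr_pdivlMr ?mulr_gt0.
  have h5 := hu n.
  have h6 : nr z <= nr (u n) + nr (u n - z) by rewrite nr_dist nr_le_dist.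
  have h6' : nr (u n) <= nr z + nr (u n - z) by apply: nr_le_dist.
  have h7 : complex.Re (f (u n)) = complex.Re (f z) + complex.Re (f (u n - z)).
    by rewrite -ReD -fD addrC subrK.
  have h8 : complex.Re (f (u n - z)) <= `|M| * nr (u n - z).
    apply: le_trans (Re_le_nr _) (le_trans (hM _) _).
    by rewrite ler_wpM2r ?nr_ge0 ?ler_norm.
  have := nr_ge0 (u n - z); have := nr_ge0 z; have := nr_ge0 (u n).
  move: h2 h4 h5 h6 h6' h7 h8; rewrite /J /c.
  set d := nr (u n - z); set a := nr z; set b := nr (u n).
  set K := `|M|; have := normr_ge0 M; rewrite -/K.
  move=> K0 d1 dc hu' hab hba hf hfd b0 a0 d0.
  have hsq1 : a ^+ 2 - b ^+ 2 <= d * (2 * a + 1).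
    have [ab|ba] := lerP b a; last by nra.
    nra.
  move: h1 hu' hsq1 hf hfd dc; rewrite -/m.
  move: (n.+1%:R^-1) (complex.Re (f (u n))) (complex.Re (f z)) => r A B.
  move: (complex.Re (f (u n - z))) (a ^+ 2) (b ^+ 2) (m) => G a2 b2 mm.
  clear - d0; move=> h1 h2 h3 hA h4 h5; nra.
exists z.
have ReE y : complex.Re (f y) = complex.Re (dot y z).
  (* Minimality along the real line through [z] in the direction [y]. A quadratic in [t] without
     constant term stays nonnegative only if its linear coefficient vanishes. *)
  have q (t : R) : 0 <= t ^+ 2 * nr y ^+ 2 +
      2 * t * (complex.Re (dot y z) - complex.Re (f y)).
    have := mJ (z + t%:C *: y); move: Jz; rewrite /J nr_sqD nrZ nrR fD fZ ReD ReZ.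
    rewrite dotZr conjc_real ReZ dotC Re_conjc exprMn real_normK ?num_real //; lra.
  set b := complex.Re (dot y z) - complex.Re (f y) in q.
  have b0 : b = 0.
    have [y0|y0] := eqVneq (nr y) 0.
      by have := q 1; have := q (-1); rewrite y0; lra.
    have ny : 0 < nr y ^+ 2 by rewrite exprn_even_gt0.
    have := q (- b / nr y ^+ 2).
    have -> : (- b / nr y ^+ 2) ^+ 2 * nr y ^+ 2 + 2 * (- b / nr y ^+ 2) * b
       = - (b ^+ 2 / nr y ^+ 2) by field; exact: y0.
    rewrite oppr_ge0 pmulr_lle0 ?invr_gt0 // => h.
    by apply/eqP; rewrite -sqrf_eq0 eq_le h sqr_ge0.
  by move: b0; rewrite /b => /eqP; rewrite subr_eq0 => /eqP.
(* The imaginary part at [x] is the real part at [- 'i *: x]. *)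
move=> x; apply: eq_ReIm => //.
by rewrite -[LHS]Re_mulNi -[RHS]Re_mulNi -fZ -dotZl ReE.
Qed.

End Dot.

Section Adjoint.
Context (H K : hilbertType R).
Implicit Types (T : bop H K).

Lemma adj_exists T : exists S : bop K H, forall x y, dot (T x) y = dot x (S y).
Proof.
have ex y : exists z, forall x, dot (T x) y = dot x z.
  apply: (@riesz H (fun x => dot (T x) y) (opnorm T * nr y)).
    by move=> a u v; rewrite linearP dotP.
  move=> x; apply: le_trans (CauchySchwarz _ _) _.
  by rewrite mulrAC ler_wpM2r ?nr_ge0 ?opnormP.
have [S hS] := choice ex.
have [||g hg] := @mkbop _ _ _ S (opnorm T).
- move=> a u v; apply: dot_injr => x.
  by rewrite -hS dotDr dotZr dotDr dotZr -!hS.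
- move=> y; have [->|y0] := eqVneq (S y) 0.
    by rewrite nr0 mulr_ge0 ?opnorm_ge0 ?nr_ge0.
  have ny : 0 < nr (S y) by rewrite lt_neqAle nr_ge0 eq_sym nr_eq0 y0.
  rewrite -(ler_pM2l ny) -expr2.
  have -> : nr (S y) ^+ 2 = nr (dot (S y) (S y)).
    by rewrite dot_nr nrR ger0_norm ?exprn_ge0 ?nr_ge0.
  rewrite -hS; apply: le_trans (CauchySchwarz _ _) _.
  by rewrite mulrA ler_wpM2r ?nr_ge0 // mulrC opnormP.
by exists g => x y; rewrite hg hS.
Qed.

Lemma adjP T x y : dot (T x) y = dot x (adj T y).
Proof.
have [S hS] := adj_exists T.
pose P := [set S0 : bop K H | forall x y, dot (T x) y = dot x (S0 y)].
exact: (@xgetI _ 0 P S hS).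
Qed.

Lemma adj_unique T (S : bop K H) :
  (forall x y, dot (T x) y = dot x (S y)) -> adj T = S.
Proof.
by move=> h; apply: bopE => y; apply: dot_injr => x; rewrite -adjP h.
Qed.

End Adjoint.

Lemma adjPr (H K : hilbertType R) (T : bop H K) x y : dot (adj T y) x = dot y (T x).
Proof. by rewrite dotC -adjP -dotC. Qed.

Lemma adjK (H K : hilbertType R) (T : bop H K) : adj (adj T) = T.
Proof. by apply: adj_unique => x y; rewrite adjPr. Qed.

Section AdjointTheory.
Context (H K : hilbertType R).
Implicit Types (S T : bop H K).

Lemma adjD S T : adj (S + T) = adj S + adj T.
Proof. by apply: adj_unique => x y; rewrite dotDl dotDr !adjP. Qed.

Lemma adjZ a T : adj (a *: T) = conjc a *: adj T.
Proof. by apply: adj_unique => x y; rewrite dotZl dotZr conjcK adjP. Qed.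

Lemma adjN T : adj (- T) = - adj T.
Proof. by apply: adj_unique => x y; rewrite dotNl dotNr adjP. Qed.

Lemma adjB S T : adj (S - T) = adj S - adj T.
Proof. by rewrite adjD adjN. Qed.

Lemma adj0 : adj (0 : bop H K) = 0.
Proof. by apply: adj_unique => x y; rewrite dot0l dot0r. Qed.

Lemma adj_sum I (r : seq I) (P : pred I) (F : I -> bop H K) :
  adj (\sum_(i <- r | P i) F i) = \sum_(i <- r | P i) adj (F i).
Proof. by elim/big_rec2: _ => [|i a b _ <-]; rewrite ?adj0 ?adjD. Qed.

Lemma adj_comp (L : hilbertType R) (A : bop K L) T :
  adj (bop_comp A T) = bop_comp (adj T) (adj A).
Proof. by apply: adj_unique => x y; rewrite /= !adjP. Qed.

(** The C*-identity. Here the adjoint is bounded directly by Cauchy-Schwarz, because [opnorm_adj] is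
    deduced from this identity. *)
Lemma opnorm_star_sq T : opnorm (bop_comp (adj T) T) = opnorm T ^+ 2.
Proof.
have h (S : bop H K) : opnorm S ^+ 2 <= opnorm (bop_comp (adj S) S).
  rewrite -[leRHS]sqr_sqrtr ?opnorm_ge0 // ler_pXn2r ?nnegrE ?opnorm_ge0 //.
  apply: opnorm_le => // x.
  rewrite -(ler_pXn2r (n := 2)) ?nnegrE ?mulr_ge0 ?nr_ge0 //.
  rewrite exprMn sqr_sqrtr ?opnorm_ge0 //.
  have -> : nr (S x) ^+ 2 = nr (dot (bop_comp (adj S) S x) x).
    by rewrite adjPr dot_nr nrR ger0_norm ?exprn_ge0 ?nr_ge0.
  apply: le_trans (CauchySchwarz _ _) _.
  by rewrite expr2 mulrA ler_wpM2r ?nr_ge0 ?opnormP.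
have a_le : opnorm (adj T) <= opnorm T.
  apply: opnorm_le => [|y]; first exact: opnorm_ge0.
  have [->|y0] := eqVneq (adj T y) 0.
    by rewrite nr0 mulr_ge0 ?opnorm_ge0 ?nr_ge0.
  have ny : 0 < nr (adj T y) by rewrite lt_neqAle nr_ge0 eq_sym nr_eq0 y0.
  rewrite -(ler_pM2l ny) -expr2.
  have -> : nr (adj T y) ^+ 2 = nr (dot (adj T y) (adj T y)).
    by rewrite dot_nr nrR ger0_norm ?exprn_ge0 ?nr_ge0.
  rewrite -adjP; apply: le_trans (CauchySchwarz _ _) _.
  by rewrite mulrA ler_wpM2r ?nr_ge0 // mulrC opnormP.
apply/eqP; rewrite eq_le h andbT; apply: le_trans (opnorm_comp _ _) _.
by rewrite expr2 ler_wpM2r ?opnorm_ge0.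
Qed.

End AdjointTheory.

Lemma opnorm_adj (H K : hilbertType R) (T : bop H K) : opnorm (adj T) = opnorm T.
Proof.
have h (H1 K1 : hilbertType R) (S : bop H1 K1) : opnorm S <= opnorm (adj S).
  have [->|S0] := eqVneq (opnorm S) 0; first exact: opnorm_ge0.
  have p : 0 < opnorm S by rewrite lt_neqAle opnorm_ge0 eq_sym S0.
  by rewrite -(ler_pM2r p) -expr2 -opnorm_star_sq opnorm_comp.
by apply/eqP; rewrite eq_le h andbT -{2}[T]adjK h.
Qed.

Section Ring.
Context (V : normedModType R[i]).
Implicit Types (a b c : bop V V).

Fact bop_mulA : associative (@bop_comp R V V V).
Proof. by move=> a b c; apply: bopE. Qed.
Fact bop_mul1 : left_id (bop_id V) (@bop_comp R V V V).
Proof. by move=> a; apply: bopE. Qed.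
Fact bop_mulr1 : right_id (bop_id V) (@bop_comp R V V V).
Proof. by move=> a; apply: bopE. Qed.
Fact bop_mulDl : left_distributive (@bop_comp R V V V) +%R.
Proof. by move=> a b c; apply: bopE. Qed.
Fact bop_mulDr : right_distributive (@bop_comp R V V V) +%R.
Proof. by move=> a b c; apply: bopE => x; exact: (linearD a). Qed.

HB.instance Definition _ :=
  GRing.Zmodule_isPzRing.Build (bop V V) bop_mulA bop_mul1 bop_mulr1 bop_mulDl bop_mulDr.

Lemma bop_mulE a b x : (a * b) x = a (b x). Proof. by []. Qed.
Lemma bop_oneE x : (1 : bop V V) x = x. Proof. by []. Qed.

Lemma bop_scaleAl k a b : k *: (a * b) = (k *: a) * b.
Proof. by apply: bopE. Qed.
Lemma bop_scaleAr k a b : k *: (a * b) = a * (k *: b).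
Proof. by apply: bopE => x; rewrite bop_mulE bop_scaleE linearZ. Qed.

Lemma opnormM a b : opnorm (a * b) <= opnorm a * opnorm b.
Proof. exact: opnorm_comp. Qed.

Lemma opnorm1_le : opnorm (1 : bop V V) <= 1.
Proof. by apply: opnorm_le => // x; rewrite mul1r. Qed.

End Ring.

Section RingAdj.
Context (H : hilbertType R).
Implicit Types (a b c : 'B(H)).

Lemma adjM a b : adj (a * b) = adj b * adj a.
Proof. exact: adj_comp. Qed.

Lemma adj1 : adj (1 : 'B(H)) = 1.
Proof. by apply: adj_unique. Qed.

Lemma opnorm_starM a : opnorm (adj a * a) = opnorm a ^+ 2.
Proof. exact: opnorm_star_sq. Qed.

End RingAdj.

End HilbertSpace.

(** * Completeness and square roots *)

Section Completeness.
Context {R : realType}.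

Lemma le_eps (a b : R) : (forall e, 0 < e -> a <= b + e) -> a <= b.
Proof. by move=> h; apply/ler_addgt0Pr. Qed.

Lemma nr_lim_unique (V : normedZmodType R[i]) (a b : V) :
  (forall e : R, 0 < e -> nr (a - b) <= e) -> a = b.
Proof.
move=> h; apply/eqP; rewrite -subr_eq0 -nr_eq0 eq_le nr_ge0 andbT.
by apply: le_eps => e e0; rewrite add0r h.
Qed.

(** The limit exists pointwise by completeness of [W]. In [key] the second index goes to infinity at
    each vector separately, which keeps the bound relative to [nr x] and so gives convergence in
    norm. *)
Lemma bop_complete (V : normedModType R[i]) (W : completeNormedModType R[i])
    (u : nat -> bop V W) :
  (forall e : R, 0 < e -> exists N, forall n m, (N <= n)%N -> (N <= m)%N ->
     opnorm (u n - u m) < e) ->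
  exists l : bop V W,
    forall e : R, 0 < e -> exists N, forall n, (N <= n)%N -> opnorm (u n - l) <= e.
Proof.
move=> h.
have ex x : exists l, forall e : R, 0 < e ->
    exists N, forall n, (N <= n)%N -> nr (u n x - l) < e.
  apply: complete_nr => e e0.
  have e1 : 0 < e / (nr x + 1) by rewrite divr_gt0 // ltr_wpDl ?nr_ge0.
  have [N hN] := h _ e1; exists N => n m Nn Nm.
  have := hN _ _ Nn Nm; rewrite ltr_pdivlMr ?ltr_wpDl ?nr_ge0 // => /le_lt_trans; apply.
  have -> : u n x - u m x = (u n - u m) x by [].
  by apply: le_trans (opnormP _ _) _; rewrite ler_wpM2l ?opnorm_ge0 // lerDl.
have [l hl] := choice ex.
have key (e : R) : 0 < e -> exists N, forall n, (N <= n)%N -> forall x,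
    nr (u n x - l x) <= e * nr x.
  move=> e0; have [N hN] := h _ e0; exists N => n Nn x.
  apply: le_eps => d d0; have [N' hN'] := hl x _ d0.
  pose m := maxn N N'.
  apply: le_trans (nr_triangle (u m x) _ _) (lerD _ _); last first.
    by rewrite ltW // hN' // leq_maxr.
  have -> : u n x - u m x = (u n - u m) x by [].
  by apply: opnorm_le_nr; rewrite ltW // hN // leq_maxl.
have lin_l : linear l.
  move=> a x y; apply: nr_lim_unique => e e0.
  pose c := nr (a *: x + y) + nr a * nr x + nr y + 1.
  have c0 : 0 < c by rewrite ltr_wpDl ?addr_ge0 ?mulr_ge0 ?nr_ge0.
  have e1 : 0 < e / c by rewrite divr_gt0.
  have [N hN] := key _ e1.
  have -> : l (a *: x + y) - (a *: l x + l y) =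
     - (u N (a *: x + y) - l (a *: x + y)) + (a *: (u N x - l x) + (u N y - l y)).
    by rewrite [u N _]linearP scalerBr opprB [X in _ = _ + X]addrACA -[- (_ *: _) - _]opprD subrKA.
  apply: le_trans (nrD _ _) _; rewrite nrN.
  apply: le_trans (lerD (lexx _) (nrD _ _)) _; rewrite nrZ.
  apply: le_trans (lerD (hN _ (leqnn _) _)
    (lerD (ler_wpM2l (nr_ge0 a) (hN _ (leqnn _) _)) (hN _ (leqnn _) _))) _.
  have ed : e = e / c * c by rewrite mulfVK ?gt_eqF.
  rewrite [leRHS]ed; move: (e / c) e1 => d d0; rewrite /c; nra.
have [N1 hN1] := key _ ltr01.
have [L hL] : exists g : bop V W, forall x, g x = l x.
  apply: (@mkbop _ _ _ l (opnorm (u N1) + 1)) => // x.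
  apply: le_trans (nr_le_dist _ (u N1 x)) _; rewrite nr_dist mulrDl.
  by apply: lerD (opnormP _ _) (hN1 _ (leqnn _) x).
exists L => e e0; have [N hN] := key _ e0; exists N => n Nn.
apply: opnorm_le => [|x]; first exact: ltW.
by rewrite bop_addE bop_oppE hL hN.
Qed.

Lemma exp_small (q e : R) : 0 <= q -> q < 1 -> 0 < e ->
  exists N, forall n, (N <= n)%N -> q ^+ n < e.
Proof.
move=> q0 q1 e0.
have h : `|q| < 1 by rewrite ger0_norm.
have /cvgrPdist_lt/(_ _ e0)[N _ hN] := cvg_expr h.
exists N => n /hN; rewrite sub0r normrN ger0_norm ?exprn_ge0 //.
Qed.

Section Sqrt.
Context (H : hilbertType R) (A : set 'B(H)) (hA : cstar_subalgebra A).

Lemma cstar_add a b : A a -> A b -> A (a + b).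
Proof. by move=> Aa Ab; rewrite -[b]scale1r; apply: cstar_lin. Qed.
Lemma cstar_scale k a : A a -> A (k *: a).
Proof. by move=> Aa; rewrite -[k *: a]add0r; apply: cstar_lin => //; apply: cstar0. Qed.
Lemma cstar_sub a b : A a -> A b -> A (a - b).
Proof. by move=> Aa Ab; rewrite -scaleN1r; apply: cstar_lin. Qed.
Lemma cstar_mulr a b : A a -> A b -> A (a * b).
Proof. exact: cstar_mul. Qed.

(* Fixed point of [y |-> (x + y^2) / 2], a contraction of the ball of radius
   [q]; then [(1 - y)^2 = 1 - x]. *)
Lemma cstar_sqrt (x : 'B(H)) (q : R) : A x -> adj x = x -> opnorm x <= q -> q < 1 ->
  exists y, [/\ A y, adj y = y & y + y = x + y * y].
Proof.
move=> Ax sx xq q1; have q0 : 0 <= q by apply: le_trans xq; apply: opnorm_ge0.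
pose f (y : 'B(H)) := (2^-1)%:C *: (x + y * y).
have n2 : nr ((2^-1)%:C : R[i]) = 2^-1 by rewrite nrR ger0_norm ?invr_ge0.
have fball (y : 'B(H)) : opnorm y <= q -> opnorm (f y) <= q.
  move=> yq; rewrite /f opnormZ n2 ler_pdivrMl //.
  apply: le_trans (opnormD _ _) _; have := opnormM y y; have := opnorm_ge0 y; nra.
have fcontr (y z : 'B(H)) : opnorm y <= q -> opnorm z <= q ->
    opnorm (f y - f z) <= q * opnorm (y - z).
  move=> yq zq.
  have -> : f y - f z = (2^-1)%:C *: (y * (y - z) + (y - z) * z).
    by rewrite /f -scalerBr mulrBr mulrBl addrA subrK opprD addrACA subrr add0r.
  rewrite opnormZ n2 ler_pdivrMl //.
  apply: le_trans (opnormD _ _) _.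
  have := opnormM y (y - z); have := opnormM (y - z) z.
  have := opnorm_ge0 (y - z); nra.
pose u n : 'B(H) := iter n f 0.
have uS n : u n.+1 = f (u n) by [].
have uball n : opnorm (u n) <= q.
  by elim: n => [|n ih]; [rewrite opnorm0|apply: fball].
have ucauchy n k : opnorm (u (n + k)%N - u n) <= q ^+ n * q.
  elim: n => [|n ih]; first by rewrite subr0 expr0 mul1r.
  rewrite addSn !uS; apply: le_trans (fcontr _ _ _ _) _ => //.
  by rewrite exprS -mulrA ler_wpM2l.
have uA n : A (u n).
  elim: n => [|n ih]; first exact: cstar0.
  by apply: cstar_scale; apply: cstar_add => //; apply: cstar_mulr.
have usa n : adj (u n) = u n.
  elim: n => [|n ih]; first exact: adj0.
  by rewrite uS /f adjZ adjD adjM sx ih conjc_real.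
have qe (e : R) : 0 < e -> exists N, q ^+ N * q < e.
  move=> e0; have [N hN] := exp_small q0 q1 e0.
  by exists N; apply: le_lt_trans (hN N (leqnn _)); rewrite ler_piMr ?exprn_ge0 ?(ltW q1).
have [y hy] : exists l : 'B(H),
    forall e : R, 0 < e -> exists N, forall n, (N <= n)%N -> opnorm (u n - l) <= e.
  apply: bop_complete => e e0.
  have e2 : 0 < e / 2 by rewrite divr_gt0.
  have [N hN] := qe _ e2; exists N => n m /subnKC <- /subnKC <-.
  apply: le_lt_trans (opnorm_triangle (u N) _ _) _; rewrite [e]splitr ltrD //.
    exact: le_lt_trans (ucauchy _ _) hN.
  by rewrite opnorm_dist; apply: le_lt_trans (ucauchy _ _) hN.
have yq : opnorm y <= q.
  apply: le_eps => e e0; have [N /(_ N (leqnn _)) hN] := hy _ e0.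
  by apply: le_trans (opnorm_le_dist _ (u N)) _; rewrite opnorm_dist lerD.
exists y; split.
- apply: (cstar_closed hA) => e e0.
  have e2 : 0 < e / 2 by rewrite divr_gt0.
  have [N /(_ N (leqnn _)) hN] := hy _ e2; exists (u N) => //.
  by rewrite opnorm_dist; apply: le_lt_trans hN _; rewrite gtr_pMr ?invf_lt1 ?ltr1n.
- apply/eqP; rewrite -subr_eq0; apply/eqP/opnorm0_eq/eqP.
  rewrite eq_le opnorm_ge0 andbT; apply: le_eps => e e0; rewrite add0r.
  have e2 : 0 < e / 2 by rewrite divr_gt0.
  have [N /(_ N (leqnn _)) hN] := hy _ e2.
  apply: le_trans (opnorm_triangle (u N) _ _) _; rewrite [e]splitr lerD //.
  by rewrite -{1}usa -adjB opnorm_adj opnorm_dist.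
- have yf : y = f y.
    apply/eqP; rewrite -subr_eq0; apply/eqP/opnorm0_eq/eqP.
    rewrite eq_le opnorm_ge0 andbT; apply: le_eps => e e0; rewrite add0r.
    have e2 : 0 < e / 2 by rewrite divr_gt0.
    have [N hN] := hy _ e2.
    apply: le_trans (opnorm_triangle (u N.+1) _ _) _; rewrite [e]splitr lerD //.
      by rewrite opnorm_dist hN.
    rewrite uS; apply: le_trans (fcontr _ _ _ _) _ => //.
    by apply: le_trans (hN _ (leqnn _)); rewrite ler_piMl ?opnorm_ge0 ?(ltW q1).
  rewrite {1 2}yf /f -scalerDl -[RHS]scale1r; congr (_ *: _).
  by rewrite -rmorphD; have -> : (2^-1 + 2^-1 = 1 :> R) by lra.
Qed.

End Sqrt.

Section Extension.
Context (V : normedModType R[i]) (W : completeNormedModType R[i]).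

(** Extension by continuity for a densely defined linear relation. The bound makes [G] single
    valued, so an operator can be prescribed on finite combinations of a family without first
    showing that the value does not depend on the combination. *)
Lemma graph_extension (G : set (V * W)) (M : R) : 0 <= M ->
  (forall (a : R[i]) p q, G p -> G q -> G (a *: p.1 + q.1, a *: p.2 + q.2)) ->
  (forall p, G p -> nr p.2 <= M * nr p.1) ->
  (forall x (e : R), 0 < e -> exists2 p, G p & nr (x - p.1) < e) ->
  exists c : bop V W, (forall p, G p -> c p.1 = p.2) /\ opnorm c <= M.
Proof.
move=> M0 Glin Gb Gd.
have Gsub p q : G p -> G q -> nr (p.2 - q.2) <= M * nr (p.1 - q.1).
  by move=> Gp Gq; have := Gb _ (Glin (-1) _ _ Gq Gp); rewrite /= !scaleN1r ![- _ + _]addrC.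
have ex x : exists l, forall (e : R), 0 < e -> exists2 d : R, 0 < d &
    forall p, G p -> nr (x - p.1) < d -> nr (l - p.2) < e.
  have exn (n : nat) : exists p, G p /\ nr (x - p.1) < n.+1%:R^-1.
    have e0 : 0 < n.+1%:R^-1 :> R by rewrite invr_gt0 ltr0n.
    by have [p] := Gd x _ e0; exists p.
  have [s hs] := choice exn.
  have small (e : R) : 0 < e -> exists N, forall n, (N <= n)%N ->
      M * nr (x - (s n).1) < e.
    move=> e0; have e1 : 0 < e / (M + 1) by rewrite divr_gt0 // ltr_wpDl.
    have [N _ hN] := near_infty_natSinv_lt (PosNum e1).
    exists N => n /hN /=; have [_] := hs n.
    rewrite ltr_pdivlMr ?ltr_wpDl //.
    move: (n.+1%:R^-1) (nr_ge0 (x - (s n).1)) => r; nra.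
  have [l hl] : exists l, forall e : R, 0 < e ->
      exists N, forall n, (N <= n)%N -> nr ((s n).2 - l) < e.
    apply: complete_nr => e e0; have e2 : 0 < e / 2 by rewrite divr_gt0.
    have [N hN] := small _ e2; exists N => n m Nn Nm.
    have [[Gn _] [Gm _]] := (hs n, hs m).
    apply: le_lt_trans (Gsub _ _ Gn Gm) _.
    have := ler_wpM2l M0 (nr_triangle x (s n).1 (s m).1).
    rewrite mulrDr [nr ((s n).1 - x)]nr_dist.
    have := hN _ Nn; have := hN _ Nm; lra.
  exists l => e e0; have e4 : 0 < e / 4 by rewrite divr_gt0.
  exists (e / 4 / (M + 1)); first by rewrite divr_gt0 // ltr_wpDl.
  move=> p Gp; rewrite ltr_pdivlMr ?ltr_wpDl // => hp.
  have [N hN] := small _ e4; have [N' hN'] := hl _ e4.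
  pose n := maxn N N'; have := hN n (leq_maxl _ _); have := hN' n (leq_maxr _ _).
  have := Gsub _ _ (proj1 (hs n)) Gp; have := nr_triangle (s n).2 l p.2.
  rewrite [nr (l - (s n).2)]nr_dist.
  have := ler_wpM2l M0 (nr_triangle x (s n).1 p.1).
  rewrite mulrDr [nr ((s n).1 - x)]nr_dist.
  have := nr_ge0 (x - p.1); nra.
have [c hc] := choice ex.
have cG p : G p -> c p.1 = p.2.
  move=> Gp; apply: nr_lim_unique => e e0; have [d d0 hd] := hc p.1 _ e0.
  by apply/ltW/hd => //; rewrite subrr nr0.
have cb x : nr (c x) <= M * nr x.
  apply: le_eps => e e0; have e2 : 0 < e / 2 by rewrite divr_gt0.
  have [d d0 hd] := hc x _ e2.
  have e3 : 0 < Num.min d (e / 2 / (M + 1)) by rewrite lt_min d0 divr_gt0 // ltr_wpDl.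
  have [p Gp] := Gd x _ e3; rewrite lt_min => /andP[p1 p2].
  move: p2; rewrite ltr_pdivlMr ?ltr_wpDl // => p2.
  have := nr_le_dist (c x) p.2; have := hd _ Gp p1; have := Gb _ Gp.
  have := nr_le_dist p.1 x; rewrite [nr (p.1 - x)]nr_dist.
  have := nr_ge0 (x - p.1); nra.
have clin : linear c.
  move=> a x y; apply: nr_lim_unique => e e0.
  pose k := nr a + 2.
  have k0 : 0 < k by rewrite ltr_wpDl ?nr_ge0.
  have e1 : 0 < e / k by rewrite divr_gt0.
  have [d1 d10 h1] := hc x _ e1; have [d2 d20 h2] := hc y _ e1.
  have [d3 d30 h3] := hc (a *: x + y) _ e1.
  have d4 : 0 < Num.min d1 (d3 / k) by rewrite lt_min d10 divr_gt0.
  have d5 : 0 < Num.min d2 (d3 / k) by rewrite lt_min d20 divr_gt0.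
  have [p Gp] := Gd x _ d4; rewrite lt_min => /andP[p1 p2].
  have [q Gq] := Gd y _ d5; rewrite lt_min => /andP[q1 q2].
  have Gpq := Glin a _ _ Gp Gq.
  have := h3 _ Gpq; rewrite /= => /(_ _); have := h1 _ Gp p1; have := h2 _ Gq q1.
  have -> : a *: x + y - (a *: p.1 + q.1) = a *: (x - p.1) + (y - q.1).
    by rewrite scalerBr opprD addrACA.
  move=> w1 w2 w3.
  have w4 : nr (a *: (x - p.1) + (y - q.1)) < d3.
    apply: le_lt_trans (nrD _ _) _; rewrite nrZ.
    move: p2 q2; rewrite !ltr_pdivlMr //; have := nr_ge0 a.
    have := nr_ge0 (x - p.1); have := nr_ge0 (y - q.1); rewrite /k; nra.
  have := w3 w4 => {}w3.
  have -> : c (a *: x + y) - (a *: c x + c y) =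
     (c (a *: x + y) - (a *: p.2 + q.2)) - (a *: (c x - p.2) + (c y - q.2)).
    by rewrite scalerBr [in RHS]addrACA -[in RHS]opprD opprB addrA subrK.
  apply: le_trans (nrB _ _) _; apply: le_trans (lerD (lexx _) (nrD _ _)) _.
  rewrite nrZ; move: w1 w2 w3; rewrite !ltr_pdivlMr //.
  have := nr_ge0 a; rewrite /k; nra.
have [g hg] := mkbop clin cb.
exists g; split=> [p Gp|]; first by rewrite hg cG.
by apply: opnorm_le => // x; rewrite hg.
Qed.

End Extension.

End Completeness.

(** * Tensor products of operators *)

Section Total.
Context {R : realType}.

Lemma bop_suml (V W : normedModType R[i]) (f : bop V W) I (r : seq I) (P : pred I)
    (F : I -> V) : f (\sum_(i <- r | P i) F i) = \sum_(i <- r | P i) f (F i).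
Proof. by elim/big_rec2: _ => [|i a b _ <-]; rewrite ?linear0 ?linearD. Qed.

Lemma bop_compE (U V W : normedModType R[i]) (f : bop V W) (g : bop U V) x :
  bop_comp f g x = f (g x).
Proof. by []. Qed.

Section Linear.
Context (V W : normedModType R[i]) (f : bop V W).
Lemma bopZ a x : f (a *: x) = a *: f x. Proof. exact: linearZ. Qed.
Lemma bopD x y : f (x + y) = f x + f y. Proof. exact: linearD. Qed.
Lemma bopB x y : f (x - y) = f x - f y. Proof. exact: linearB. Qed.
Lemma bop0 : f 0 = 0. Proof. exact: linear0. Qed.
End Linear.

Definition total (I : Type) (H : hilbertType R) (u : I -> H) :=
  closure (lin_span (range u)) = [set: H].

Section Family.
Context (I : Type) (H : hilbertType R) (u : I -> H).

Lemma lin_span_range v : lin_span (range u) v ->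
  exists s : seq (R[i] * I), v = \sum_(p <- s) p.1 *: u p.2.
Proof.
case=> s [hs ->]; elim: s hs => [|[a x] s ih] hs.
  by exists [::]; rewrite !big_nil.
have [|t ht] := ih; first by move=> p ps; apply: hs; rewrite inE ps orbT.
have [i _ ui] : range u x by apply: (hs (a, x)); rewrite mem_head.
by exists ((a, i) :: t); rewrite !big_cons ht /= ui.
Qed.

Lemma total_near : total u -> forall x (e : R), 0 < e ->
  exists s : seq (R[i] * I), nr (x - \sum_(p <- s) p.1 *: u p.2) < e.
Proof.
move=> tu x e e0; have : closure (lin_span (range u)) x by rewrite tu.
by move=> /closureP_nr/(_ _ e0)[_ /lin_span_range[s ->]]; exists s.
Qed.

Lemma total_op_eq (W : normedModType R[i]) (A B : bop H W) : total u ->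
  (forall i, A (u i) = B (u i)) -> A = B.
Proof.
move=> tu h; apply: bopE => x; apply: nr_lim_unique => e e0.
pose c := opnorm (A - B) + 1.
have c0 : 0 < c by rewrite ltr_wpDl ?opnorm_ge0.
have ec : 0 < e / c by rewrite divr_gt0.
have [s] := total_near tu x ec; rewrite ltr_pdivlMr // => hs.
have z0 : (A - B) (\sum_(p <- s) p.1 *: u p.2) = 0.
  rewrite bop_suml big1 // => p _.
  by rewrite bopZ bop_addE bop_oppE h subrr scaler0.
have -> : A x - B x = (A - B) (x - \sum_(p <- s) p.1 *: u p.2).
  by rewrite bopB z0 subr0.
apply: le_trans (opnormP _ _) _; apply: le_trans (ltW hs).
by rewrite mulrC ler_wpM2l ?nr_ge0 // lerDl.
Qed.

Lemma total_vec_eq (x y : H) : total u ->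
  (forall i, dot x (u i) = dot y (u i)) -> x = y.
Proof.
move=> tu h; apply: nr_lim_unique => e e0.
have [s hs] := total_near tu (x - y) e0.
set z := x - y in hs *.
have z0 : dot z (\sum_(p <- s) p.1 *: u p.2) = 0.
  rewrite dot_sumr big1 // => p _.
  by rewrite dotZr dotBl h subrr mulr0.
have [->|nz] := eqVneq (nr z) 0; first exact: ltW.
have nz0 : 0 < nr z by rewrite lt_neqAle nr_ge0 eq_sym nz.
rewrite -(ler_pM2l nz0) -expr2.
have -> : nr z ^+ 2 = nr (dot z (z - \sum_(p <- s) p.1 *: u p.2)).
  by rewrite dotBr z0 subr0 dot_nr nrR ger0_norm ?exprn_ge0 ?nr_ge0.
by apply: le_trans (CauchySchwarz _ _) _; rewrite ler_wpM2l ?nr_ge0 // ltW.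
Qed.

(** Proportional Gram matrices make the assignment of [w i] to [u i] well defined and bounded on
    finite combinations. The factor [k] serves [basis_tensor], where tensoring with a fixed vector
    [x] multiplies inner products by the square of its norm. *)
Lemma isometry_extension (K : hilbertType R) (w : I -> K) (k : R) : 0 <= k ->
  total u -> (forall i j, dot (w i) (w j) = k%:C * dot (u i) (u j)) ->
  exists V : bop H K, (forall i, V (u i) = w i) /\
    forall x y, dot (V x) (V y) = k%:C * dot x y.
Proof.
move=> k0 tu hw.
pose G := [set p : H * K | exists s : seq (R[i] * I),
   p = (\sum_(q <- s) q.1 *: u q.2, \sum_(q <- s) q.1 *: w q.2)].
have gram (s : seq (R[i] * I)) : nr (\sum_(q <- s) q.1 *: w q.2) ^+ 2 =
    k * nr (\sum_(q <- s) q.1 *: u q.2) ^+ 2.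
  apply: complexI; rewrite [(k * _)%:C]realcM -!dot_nr !dot_suml mulr_sumr.
  apply: eq_bigr => p _; rewrite !dot_sumr mulr_sumr; apply: eq_bigr => q _.
  by rewrite !dotZl !dotZr hw; ring.
have [||||V [hV _]] := @graph_extension _ _ _ G (Num.sqrt k).
- exact: sqrtr_ge0.
- move=> a _ _ [s ->] [t ->]; exists ([seq (a * q.1, q.2) | q <- s] ++ t).
  rewrite !big_cat !big_map /= !scaler_sumr.
  by congr (_ + _, _ + _); apply: eq_bigr => q _; rewrite scalerA.
- move=> _ [s ->] /=; rewrite -(ler_pXn2r (n := 2)) ?nnegrE ?mulr_ge0 ?nr_ge0 ?sqrtr_ge0 //.
  by rewrite exprMn sqr_sqrtr // gram.
- move=> x e e0; have [s hs] := total_near tu x e0.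
  by exists (\sum_(q <- s) q.1 *: u q.2, \sum_(q <- s) q.1 *: w q.2); first by exists s.
have Vu i : V (u i) = w i.
  have := hV (u i, w i); apply; exists [:: (1, i)].
  by rewrite !big_seq1 !scale1r.
exists V; split=> // x y.
have -> : k%:C * dot x y = dot (k%:C *: x) y by rewrite dotZl.
suff E : bop_comp (adj V) V = k%:C *: (1 : 'B(H)).
  have : dot (bop_comp (adj V) V x) y = dot ((k%:C *: (1 : 'B(H))) x) y by rewrite E.
  by rewrite bop_compE adjPr bop_scaleE bop_oneE.
apply: (total_op_eq tu) => i; apply: (total_vec_eq tu) => j.
by rewrite bop_compE adjPr !Vu hw bop_scaleE bop_oneE dotZl.
Qed.

End Family.
End Total.

Section TensorOperators.
Context {R : realType}.

(** An unbundled form of [hilbert_tensor]. It is stable under exchange of the two factors, so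
    statements on one leg yield those on the other. *)
Record tensor_model (H K T : hilbertType R) (tau : H -> K -> T) : Prop := {
  tm_linl : forall a x x' y, tau (a *: x + x') y = a *: tau x y + tau x' y;
  tm_linr : forall a x y y', tau x (a *: y + y') = a *: tau x y + tau x y';
  tm_dot : forall x x' y y', dot (tau x y) (tau x' y') = dot x x' * dot y y';
  tm_total : total (fun p : H * K => tau p.1 p.2) }.

Lemma tensor_model_flip (H K T : hilbertType R) (tau : H -> K -> T) :
  tensor_model tau -> tensor_model (fun y x => tau x y).
Proof.
case=> l r d t; split=> // [x x' y y'|]; first by rewrite d mulrC.
rewrite /total -t; congr (closure (lin_span _)); apply/seteqP.
by split=> _ [[x y] _ <-]; exists (y, x).
Qed.

Lemma hilbert_tensor_model (H K T : hilbertType R) (tau : {bilinear H -> K -> T}) :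
  hilbert_tensor tau -> tensor_model tau.
Proof.
case=> d t; split=> //.
- by move=> a x x' y; rewrite linearPl.
- by move=> a x y y'; rewrite linearPr.
Qed.

Lemma cstar_setT (H : hilbertType R) : cstar_subalgebra [set: 'B(H)].
Proof. by split. Qed.

Section Model.
Context (H K T : hilbertType R) (tau : H -> K -> T) (ht : tensor_model tau).

Lemma tm_Zl a x y : tau (a *: x) y = a *: tau x y.
Proof.
have t0 : tau 0 y = 0.
  have := tm_linl ht 1 0 0 y; rewrite scaler0 addr0 scale1r.
  by move/(congr1 (fun c => c - tau 0 y)); rewrite addrK subrr.
by have := tm_linl ht a x 0 y; rewrite t0 !addr0.
Qed.

Lemma tm_Dl x x' y : tau (x + x') y = tau x y + tau x' y.
Proof. by rewrite -{1}[x]scale1r (tm_linl ht) scale1r. Qed.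

Lemma tm_nr x y : nr (tau x y) = nr x * nr y.
Proof.
apply/eqP; rewrite -(eqrXn2 (n := 2)) ?mulr_ge0 ?nr_ge0 //; apply/eqP.
apply: complexI; rewrite exprMn [(_ ^+ 2 * _)%:C]realcM -!dot_nr; exact: (tm_dot ht).
Qed.

(* For [|a| <= q < M] the square root [w] of [M^2 - a^* a] gives
   [|sum (a x) (x) y|^2 + |sum (w x) (x) y|^2 = M^2 |sum x (x) y|^2]. *)
Lemma tensor_left_bound (a : 'B(H)) (M : R) (s : seq (H * K)) : opnorm a < M ->
  nr (\sum_(p <- s) tau (a p.1) p.2) <= M * nr (\sum_(p <- s) tau p.1 p.2).
Proof.
move=> aM; have M0 : 0 < M := le_lt_trans (opnorm_ge0 a) aM.
pose b := (M^-1)%:C *: a.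
have b1 : opnorm b < 1.
  rewrite /b opnormZ nrR ger0_norm ?invr_ge0 ?(ltW M0) //.
  by rewrite ltr_pdivrMl // mulr1.
have [||||y [_ sy ey]] := cstar_sqrt (cstar_setT H) (x := adj b * b) (q := opnorm b ^+ 2).
- by [].
- by rewrite adjM adjK.
- by rewrite opnorm_starM.
- by rewrite exprn_ilt1 ?opnorm_ge0.
pose w := 1 - y.
have hw : adj w * w = 1 - adj b * b.
  have -> : adj b * b = y + y - y * y by rewrite ey addrK.
  rewrite /w adjB adj1 sy mulrBl mul1r mulrBr mulr1 !opprB -addrA opprD.
  by congr (_ + _); rewrite addrCA.
have hwx x : adj w (w x) + adj b (b x) = x.
  have -> : adj w (w x) = (1 - adj b * b) x by rewrite -hw.
  by rewrite bop_addE bop_oppE bop_oneE bop_mulE subrK.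
have gram (c : 'B(H)) : (nr (\sum_(p <- s) tau (c p.1) p.2) ^+ 2)%:C =
    \sum_(p <- s) \sum_(q <- s) dot (adj c (c p.1)) q.1 * dot p.2 q.2.
  rewrite -dot_nr dot_suml; apply: eq_bigr => p _.
  rewrite dot_sumr; apply: eq_bigr => q _.
  by rewrite (tm_dot ht) adjPr.
have pyth : nr (\sum_(p <- s) tau (w p.1) p.2) ^+ 2 +
    nr (\sum_(p <- s) tau (b p.1) p.2) ^+ 2 = nr (\sum_(p <- s) tau p.1 p.2) ^+ 2.
  have g1 := gram 1; rewrite adj1 /= in g1.
  apply: complexI; rewrite realcD !gram g1 -big_split /=.
  apply: eq_bigr => p _; rewrite -big_split; apply: eq_bigr => q _ /=.
  by rewrite -mulrDl -dotDl hwx.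
have eb : \sum_(p <- s) tau (a p.1) p.2 = M%:C *: \sum_(p <- s) tau (b p.1) p.2.
  rewrite scaler_sumr; apply: eq_bigr => p _.
  rewrite /b bop_scaleE tm_Zl scalerA -realcM mulfV ?gt_eqF //.
  by rewrite scale1r.
rewrite eb nrZ nrR ger0_norm ?(ltW M0) // ler_pM2l //.
rewrite -(ler_pXn2r (n := 2)) ?nnegrE ?nr_ge0 // -pyth lerDr sqr_ge0 //.
Qed.

(** [tensor_left_bound] asks for a strict inequality, so an operator is built for every [M] above
    the norm of [a]. By density all of them coincide, and [M] can decrease to that norm. *)
Lemma tensor_left (a : 'B(H)) :
  exists c : 'B(T), (forall x y, c (tau x y) = tau (a x) y) /\ opnorm c <= opnorm a.
Proof.
have step (M : R) : opnorm a < M -> exists c : 'B(T),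
    (forall x y, c (tau x y) = tau (a x) y) /\ opnorm c <= M.
  move=> aM; have M0 : 0 < M := le_lt_trans (opnorm_ge0 a) aM.
  pose G := [set p : T * T | exists s : seq (H * K),
     p = (\sum_(q <- s) tau q.1 q.2, \sum_(q <- s) tau (a q.1) q.2)].
  have [||||c [hc cM]] := @graph_extension _ _ _ G M.
  - exact: ltW.
  - move=> k _ _ [s ->] [t ->]; exists ([seq (k *: q.1, q.2) | q <- s] ++ t).
    rewrite !big_cat !big_map /= !scaler_sumr.
    by congr (_ + _, _ + _); apply: eq_bigr => q _; rewrite ?bopZ tm_Zl.
  - by move=> _ [s ->] /=; apply: tensor_left_bound.
  - move=> x e e0; have [s hs] := total_near (tm_total ht) x e0.
    pose t := [seq (p.1 *: p.2.1, p.2.2) | p <- s].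
    exists (\sum_(q <- t) tau q.1 q.2, \sum_(q <- t) tau (a q.1) q.2); first by exists t.
    rewrite /= big_map; move: hs; rewrite (eq_bigr (fun p => tau (p.1 *: p.2.1) p.2.2)) //.
    by move=> p _; rewrite tm_Zl.
  exists c; split=> // x y.
  have := hc (tau x y, tau (a x) y); apply.
  by exists [:: (x, y)]; rewrite !big_seq1.
have [c [hc _]] := step (opnorm a + 1) (ltr_pwDr ltr01 (lexx _)).
exists c; split=> //; apply: le_eps => e e0.
have [c' [hc' cM]] := step (opnorm a + e) (ltr_pwDr e0 (lexx _)).
suff -> : c = c' by [].
by apply: (total_op_eq (tm_total ht)) => p; rewrite hc hc'.
Qed.

End Model.

Section TensorOp.
Context (H K T : hilbertType R) (tau : {bilinear H -> K -> T}).
Hypothesis ht : hilbert_tensor tau.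
Let hm := hilbert_tensor_model ht.

(** The operator is the product of [a] on the first leg and [b] on the second, the latter coming
    from the flipped model. Its existence shows that [tensor_op] never takes its default value. *)
Lemma tensor_op_spec (a : 'B(H)) (b : 'B(K)) :
  (forall x y, tensor_op tau a b (tau x y) = tau (a x) (b y)) /\
  opnorm (tensor_op tau a b) <= opnorm a * opnorm b.
Proof.
have [c [hc nc]] := tensor_left hm a.
have [d [hd nd]] := tensor_left (tensor_model_flip hm) b.
pose P := [set c : 'B(T) | forall x y, c (tau x y) = tau (a x) (b y)].
have Pcd : P (c * d) by move=> x y; rewrite bop_mulE hd hc.
have PE : P (tensor_op tau a b) := xgetI 0 Pcd.
split=> //.
have -> : tensor_op tau a b = c * d.
  by apply: (total_op_eq (tm_total hm)) => p; rewrite PE Pcd.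
by apply: le_trans (opnormM _ _) _; rewrite ler_pM ?opnorm_ge0.
Qed.

Lemma tensor_opE a b x y : tensor_op tau a b (tau x y) = tau (a x) (b y).
Proof. by have [] := tensor_op_spec a b. Qed.

Lemma opnorm_tensor_op a b : opnorm (tensor_op tau a b) <= opnorm a * opnorm b.
Proof. by have [] := tensor_op_spec a b. Qed.

Lemma tensor_ext (A B : 'B(T)) : (forall x y, A (tau x y) = B (tau x y)) -> A = B.
Proof. by move=> h; apply: (total_op_eq (tm_total hm)) => p. Qed.

Lemma tensor_op_unique (a : 'B(H)) (b : 'B(K)) (A : 'B(T)) :
  (forall x y, A (tau x y) = tau (a x) (b y)) -> tensor_op tau a b = A.
Proof. by move=> h; apply: tensor_ext => x y; rewrite tensor_opE h. Qed.

Lemma tensor_opDl a a' b : tensor_op tau (a + a') b = tensor_op tau a b + tensor_op tau a' b.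
Proof. by apply: tensor_op_unique => x y; rewrite bop_addE !tensor_opE -linearDl. Qed.

Lemma tensor_opZl k a b : tensor_op tau (k *: a) b = k *: tensor_op tau a b.
Proof. by apply: tensor_op_unique => x y; rewrite bop_scaleE !tensor_opE -linearZl. Qed.

Lemma tensor_opDr a b b' : tensor_op tau a (b + b') = tensor_op tau a b + tensor_op tau a b'.
Proof. by apply: tensor_op_unique => x y; rewrite bop_addE !tensor_opE -linearDr. Qed.

Lemma tensor_opZr k a b : tensor_op tau a (k *: b) = k *: tensor_op tau a b.
Proof. by apply: tensor_op_unique => x y; rewrite bop_scaleE !tensor_opE -linearZr. Qed.

Lemma tensor_op0l b : tensor_op tau 0 b = 0.
Proof. by rewrite -(scale0r (0 : 'B(H))) tensor_opZl scale0r. Qed.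

Lemma tensor_op0r a : tensor_op tau a 0 = 0.
Proof. by rewrite -(scale0r (0 : 'B(K))) tensor_opZr scale0r. Qed.

Lemma tensor_opNl a b : tensor_op tau (- a) b = - tensor_op tau a b.
Proof. by rewrite -scaleN1r tensor_opZl scaleN1r. Qed.

Lemma tensor_opNr a b : tensor_op tau a (- b) = - tensor_op tau a b.
Proof. by rewrite -scaleN1r tensor_opZr scaleN1r. Qed.

Lemma tensor_op_suml I (r : seq I) (P : pred I) (F : I -> 'B(H)) b :
  tensor_op tau (\sum_(i <- r | P i) F i) b = \sum_(i <- r | P i) tensor_op tau (F i) b.
Proof. by elim/big_rec2: _ => [|i c d _ <-]; rewrite ?tensor_op0l ?tensor_opDl. Qed.

Lemma tensor_op_sumr I (r : seq I) (P : pred I) (F : I -> 'B(K)) a :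
  tensor_op tau a (\sum_(i <- r | P i) F i) = \sum_(i <- r | P i) tensor_op tau a (F i).
Proof. by elim/big_rec2: _ => [|i c d _ <-]; rewrite ?tensor_op0r ?tensor_opDr. Qed.

Lemma tensor_opM a a' b b' :
  tensor_op tau a b * tensor_op tau a' b' = tensor_op tau (a * a') (b * b').
Proof. by apply/esym/tensor_op_unique => x y; rewrite bop_mulE !tensor_opE. Qed.

Lemma tensor_op1 : tensor_op tau 1 1 = 1.
Proof. exact: tensor_op_unique. Qed.

Lemma tensor_op_adj a b : adj (tensor_op tau a b) = tensor_op tau (adj a) (adj b).
Proof.
apply/esym/tensor_op_unique => x y; apply: (total_vec_eq (tm_total hm)) => -[x' y'] /=.
by case: ht => hd _; rewrite adjPr tensor_opE !hd !adjPr.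
Qed.

Lemma tensor_dot x x' y y' : dot (tau x y) (tau x' y') = dot x x' * dot y y'.
Proof. by case: ht. Qed.

End TensorOp.
End TensorOperators.

(** * Asymptotic representations *)

Section Vanish.
Context {R : realType}.

Definition vanishes (V W : normedModType R[i]) (F : R -> bop V W) :=
  forall e : R, 0 < e -> \forall t \near +oo, opnorm (F t) <= e.

Definition ev_bounded (V W : normedModType R[i]) (F : R -> bop V W) :=
  exists2 M : R, 0 < M & \forall t \near +oo, opnorm (F t) <= M.

Section Basic.
Context (V W : normedModType R[i]).
Implicit Types F G : R -> bop V W.

Lemma cvg_vanishes F : opnorm (F t) @[t --> +oo] --> (0 : R) <-> vanishes F.
Proof.
split=> [/cvgrPdist_le h e e0|h].
  by apply: filterS (h _ e0) => t; rewrite sub0r normrN ger0_norm ?opnorm_ge0.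
apply/cvgrPdist_le => e e0; apply: filterS (h _ e0) => t.
by rewrite sub0r normrN ger0_norm ?opnorm_ge0.
Qed.

Lemma vanishes0 : vanishes (fun _ => 0 : bop V W).
Proof. by move=> e e0; apply: nearW => t; rewrite opnorm0 ltW. Qed.

Lemma vanishesD F G : vanishes F -> vanishes G -> vanishes (fun t => F t + G t).
Proof.
move=> hF hG e e0; have e2 : 0 < e / 2 by rewrite divr_gt0.
apply: filterS2 (hF _ e2) (hG _ e2) => t h1 h2.
by apply: le_trans (opnormD _ _) _; rewrite [e]splitr lerD.
Qed.

Lemma vanishesN F : vanishes F -> vanishes (fun t => - F t).
Proof. by move=> hF e e0; apply: filterS (hF _ e0) => t; rewrite opnormN. Qed.

Lemma vanishesB F G : vanishes F -> vanishes G -> vanishes (fun t => F t - G t).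
Proof. by move=> hF hG; apply: vanishesD => //; apply: vanishesN. Qed.

Lemma vanishes_dist F G : vanishes (fun t => F t - G t) -> vanishes (fun t => G t - F t).
Proof. by move=> h e e0; apply: filterS (h _ e0) => t; rewrite opnorm_dist. Qed.

Lemma vanishesZ k F : vanishes F -> vanishes (fun t => k *: F t).
Proof.
move=> hF e e0; have k1 : 0 < nr k + 1 by rewrite ltr_wpDl ?nr_ge0.
have e1 : 0 < e / (nr k + 1) by rewrite divr_gt0.
apply: filterS (hF _ e1) => t; rewrite opnormZ ler_pdivlMr //.
apply: le_trans; rewrite mulrC ler_wpM2l ?opnorm_ge0 // lerDl //.
Qed.

Lemma vanishes_eq F G : (forall t, F t = G t) -> vanishes F -> vanishes G.
Proof. by move=> h; have -> : F = G by apply/funext. Qed.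

Lemma vanishes_sum I (r : seq I) (F : I -> R -> bop V W) :
  (forall i, vanishes (F i)) -> vanishes (fun t => \sum_(i <- r) F i t).
Proof.
move=> hF; elim: r => [|i r ih].
  by move=> e e0; apply: nearW => t; rewrite big_nil opnorm0 ltW.
move=> e e0; apply: filterS (vanishesD (hF i) ih e0) => t.
by rewrite big_cons.
Qed.

Lemma vanishes_sum_in (I : eqType) (r : seq I) (F : I -> R -> bop V W) :
  (forall i, i \in r -> vanishes (F i)) -> vanishes (fun t => \sum_(i <- r) F i t).
Proof.
move=> hF; apply: (vanishes_eq
  (F := fun t => \sum_(i <- r) (if i \in r then F i t else 0))).
  by move=> t; apply: eq_big_seq => i ->.
apply: (@vanishes_sum _ r (fun i t => if i \in r then F i t else 0)) => i.
case: (boolP (i \in r)) => [/hF//|_]; exact: vanishes0.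
Qed.

Lemma ev_bounded_vanishes F : vanishes F -> ev_bounded F.
Proof. by move=> h; exists 1 => //; apply: h. Qed.

Lemma ev_boundedD F G : ev_bounded F -> ev_bounded G -> ev_bounded (fun t => F t + G t).
Proof.
case=> M M0 hF [N N0 hG]; exists (M + N); first exact: addr_gt0.
apply: filterS2 hF hG => t h1 h2.
by apply: le_trans (opnormD _ _) _; rewrite lerD.
Qed.

Lemma ev_boundedZ k F : ev_bounded F -> ev_bounded (fun t => k *: F t).
Proof.
case=> M M0 hF; exists (nr k * M + 1); first by rewrite ltr_wpDl // mulr_ge0 ?nr_ge0 ?ltW.
apply: filterS hF => t h1; rewrite opnormZ.
by apply: le_trans (ler_wpM2l (nr_ge0 k) h1) _; rewrite lerDl.
Qed.

End Basic.

Lemma vanishes_prod (V W V1 W1 V2 W2 : normedModType R[i])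
   (F : R -> bop V W) (G : R -> bop V1 W1) (P : R -> bop V2 W2) :
  (forall t, opnorm (P t) <= opnorm (F t) * opnorm (G t)) ->
  vanishes F -> ev_bounded G -> vanishes P.
Proof.
move=> hP hF [M M0 hG] e e0; have e1 : 0 < e / M by rewrite divr_gt0.
apply: filterS2 (hF _ e1) hG => t h1 h2.
apply: le_trans (hP t) _; rewrite -(mulfVK (lt0r_neq0 M0) e).
by rewrite ler_pM ?opnorm_ge0.
Qed.

End Vanish.

Section Asymptotic.
Context {R : realType} (H K : hilbertType R) (A : set 'B(H)) (hA : cstar_subalgebra A).
Context (A1 : A 1) (phi : R -> 'B(H) -> 'B(K)) (hphi : asymptotic_representation A phi).

Lemma asym_linV mu a b : A a -> A b ->
  vanishes (fun t => phi t (a + mu *: b) - phi t a - mu *: phi t b).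
Proof. by move=> Aa Ab; apply/cvg_vanishes; apply: (asym_lin hphi). Qed.

Lemma asym_mulV a b : A a -> A b ->
  vanishes (fun t => phi t (a * b) - phi t a * phi t b).
Proof. by move=> Aa Ab; apply/cvg_vanishes; apply: (asym_mul hphi). Qed.

Lemma asym_adjV a : A a -> vanishes (fun t => phi t (adj a) - adj (phi t a)).
Proof. by move=> Aa; apply/cvg_vanishes; apply: (asym_adj hphi). Qed.

Lemma asym0 : vanishes (fun t => phi t 0).
Proof.
have A0 := cstar0 hA.
have := vanishesN (asym_linV 1 A0 A0); apply: vanishes_eq => t.
by rewrite scale1r addr0 scale1r subrr sub0r opprK.
Qed.

Lemma asymZ mu a : A a -> vanishes (fun t => phi t (mu *: a) - mu *: phi t a).
Proof.
move=> Aa; have := vanishesD (asym_linV mu (cstar0 hA) Aa) asym0.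
by apply: vanishes_eq => t; rewrite add0r addrAC subrK.
Qed.

Lemma asymD a b : A a -> A b -> vanishes (fun t => phi t (a + b) - (phi t a + phi t b)).
Proof.
move=> Aa Ab; have := asym_linV 1 Aa Ab.
by apply: vanishes_eq => t; rewrite !scale1r opprD addrA.
Qed.

Lemma asym_suml (I : eqType) (r : seq I) (k : I -> R[i]) (a : I -> 'B(H)) :
  (forall i, i \in r -> A (a i)) ->
  A (\sum_(i <- r) k i *: a i) /\
  vanishes (fun t => phi t (\sum_(i <- r) k i *: a i) - \sum_(i <- r) k i *: phi t (a i)).
Proof.
elim: r => [|i r ih] hr.
  rewrite big_nil; split; first exact: cstar0 hA.
  by apply: vanishes_eq asym0 => t; rewrite big_nil subr0.
have Ai : A (a i) by apply: hr; rewrite mem_head.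
have [|Ar vr] := ih; first by move=> j jr; apply: hr; rewrite inE jr orbT.
rewrite big_cons addrC; split; first exact: cstar_lin.
have := vanishesD (asym_linV (k i) Ar Ai) vr; apply: vanishes_eq => t.
by rewrite big_cons [X in X + _]addrAC subrKA opprD addrA.
Qed.

(** The error is relative to the norm of [phi t b] because boundedness of [phi] is not yet
    available: replacing [phi t (adj a)] by [adj (phi t a)] costs a small multiple of that norm. *)
Lemma asym_adj_mul a b : A a -> A b -> exists2 E : R -> R,
  (forall e, 0 < e -> \forall t \near +oo, E t <= e) &
  (forall t, 0 <= E t /\
    opnorm (adj (phi t a) * phi t b - phi t (adj a * b)) <= E t * opnorm (phi t b) + E t).
Proof.
move=> Aa Ab.
exists (fun t => opnorm (phi t (adj a) - adj (phi t a)) +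
   opnorm (phi t (adj a * b) - phi t (adj a) * phi t b)).
  move=> e e0; have e2 : 0 < e / 2 by rewrite divr_gt0.
  apply: filterS2 (asym_adjV Aa e2) (asym_mulV (cstar_adj hA Aa) Ab e2) => t h1 h2.
  by rewrite [e]splitr lerD.
move=> t; split; first by rewrite addr_ge0 ?opnorm_ge0.

apply: le_trans (opnorm_triangle (phi t (adj a) * phi t b) _ _) _.
rewrite -mulrBl; apply: lerD.
  apply: le_trans (opnormM _ _) _; rewrite ler_wpM2r ?opnorm_ge0 //.
  by rewrite opnorm_dist lerDl opnorm_ge0.
by rewrite opnorm_dist lerDr opnorm_ge0.
Qed.

(** The norm [N] of [phi t 1] satisfies [N ^+ 2 <= N + E t * N + E t], which fails once [N] exceeds
    [1 + 2 * E t]. *)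
Lemma asym_one (e : R) : 0 < e -> \forall t \near +oo, opnorm (phi t 1) <= 1 + e.
Proof.
move=> e0; have [E hE hb] := asym_adj_mul A1 A1.
have e2 : 0 < e / 2 by rewrite divr_gt0.
apply: filterS (hE _ e2) => t ht.
have [Et0 hbt] := hb t; rewrite adj1 mulr1 in hbt.
have h := opnorm_le_dist (adj (phi t 1) * phi t 1) (phi t 1).
rewrite opnorm_starM in h; have := opnorm_ge0 (phi t 1).
move: (opnorm (phi t 1)) hbt h => N hbt h N0.
rewrite leNgt; apply/negP => hN; nra.
Qed.

Lemma asym_isometry u (e : R) : A u -> adj u * u = 1 -> 0 < e ->
  \forall t \near +oo, opnorm (phi t u) <= 1 + e.
Proof.
move=> Au uu e0; have [E hE hb] := asym_adj_mul Au Au.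
have e2 : 0 < e / 2 by rewrite divr_gt0.
apply: filterS2 (hE _ e2) (asym_one e2) => t ht h1.
have [Et0 hbt] := hb t; rewrite uu in hbt.
have h := opnorm_le_dist (adj (phi t u) * phi t u) (phi t 1).
rewrite opnorm_starM in h; have := opnorm_ge0 (phi t u).
move: (opnorm (phi t u)) (opnorm (phi t 1)) (opnorm (_ - phi t 1)) hbt h h1.
move=> N P D hbt h h1 N0; rewrite leNgt; apply/negP => hN.
by clear uu; nra.
Qed.

(* For [|b| <= 1/2] write [b^* b + w^2 = 1]; then [|phi b|^2 + |phi w|^2] is
   asymptotically controlled by [|phi 1|]. *)
Lemma asym_bounded a : A a -> ev_bounded (fun t => phi t a).
Proof.
move=> Aa; pose c := (2 * (opnorm a + 1)); pose b := (c^-1)%:C *: a.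
have c0 : 0 < c by rewrite mulr_gt0 // ltr_wpDl ?opnorm_ge0.
have Ab : A b by apply: cstar_scale.
have b2 : opnorm b <= 2^-1.
  rewrite /b opnormZ nrR ger0_norm ?invr_ge0 ?(ltW c0) // ler_pdivrMl //.
  by rewrite /c; have := opnorm_ge0 a; lra.
have [||||y [Ay sy ey]] := cstar_sqrt hA (x := adj b * b) (q := 2^-1).
- by apply: cstar_mulr => //; apply: cstar_adj.
- by rewrite adjM adjK.
- by rewrite opnorm_starM; have := opnorm_ge0 b; nra.
- by lra.
pose w := 1 - y; have Aw : A w by apply: cstar_sub.
have hw : adj w * w = 1 - adj b * b.
  have -> : adj b * b = y + y - y * y by rewrite ey addrK.
  rewrite /w adjB adj1 sy mulrBl mul1r mulrBr mulr1 !opprB -addrA opprD.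
  by congr (_ + _); rewrite addrCA.
have Abb : A (adj b * b) by apply: cstar_mulr => //; apply: cstar_adj.
have Aww : A (adj w * w) by apply: cstar_mulr => //; apply: cstar_adj.
have bounded_b : ev_bounded (fun t => phi t b).
  have [E hE hb] := asym_adj_mul Ab Ab; have [F hF hf] := asym_adj_mul Aw Aw.
  exists 3 => //; have q0 : 0 < 4^-1 :> R by rewrite invr_gt0.
  apply: filterS3 (hE _ q0) (hF _ q0)
    (filterI (asym_one q0) (asymD Abb Aww q0)) => t ht1 ht2 [h1 hD].
  have [E0 hbt] := hb t; have [F0 hft] := hf t.
  rewrite hw [_ + (1 - _)]addrC subrK -hw in hD.
  pose S := adj (phi t b) * phi t b + adj (phi t w) * phi t w.
  (* Adding a positive operator to [adj z * z] does not decrease its quadratic form, so the norm of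
     [S] dominates both squares. *)
  have hS (z : 'B(K)) (z' : 'B(K)) :
      opnorm z ^+ 2 <= opnorm (adj z * z + adj z' * z').
    rewrite -[leRHS]sqr_sqrtr ?opnorm_ge0 // ler_pXn2r ?nnegrE ?opnorm_ge0 ?sqrtr_ge0 //.
    apply: opnorm_le => [|x]; first exact: sqrtr_ge0.
    rewrite -(ler_pXn2r (n := 2)) ?nnegrE ?mulr_ge0 ?nr_ge0 ?sqrtr_ge0 //.
    rewrite exprMn sqr_sqrtr ?opnorm_ge0 //.
    apply: (@le_trans _ _ (complex.Re (dot ((adj z * z + adj z' * z') x) x))).
      rewrite bop_addE !bop_mulE dotDl !adjPr !dot_nr ReD /= lerDl exprn_ge0 ?nr_ge0 //.
    apply: le_trans (Re_le_nr _) _; apply: le_trans (CauchySchwarz _ _) _.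
    by rewrite expr2 mulrA ler_wpM2r ?nr_ge0 ?opnormP.
  have hS1 := hS (phi t b) (phi t w).
  have hS2 := hS (phi t w) (phi t b); rewrite addrC in hS2; rewrite -/S in hS1 hS2.
  have SP : opnorm S <= opnorm (phi t 1) +
     (opnorm (phi t 1 - (phi t (adj b * b) + phi t (adj w * w))) +
     (opnorm (adj (phi t b) * phi t b - phi t (adj b * b)) +
      opnorm (adj (phi t w) * phi t w - phi t (adj w * w)))).
    apply: le_trans (opnorm_le_dist _ (phi t 1)) _; rewrite lerD2l.
    apply: le_trans (opnorm_triangle (phi t (adj b * b) + phi t (adj w * w)) _ _) _.
    rewrite addrC opnorm_dist; apply: lerD => //.
    rewrite /S opprD addrACA; exact: opnormD.
  have := opnorm_ge0 (phi t b); have := opnorm_ge0 (phi t w).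
  move=> W0 B0; rewrite leNgt; apply/negP => hN.
  move: hbt hft hD h1 SP.
  move: (opnorm (phi t b)) (opnorm (phi t w)) (opnorm S) (E t) (F t)
    W0 B0 hN hS1 hS2 ht1 ht2 E0 F0 => B W s Et Ft W0 B0 hN hS1 hS2 ht1 ht2 E0 F0.
  move: (opnorm _) (opnorm _) (opnorm _) (opnorm _) => x1 x2 x3 x4 hx1 hx2 hx3 hx4 hs.
  (* The squares of [B] and [W] are at most [s], and [s <= 2 + (B + W) / 4]. Adding the two bounds
     and absorbing [W] through [k3] leaves [B ^+ 2 <= 4 + 1 / 16 + B / 2], which is impossible for
     [B > 3]. *)
  have k1 : Et * B <= B / 4 by rewrite mulrC ler_wpM2l.
  have k2 : Ft * W <= W / 4 by rewrite mulrC ler_wpM2l.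
  have k3 := sqr_ge0 (W - 4^-1).
  have k4 : 3 * B <= B ^+ 2 by rewrite expr2 ler_wpM2r // ltW.
  rewrite sqrrB in k3.
  by clear - hN hS1 hS2 ht1 ht2 E0 F0 hx1 hx2 hx3 hx4 hs W0 B0 k1 k2 k3 k4; lra.
have -> : a = c%:C *: b by rewrite /b scalerA -realcM mulfV ?gt_eqF ?scale1r.
have [M M0 hM] := ev_boundedD (ev_bounded_vanishes (asymZ c%:C Ab)) (ev_boundedZ c%:C bounded_b).
by exists M => //; apply: filterS hM => t; rewrite subrK.
Qed.

End Asymptotic.

Section Decomposition.
Context {R : realType} (H1 H2 K K' T : hilbertType R).
Context (A : set 'B(H1)) (hA : cstar_subalgebra A) (A1 : A 1).
Context (B : set 'B(H2)) (hB : cstar_subalgebra B) (B1 : B 1).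
Context (phi : R -> 'B(H1) -> 'B(K)) (hphi : asymptotic_representation A phi).
Context (psi : R -> 'B(H2) -> 'B(K')) (hpsi : asymptotic_representation B psi).
Context (tau : {bilinear K -> K' -> T}) (htau : hilbert_tensor tau).

Lemma vanishes_tensor_l (F : R -> 'B(K)) (G : R -> 'B(K')) :
  vanishes F -> ev_bounded G -> vanishes (fun t => tensor_op tau (F t) (G t)).
Proof. by apply: vanishes_prod => t; apply: opnorm_tensor_op. Qed.

Lemma vanishes_tensor_r (F : R -> 'B(K)) (G : R -> 'B(K')) :
  ev_bounded F -> vanishes G -> vanishes (fun t => tensor_op tau (F t) (G t)).
Proof.
by move=> hF hG; apply: (vanishes_prod _ hG hF) => t; rewrite mulrC opnorm_tensor_op.
Qed.

(* If [a_0 <> 0], applying a vector functional to the first legs expresses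
   [b_0] through the other [b_i], which shortens the sum. *)
Lemma null_tensor_vanishes (s : seq ('B(H1) * 'B(H2))) :
  (forall p, p \in s -> A p.1 /\ B p.2) ->
  (forall x x' y y', \sum_(p <- s) dot (p.1 x) x' * dot (p.2 y) y' = 0) ->
  vanishes (fun t => \sum_(p <- s) tensor_op tau (phi t p.1) (psi t p.2)).
Proof.
have [n] := ubnP (size s); elim: n s => // n IH s sn hs hz.
have [[p0 [p0s p00]]|all0] := pselect (exists p, p \in s /\ p.1 <> 0); last first.
  (* Even with a zero first leg the term need not be zero, since [phi t] is not linear; but
     [phi t 0] tends to 0 while the second leg stays bounded. *)
  apply: vanishes_sum_in => p ps; have [_ Bp] := hs p ps.
  have -> : p.1 = 0 by apply: contrapT => p1; apply: all0; exists p.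
  by apply: vanishes_tensor_l; [apply: asym0 hphi|apply: asym_bounded hpsi p.2 Bp].
have [x [x' k0]] : exists x x', dot (p0.1 x) x' != 0.
  apply: contrapT => hn; apply: p00; apply: bopE => x; apply: dot_inj => x'.
  apply/eqP; rewrite bop_zeroE dot0l; apply: contrapT => /negP h.
  by apply: hn; exists x, x'.
set k := dot (p0.1 x) x' in k0.
pose s' := rem p0 s; have ps : perm_eq s (p0 :: s') := perm_to_rem p0s.
pose c (p : 'B(H1) * 'B(H2)) := dot (p.1 x) x' / k : R[i].
have [Ap0 Bp0] := hs _ p0s.
have hs' p : p \in s' -> A p.1 /\ B p.2 by move/mem_rem; apply: hs.
have eb : p0.2 = \sum_(p <- s') - c p *: p.2.
  apply: bopE => y; apply: dot_inj => y'.
  have := hz x x' y y'; rewrite (perm_big _ ps) /= big_cons -/k => /eqP.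
  rewrite addr_eq0 => /eqP e; apply: (mulfI k0); rewrite e.
  rewrite bop_sumE dot_suml mulr_sumr -sumrN; apply: eq_bigr => p _.
  by rewrite bop_scaleE dotZl mulrA mulrN /c mulrCA mulfV // mulr1 mulNr.
(* Substituting [eb] for [p0.2] and collecting the terms with the same second leg gives a null sum
   with one term fewer. *)
pose s2 := [seq (p.1 - c p *: p0.1, p.2) | p <- s'].
have v2 : vanishes (fun t => \sum_(p <- s2) tensor_op tau (phi t p.1) (psi t p.2)).
  apply: IH.
  - rewrite size_map; have := perm_size ps; rewrite /= => e.
    by move: sn; rewrite e ltnS.
  - move=> _ /mapP[p ps' ->] /=; have [Ap Bp] := hs' _ ps'.
    by split=> //; apply: cstar_sub => //; apply: cstar_scale.
  - move=> z z' y y'; rewrite big_map.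
    have E1 (p : 'B(H1) * 'B(H2)) : dot ((p.1 - c p *: p0.1) z) z' =
        dot (p.1 z) z' - c p * dot (p0.1 z) z' by rewrite -dotZl -dotBl.
    have E2 (p : 'B(H1) * 'B(H2)) : dot ((- c p *: p.2) y) y' = - c p * dot (p.2 y) y'.
      by rewrite -dotZl.
    rewrite (eq_bigr (fun p : 'B(H1) * 'B(H2) => dot (p.1 z) z' * dot (p.2 y) y' +
      dot (p0.1 z) z' * dot ((- c p *: p.2) y) y')); last first.
      by move=> p _; rewrite E1 E2; ring.
    rewrite big_split -mulr_sumr -dot_suml -bop_sumE -eb.
    by rewrite -[RHS](hz z z' y y') (perm_big _ ps) big_cons; exact: addrC.
have [_ vb] := @asym_suml _ _ _ _ hB _ hpsi _ s' (fun p => - c p) snd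
   (fun p (ps' : p \in s') => proj2 (hs' p ps')).
rewrite -eb in vb.
(* [v3] and [v4] measure how far [psi] and [phi] are from respecting this substitution; together
   with [v2] they add up to the original sum. *)
have v3 : vanishes (fun t => tensor_op tau (phi t p0.1)
    (psi t p0.2 - \sum_(p <- s') - c p *: psi t p.2)).
  by apply: vanishes_tensor_r => //; apply: asym_bounded hphi p0.1 Ap0.
have v4 : vanishes (fun t => \sum_(p <- s') tensor_op tau
    (phi t p.1 + - c p *: phi t p0.1 - phi t (p.1 - c p *: p0.1)) (psi t p.2)).
  apply: vanishes_sum_in => p ps'; have [Ap Bp] := hs' _ ps'.
  apply: vanishes_tensor_l; last exact: asym_bounded hpsi p.2 Bp.
  apply: vanishes_dist; have := asym_linV hphi (- c p) Ap Ap0.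
  by apply: vanishes_eq => t; rewrite opprD addrA scaleNr.
have := vanishesD (vanishesD v3 v4) v2; apply: vanishes_eq => t.
rewrite (perm_big _ ps) /= big_cons -addrA.
rewrite /s2 big_map /= -big_split /= tensor_opDr // tensor_opNr // tensor_op_sumr //.
rewrite -addrA; congr (_ + _); rewrite -sumrN -big_split /=; apply: eq_bigr => p _.
rewrite -tensor_opDl // subrK tensor_opDl // tensor_opZl // tensor_opZr //.
by rewrite addrCA addNr addr0.
Qed.

End Decomposition.

(** * Limits superior *)

Section Limsup.
Context {R : realType}.

Lemma limf_esup_le (T : choiceType) (X : filteredType T) (Fi : set_system X)
    (f : X -> R) (l : R) :
  (forall e, 0 < e -> \forall t \near Fi, f t <= l + e) ->
  (limf_esup (fun t => (f t)%:E) Fi <= l%:E)%E.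
Proof.
move=> h; rewrite limf_esupE; apply/lee_addgt0Pr => e e0.
apply: ereal_inf_le; exists (ereal_sup [set (f t)%:E | t in [set t | f t <= l + e]]).
  by exists [set t | f t <= l + e] => //; apply: h.
by apply: ge_ereal_sup => _ [t /= ht <-]; rewrite -EFinD lee_fin.
Qed.

Lemma limf_esup_ge (T : choiceType) (X : filteredType T) (Fi : set_system X)
    (f : X -> R) (l : R) :
  (forall e (V : set X), 0 < e -> Fi V -> exists2 t, V t & l - e <= f t) ->
  (l%:E <= limf_esup (fun t => (f t)%:E) Fi)%E.
Proof.
move=> h; rewrite limf_esupE; apply: le_ereal_inf_tmp => _ [V FV <-].
apply/lee_addgt0Pr => e e0; have [t Vt ht] := h e V e0 FV.
apply: (@le_trans _ _ ((f t)%:E + e%:E)%E).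
  by rewrite -EFinD lee_fin -lerBlDr.
by rewrite leeD2r //; apply: ereal_sup_ubound; exists t.
Qed.

Lemma limn_esup_lt (u : nat -> R) (l e : R) : 0 < e ->
  (limn_esup (fun n => (u n)%:E) = l%:E)%E -> \forall n \near \oo, u n <= l + e.
Proof.
move=> e0; rewrite /limn_esup limf_esupE => h.
have : (ereal_inf [set ereal_sup [set (u n)%:E | n in V] | V in \oo] < (l + e)%:E)%E.
  by rewrite h lte_fin ltrDl.
move/ereal_inf_lt => [_ [V FV <-]] hV.
apply: filterS FV => n Vn; rewrite -lee_fin; apply/ltW/le_lt_trans/hV.
by apply: ereal_sup_ubound; exists n.
Qed.

Lemma limn_esup_frequently (u : nat -> R) (l e : R) : 0 < e ->
  (limn_esup (fun n => (u n)%:E) = l%:E)%E ->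
  forall N, exists2 n, (N <= n)%N & l - e <= u n.
Proof.
move=> e0; rewrite /limn_esup limf_esupE => h N.
apply: contrapT => hn.
have : (l%:E <= (l - e)%:E)%E.
  rewrite -h; apply: ereal_inf_le.
  exists (ereal_sup [set (u n)%:E | n in [set n | (N <= n)%N]]).
    by exists [set n | (N <= n)%N] => //; exists N.
  apply: ge_ereal_sup => _ [n /= Nn <-]; rewrite lee_fin leNgt; apply/negP => hlt.
  by apply: hn; exists n => //; apply: ltW.
by rewrite lee_fin => hle; move: e0; rewrite ltNge; apply/negP/negPn; lra.
Qed.

End Limsup.

(** * Evaluation of tensors and the upper bound *)

Section VectorForm.
Context {R : realType} (H1 H2 : hilbertType R) (x x' : H1) (y y' : H2).

(** An algebraic tensor is a function on bilinear forms. Evaluation at these forms turns an equality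
    of tensors into the scalar identities that [null_tensor_vanishes] takes as input. *)
Definition vector_form (a : 'B(H1)) (b : 'B(H2)) : R[i]^o :=
  dot (a x) x' * dot (b y) y'.

Lemma vector_form_bilinear : bilinear_for *:%R *:%R vector_form.
Proof.
split=> c k a b; rewrite /vector_form bop_addE bop_scaleE dotP.
  by rewrite mulrDl -mulrA.
by rewrite mulrDr mulrCA.
Qed.

HB.instance Definition _ := bilinear_isBilinear.Build R[i] 'B(H1) 'B(H2) R[i]^o *:%R *:%R
  vector_form vector_form_bilinear.

End VectorForm.

Section UpperBound.
Context {R : realType} {F : groupType}.

Lemma cstar_of_subalgebra (H : hilbertType R) (pi : F -> 'B(H)) :
  cstar_subalgebra (cstar_of pi).
Proof.
split.
- by move=> A [hA _]; apply: cstar0.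
- by move=> mu a b ha hb A AA; apply: cstar_lin; [case: AA|apply: ha|apply: hb].
- by move=> a b ha hb A AA; apply: cstar_mul; [case: AA|apply: ha|apply: hb].
- by move=> a ha A AA; apply: cstar_adj; [case: AA|apply: ha].
- move=> a ha A AA; apply: (cstar_closed (proj1 AA)) => e e0.
  by have [b hb ?] := ha _ e0; exists b => //; apply: hb.
Qed.

Lemma cstar_of_gen (H : hilbertType R) (pi : F -> 'B(H)) g : cstar_of pi (pi g).
Proof. by move=> A [_]; apply; exists g. Qed.

Lemma cstar_of1 (H : hilbertType R) (pi : F -> 'B(H)) : unitary_rep pi -> cstar_of pi 1.
Proof. by move=> hpi; have := @cstar_of_gen _ pi 1%g; rewrite (urep1 hpi). Qed.

Lemma Delta_freeg (H1 H2 : hilbertType R) (pi : F -> 'B(H1)) (pi' : F -> 'B(H2))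
    (s : seq (R[i] * F)) :
  Delta pi pi' (Freeg s) = \sum_(p <- s) (p.1 *: pi p.2) ⊙ pi' p.2.
Proof.
rewrite /Delta fglift_Freeg /prelift; apply: eq_bigr => p _.
by apply/funext => B; rewrite /pure_tensor linearZl_LR.
Qed.

Lemma tensor_sumE (H1 H2 : hilbertType R) (s : seq ('B(H1) * 'B(H2))) x x' y y' :
  (\sum_(p <- s) p.1 ⊙ p.2) (vector_form x x' y y' : {bilinear _ -> _ -> _}) =
    \sum_(p <- s) dot (p.1 x) x' * dot (p.2 y) y'.
Proof. by elim/big_rec2: _ => [//|p a b _ <-]. Qed.

Lemma representation_asymptotic (H K : hilbertType R) (A : set 'B(H))
    (psi : 'B(H) -> 'B(K)) :
  representation A psi -> asymptotic_representation A (fun _ => psi).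
Proof.
move=> hpsi; split.
- move=> a Aa t t0; rewrite subrr opnorm0; exact: cvg_cst.
- move=> mu a b Aa Ab; apply/cvg_vanishes.
  apply: (vanishes_eq _ (@vanishes0 _ _ _)) => t.
  by rewrite (rep_lin hpsi) // addrAC addrK subrr.
- move=> a b Aa Ab; apply/cvg_vanishes.
  apply: (vanishes_eq _ (@vanishes0 _ _ _)) => t.
  by rewrite (rep_mul hpsi) // subrr.
- move=> a Aa; apply/cvg_vanishes.
  apply: (vanishes_eq _ (@vanishes0 _ _ _)) => t.
  by rewrite (rep_adj hpsi) // subrr.
Qed.

Lemma left_le_symmetric (H1 H2 : hilbertType R) (A : set 'B(H1)) (B : set 'B(H2))
    (c : tensor 'B(H1) 'B(H2)) :
  (left_asymptotic_norm A B c <= symmetric_asymptotic_norm A B c)%E.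
Proof.
apply: le_ereal_sup => r [H [T [tau [phi [psi [s [htau hphi hpsi hs ->]]]]]]].
exists H, T, tau, phi, (fun _ => psi), s; split=> //.
exact: representation_asymptotic.
Qed.

(** A given decomposition [s] minus the canonical one is the null sum [s1], so both have the same
    asymptotic behaviour. In the canonical one each term is eventually bounded by its coefficient up
    to a factor close to 1. *)
Lemma symmetric_norm_le1 (H1 H2 : hilbertType R) (pi : F -> 'B(H1)) (pi' : F -> 'B(H2))
    (s0 : seq (R[i] * F)) : unitary_rep pi -> unitary_rep pi' ->
  \sum_(p <- s0) nr p.1 <= 1 ->
  (symmetric_asymptotic_norm (cstar_of pi) (cstar_of pi') (Delta pi pi' (Freeg s0)) <= 1)%E.
Proof.
move=> hpi hpi' s01.
have hA := cstar_of_subalgebra pi; have hB := cstar_of_subalgebra pi'.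
apply: ge_ereal_sup => _ [H [T [tau [phi [psi [s [htau hphi hpsi [hs es] ->]]]]]]].
pose s1 := s ++ [seq (- p.1 *: pi p.2, pi' p.2) | p <- s0].
have v1 : vanishes (fun t => \sum_(p <- s1) tensor_op tau (phi t p.1) (psi t p.2)).
  apply: (null_tensor_vanishes hA (cstar_of1 hpi) hB (cstar_of1 hpi') hphi hpsi htau).
    move=> p; rewrite mem_cat => /orP[/hs//|/mapP[q _ ->]] /=; split.
      by apply: (cstar_scale hA); apply: cstar_of_gen.
    exact: cstar_of_gen.
  move=> x x' y y'.
  have := congr1 (fun c => c (vector_form x x' y y' : {bilinear _ -> _ -> _})) es.
  rewrite Delta_freeg tensor_sumE /s1 big_cat big_map /= => <-.
  have -> : (\sum_(p <- s0) (p.1 *: pi p.2) ⊙ pi' p.2)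
      (vector_form x x' y y' : {bilinear _ -> _ -> _}) =
      \sum_(p <- s0) dot ((p.1 *: pi p.2) x) x' * dot (pi' p.2 y) y'.
    by elim/big_rec2: _ => [//|p a b _ <-].
  rewrite -big_split big1 //= => p _.
  have -> : dot ((- p.1 *: pi p.2) x) x' = - dot ((p.1 *: pi p.2) x) x'.
    by rewrite scaleNr bop_oppE dotNl.
  by rewrite mulNr addrN.
have v2 : vanishes (fun t => \sum_(p <- s0) tensor_op tau
    (phi t (- p.1 *: pi p.2) - - p.1 *: phi t (pi p.2)) (psi t (pi' p.2))).
  apply: vanishes_sum => p; apply: vanishes_tensor_l => //.
    by apply: (asymZ hA hphi); apply: cstar_of_gen.
  by apply: (asym_bounded hB (cstar_of1 hpi') hpsi); apply: cstar_of_gen.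
have v3 : vanishes (fun t => \sum_(p <- s) tensor_op tau (phi t p.1) (psi t p.2) -
    \sum_(p <- s0) p.1 *: tensor_op tau (phi t (pi p.2)) (psi t (pi' p.2))).
  have := vanishesB v1 v2; apply: vanishes_eq => t.
  rewrite /s1 big_cat big_map /= -addrA; congr (_ + _).
  rewrite -sumrN -big_split -sumrN /=; apply: eq_bigr => p _.
  rewrite tensor_opDl // opprD addrA subrr sub0r tensor_opNl // opprK.
  by rewrite tensor_opZl // scaleNr.
have vu g (e : R) : 0 < e -> \forall t \near +oo, opnorm (phi t (pi g)) <= 1 + e.
  move=> e0; apply: (asym_isometry hA (cstar_of1 hpi) hphi) => //.
    exact: cstar_of_gen.
  exact: (urepUl hpi g).
have vu' g (e : R) : 0 < e -> \forall t \near +oo, opnorm (psi t (pi' g)) <= 1 + e.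
  move=> e0; apply: (asym_isometry hB (cstar_of1 hpi') hpsi) => //.
    exact: cstar_of_gen.
  exact: (urepUl hpi' g).
apply: limf_esup_le => e e0.
(* With this choice the square of [1 + d] is at most [1 + 3 * (e / 4)]; the remaining quarter of [e]
   pays for [v3]. *)
pose d := Num.min 1 (e / 4).
have d0 : 0 < d by rewrite lt_min ltr01 divr_gt0.
have e4 : 0 < e / 4 by rewrite divr_gt0.
have all0 : \forall t \near +oo, forall p, p \in s0 ->
    opnorm (phi t (pi p.2)) <= 1 + d /\ opnorm (psi t (pi' p.2)) <= 1 + d.
  elim: (s0) => [|p r ih]; first exact: nearW.
  apply: filterS3 ih (vu p.2 _ d0) (vu' p.2 _ d0) => t ht h1 h2 q.
  by rewrite inE => /orP[/eqP->|/ht].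
apply: filterS2 all0 (v3 _ e4) => t ht h3.
apply: le_trans (opnorm_le_dist _ _) _; last first.
  have -> : 1 + e = (1 + 3 * (e / 4)) + e / 4 by field.
  apply: lerD h3.
  apply: le_trans (opnorm_sum _ _ _) _.
  apply: (@le_trans _ _ (\sum_(p <- s0) nr p.1 * (1 + 3 * (e / 4)))).
    rewrite big_seq [leRHS]big_seq; apply: ler_sum => p ps.
    have [h1 h2] := ht _ ps.
    rewrite opnormZ ler_wpM2l ?nr_ge0 //.
    apply: le_trans (opnorm_tensor_op htau _ _) _.
    apply: (@le_trans _ _ ((1 + d) * (1 + d))).
      by rewrite ler_pM ?opnorm_ge0.
    have d1 : d <= 1 by rewrite /d ge_min lexx.
    have d2 : d <= e / 4 by rewrite /d ge_min lexx orbT.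
    nra.
  rewrite -mulr_suml ler_piMl //; lra.
Qed.

End UpperBound.

(** * The free group *)

Section Generation.
Context (F : groupType) (P : F -> Prop).
Hypotheses (P1 : P 1%g) (PM : forall x y, P x -> P y -> P (x * y)%g)
  (PV : forall x, P x -> P x^-1%g).

Definition subgroup_pred : pred F := fun x => `[< P x >].
Definition subgroup_type := {x : F | subgroup_pred x}.

Lemma subgroup_pred_closed : group_closed subgroup_pred.
Proof.
split; first exact/asboolP.
by move=> x y /asboolP Px /asboolP Py; apply/asboolP/PM => //; apply: PV.
Qed.

HB.instance Definition _ := SubChoice.on subgroup_type.
HB.instance Definition _ :=
  SubChoice_isSubGroup.Build F subgroup_pred subgroup_type subgroup_pred_closed.

(** The elements satisfying [P] form a subgroup. The map into it given by freeness, followed by the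
    inclusion, agrees with the identity on the generators and hence everywhere. This serves as
    induction on elements of the free group. *)
Lemma free_generated (g1 g2 : F) : free_on2 g1 g2 -> P g1 -> P g2 -> forall x, P x.
Proof.
move=> hF p1 p2 x.
have q1 : subgroup_pred g1 by apply/asboolP.
have q2 : subgroup_pred g2 by apply/asboolP.
have [[f [f1 f2]] _] := hF subgroup_type (exist _ g1 q1) (exist _ g2 q2).
have [_ un] := hF F g1 g2.
pose h : {multiplicative F -> F} := (\val : subgroup_type -> F) \o f.
have e : h =1 (idfun : F -> F).
  by apply: un; rewrite /= ?f1 ?f2.
by rewrite -[x]e /=; apply/asboolP; case: (f x).
Qed.

End Generation.

(** The integers as a group in multiplicative notation: the homomorphism sending [g1] to 1 and [g2]
    to 0 separates the powers of [g1]. *)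
Definition additive_int : Type := int.
HB.instance Definition _ := Choice.on additive_int.

Lemma additive_intN : left_inverse (0 : int) -%R +%R.
Proof. exact: addNr. Qed.
Lemma additive_intNr : right_inverse (0 : int) -%R +%R.
Proof. exact: addrN. Qed.

HB.instance Definition _ := isGroup.Build additive_int (@addrA int)
  (@add0r int) (@addr0 int) additive_intN additive_intNr.

Section FreeGroup.
Context (F : groupType) (g1 g2 : F) (hF : free_on2 g1 g2).

Definition letter (b : bool * bool) : F :=
  let g := if b.1 then g1 else g2 in if b.2 then g else g^-1%g.
Definition word (w : seq (bool * bool)) : F :=
  foldr (fun b x => (letter b * x)%g) 1%g w.

Lemma word_cat w v : word (w ++ v) = (word w * word v)%g.
Proof. by elim: w => [|b w ih] /=; rewrite ?mul1g // ih mulgA. Qed.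

Lemma word_surj x : exists w, word w = x.
Proof.
apply: (free_generated (P := fun x => exists w, word w = x) _ _ _ hF).
- by exists [::].
- by move=> _ _ [w <-] [v <-]; exists (w ++ v); rewrite word_cat.
- move=> _ [w <-]; elim: w => [|b w [v hv]]; first by exists [::]; rewrite /= invg1.
  exists (v ++ [:: (b.1, ~~ b.2)]); rewrite word_cat hv /= invgM mulg1.
  by case: b => b [] /=; rewrite ?invgK.
- by exists [:: (true, true)]; rewrite /= mulg1.
- by exists [:: (false, true)]; rewrite /= mulg1.
Qed.

Lemma free_inj_nat : exists f : F -> nat, injective f.
Proof.
have [w hw] := choice word_surj.
exists (fun x => pickle (w x)) => x y /(pcan_inj pickleK) e.
by rewrite -[x]hw e hw.
Qed.

Lemma free_pow_inj : injective (fun n => (g1 ^+ n)%g).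
Proof.
have [[f [f1 _]] _] := @hF additive_int (1 : int) (0 : int).
have hp n : f (g1 ^+ n)%g = n%:Z.
  elim: n => [|n ih].
    have : (f 1%g : int) + f 1%g = f 1%g by rewrite -[in RHS](mulg1 1%g) gmulfM.
    by move/(congr1 (fun c : int => c - f 1%g)); rewrite addrK subrr expg0.
  by rewrite expgS gmulfM f1 ih -[n.+1]add1n PoszD.
by move=> i j e; have := hp i; rewrite e hp => -[].
Qed.

(** Both sets are countable because words are, and infinite because of the powers of [g1]. The
    bijection is what identifies the tensor square of l^2(F) with l^2(F). *)
Lemma free_square_bij : exists f : F * F -> F,
  injective f /\ forall x, exists p, f p = x.
Proof.
have [f f_inj] := free_inj_nat.
have cF : countable [set: F].
  by apply/countable_injP; exists f => x y _ _; apply: f_inj.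
have cFF : countable [set: F * F] by rewrite -setXTT; apply: countableX.
have iF : ([set: nat] #<= [set: F])%card.
  apply: (@card_le_trans _ _ _ (range (fun n => (g1 ^+ n)%g))).
    have : (range (fun n => (g1 ^+ n)%g) #= [set: nat])%card.
      by apply: inj_card_eq => x y _ _; apply: free_pow_inj.
    by rewrite card_eq_le => /andP[].
  exact: subset_card_le.
have iFF : ([set: nat] #<= [set: F * F])%card.
  apply: (@card_le_trans _ _ _ (range (fun n => ((g1 ^+ n)%g, 1%g : F)))).
    have : (range (fun n => ((g1 ^+ n)%g, 1%g : F)) #= [set: nat])%card.
      by apply: inj_card_eq => x y _ _ []; apply: free_pow_inj.
    by rewrite card_eq_le => /andP[].
  exact: subset_card_le.
have eF := Cantor_Bernstein cF iF; have eFF := Cantor_Bernstein cFF iFF.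
have /card_bijP[h [k hk kh]] := card_eq_trans eFF (card_esym eF).
exists (fun p => val (h (to_setT p))); split.
  by move=> p q /val_inj/(can_inj hk)/(congr1 val).
move=> x; exists (val (k (to_setT x))).
have -> : to_setT (val (k (to_setT x))) = k (to_setT x) by apply/val_inj.
by rewrite kh.
Qed.

End FreeGroup.

(** * Unitary representations from freeness *)

Section UnitaryGroup.
Context {R : realType} (H : hilbertType R).

Definition unitary_pred : pred 'B(H) :=
  fun u => `[< adj u * u = 1 /\ u * adj u = 1 >].
Definition unitary := {u : 'B(H) | unitary_pred u}.

Lemma unitary1 : unitary_pred 1.
Proof. by apply/asboolP; rewrite adj1 mulr1. Qed.
Lemma unitaryM (u v : unitary) : unitary_pred (val u * val v).
Proof.
case: u v => u /= /asboolP[h1 h2] [v /= /asboolP[h3 h4]]; apply/asboolP.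
rewrite adjM; split.
  by rewrite -mulrA [adj u * _]mulrA h1 mul1r.
by rewrite -mulrA [v * _]mulrA h4 mul1r.
Qed.
Lemma unitaryV (u : unitary) : unitary_pred (adj (val u)).
Proof. by case: u => u /= /asboolP[h1 h2]; apply/asboolP; rewrite adjK. Qed.

Definition unitary_one : unitary := @exist _ (fun x => unitary_pred x) 1 unitary1.
Definition unitary_mul (u v : unitary) : unitary := @exist _ (fun x => unitary_pred x) _ (unitaryM u v).
Definition unitary_inv (u : unitary) : unitary := @exist _ (fun x => unitary_pred x) _ (unitaryV u).

Lemma unitary_mulA : associative unitary_mul.
Proof. by move=> u v w; apply/val_inj; rewrite /= mulrA. Qed.
Lemma unitary_mul1 : left_id unitary_one unitary_mul.
Proof. by move=> u; apply/val_inj; rewrite /= mul1r. Qed.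
Lemma unitary_mulr1 : right_id unitary_one unitary_mul.
Proof. by move=> u; apply/val_inj; rewrite /= mulr1. Qed.
Lemma unitary_mulV : left_inverse unitary_one unitary_inv unitary_mul.
Proof. by move=> u; apply/val_inj; case: u => u /= /asboolP[]. Qed.
Lemma unitary_mulrV : right_inverse unitary_one unitary_inv unitary_mul.
Proof. by move=> u; apply/val_inj; case: u => u /= /asboolP[]. Qed.

HB.instance Definition _ := Choice.on unitary.
HB.instance Definition _ := isGroup.Build unitary unitary_mulA unitary_mul1
  unitary_mulr1 unitary_mulV unitary_mulrV.

Lemma free_representation (F : groupType) (g1 g2 : F) (u1 u2 : 'B(H)) :
  free_on2 g1 g2 -> adj u1 * u1 = 1 -> u1 * adj u1 = 1 ->
  adj u2 * u2 = 1 -> u2 * adj u2 = 1 ->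
  exists pi : F -> 'B(H), [/\ unitary_rep pi, pi g1 = u1 & pi g2 = u2].
Proof.
move=> hF a1 b1 a2 b2.
have p1 : unitary_pred u1 by apply/asboolP.
have p2 : unitary_pred u2 by apply/asboolP.
have [[f [f1 f2]] _] := hF unitary (exist _ u1 p1) (exist _ u2 p2).
exists (fun g => val (f g)); split; rewrite ?f1 ?f2 //.
have fM g h : val (f (g * h)%g) = val (f g) * val (f h).
  by rewrite gmulfM.
have fU g : adj (val (f g)) * val (f g) = 1 /\ val (f g) * adj (val (f g)) = 1.
  by case: (f g) => u /= /asboolP.
split=> //; last 2 first.
- by move=> g; case: (fU g).
- by move=> g; case: (fU g).
have e : val (f 1%g) * val (f 1%g) = val (f 1%g) by rewrite -fM mulg1.
have [h1 _] := fU 1%g.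
by have := congr1 (fun c => adj (val (f 1%g)) * c) e; rewrite /= mulrA h1 mul1r.
Qed.

End UnitaryGroup.

(** * The regular representation and its deformation *)

Section BasisTensor.
Context {R : realType} (F : eqType) (H : hilbertType R) (delta : F -> H).
Hypothesis dd : forall g h, dot (delta g) (delta h) = (g == h)%:R.
Hypothesis dt : total delta.

(** The isometries [W y], sending [delta x] to [delta (b (x, y))], have mutually orthogonal ranges
    and play the role of tensoring with [delta y] on the right. The operator [A x] sends [delta y]
    to [W y x], that is, it tensors with [x] on the left; totality is surjectivity of [b]. *)
Lemma basis_tensor (b : F * F -> F) : injective b -> (forall x, exists p, b p = x) ->
  exists tau : {bilinear H -> H -> H}, hilbert_tensor tau.
Proof.
move=> bI bS.
have natE (m n : bool) : ((m && n)%:R : R[i]) = m%:R * n%:R.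
  by case: m; case: n; rewrite ?mulr1 ?mulr0 ?mul0r.
have bE x y x' y' : (b (x, y) == b (x', y')) = (x == x') && (y == y').
  by rewrite (inj_eq bI).
have exW y : exists V : 'B(H), forall x, V (delta x) = delta (b (x, y)).
  have [|V [hV _]] := @isometry_extension _ _ _ delta _ (fun x => delta (b (x, y))) 1 ler01 dt.
    by move=> i j; rewrite !dd bE eqxx andbT mul1r.
  by exists V.
have [W hW] := choice exW.
have WW y y' x x' : dot (W y x) (W y' x') = (y == y')%:R * dot x x'.
  have : bop_comp (adj (W y')) (W y) = (y == y')%:R *: (1 : 'B(H)).
    apply: (total_op_eq dt) => i; apply: (total_vec_eq dt) => j.
    rewrite bop_compE adjPr !hW dd bE bop_scaleE dotZl bop_oneE dd natE.
    by rewrite mulrC.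
  move/(congr1 (fun a : 'B(H) => dot (a x) x')).
  by rewrite bop_compE adjPr bop_scaleE dotZl bop_oneE.
have exA x : exists A : 'B(H), forall y, A (delta y) = W y x.
  have [|A [hA _]] := @isometry_extension _ _ _ delta _ (fun y => W y x) (nr x ^+ 2)
     (exprn_ge0 _ (nr_ge0 _)) dt.
    by move=> i j; rewrite WW dd dot_nr mulrC.
  by exists A.
have [A hA] := choice exA.
have Alin a x x' : A (a *: x + x') = a *: A x + A x'.
  apply: (total_op_eq dt) => y.
  by rewrite bop_addE bop_scaleE !hA bopD bopZ.
pose t (x v : H) := A x v.
have tbil : bilinear_for *:%R *:%R t.
  split=> u a x y; rewrite /t ?Alin ?bop_addE ?bop_scaleE //.
  by rewrite bopD bopZ.
pose tau : {bilinear H -> H -> H} :=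
  HB.pack t (bilinear_isBilinear.Build _ _ _ _ *:%R *:%R t tbil).
exists tau; split.
  move=> x x' y y'; rewrite /tau /= /t.
  have : bop_comp (adj (A x')) (A x) = dot x x' *: (1 : 'B(H)).
    apply: (total_op_eq dt) => i; apply: (total_vec_eq dt) => j.
    by rewrite bop_compE adjPr !hA WW bop_scaleE dotZl bop_oneE dd mulrC.
  move/(congr1 (fun a : 'B(H) => dot (a y) y')).
  by rewrite bop_compE adjPr bop_scaleE dotZl bop_oneE.
rewrite -subTset -dt; apply: closure_subset => v [s [hs ->]].
exists s; split=> // p /hs[x _ <-].
have [[y z] <-] := bS x; exists (delta y, delta z) => //.
by rewrite /= /t hA hW.
Qed.

End BasisTensor.

(** * Formal group sums and their images *)

Section GroupSums.
Context {R : realType} {F : groupType}.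

Definition gsum (V : lmodType R[i]) (rho : F -> V) (s : seq (R[i] * F)) : V :=
  \sum_(p <- s) p.1 *: rho p.2.

(** Elements of the group algebra are handled as unreduced formal sums. Product and involution are
    defined on these, and only their images under representations matter. *)
Definition gmul (s t : seq (R[i] * F)) : seq (R[i] * F) :=
  [seq (p.1 * q.1, (p.2 * q.2)%g) | p <- s, q <- t].

Definition gstar (s : seq (R[i] * F)) : seq (R[i] * F) :=
  [seq (conjc p.1, p.2^-1%g) | p <- s].

Lemma rep_ext_gsum (H : hilbertType R) (rho : F -> 'B(H)) s :
  rep_ext rho (Freeg s) = gsum rho s.
Proof. by rewrite /rep_ext fglift_Freeg. Qed.

Lemma gsum_cat (V : lmodType R[i]) (rho : F -> V) s t :
  gsum rho (s ++ t) = gsum rho s + gsum rho t.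
Proof. exact: big_cat. Qed.

Lemma gsum_scale (V : lmodType R[i]) (rho : F -> V) k s :
  gsum rho [seq (k * p.1, p.2) | p <- s] = k *: gsum rho s.
Proof. by rewrite /gsum big_map scaler_sumr; apply: eq_bigr => p _; rewrite scalerA. Qed.

(** The image of 1 is only a projection. This generality is needed for [sigma n] once it acts on a
    subspace of l^2(F) and is extended by 0. *)
Record star_rep (H : hilbertType R) (rho : F -> 'B(H)) : Prop := {
  srepM : forall g h, rho (g * h)%g = rho g * rho h;
  srepV : forall g, adj (rho g) = rho g^-1%g }.

Lemma unitary_star_rep (H : hilbertType R) (rho : F -> 'B(H)) :
  unitary_rep rho -> star_rep rho.
Proof.
move=> h; split=> [g k|g]; first exact: urepM.
have e : rho g * rho g^-1%g = 1 by rewrite -[LHS](urepM h) mulgV (urep1 h).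
rewrite -[LHS]mulr1 -e mulrA.
have -> : adj (rho g) * rho g = 1 by apply: urepUl.
by rewrite mul1r.
Qed.

Lemma opnorm_isometry_le1 (H K : hilbertType R) (u : bop H K) :
  bop_comp (adj u) u = bop_id H -> opnorm u <= 1.
Proof.
move=> h; apply: opnorm_le => // x.
rewrite mul1r -(ler_pXn2r (n := 2)) ?nnegrE ?nr_ge0 // -lecR -!dot_nr.
have -> : dot (u x) (u x) = dot (bop_comp (adj u) u x) x by rewrite bop_compE adjPr.
by rewrite h.
Qed.

Lemma opnorm_urep (H : hilbertType R) (rho : F -> 'B(H)) g :
  unitary_rep rho -> opnorm (rho g) <= 1.
Proof. by move=> h; apply: opnorm_isometry_le1; apply: urepUl. Qed.

Section StarRep.
Context (H : hilbertType R) (rho : F -> 'B(H)) (hr : star_rep rho).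

Lemma gsum_mul s t : gsum rho (gmul s t) = gsum rho s * gsum rho t.
Proof.
rewrite /gsum big_allpairs_dep mulr_suml; apply: eq_bigr => p _.
rewrite mulr_sumr; apply: eq_bigr => q _ /=.
by rewrite (srepM hr) -bop_scaleAl -bop_scaleAr scalerA.
Qed.

Lemma gsum_star s : gsum rho (gstar s) = adj (gsum rho s).
Proof.
rewrite /gsum big_map adj_sum; apply: eq_bigr => p _.
by rewrite adjZ (srepV hr).
Qed.

Lemma gsum_square s : opnorm (gsum rho (gmul (gstar s) s)) = opnorm (gsum rho s) ^+ 2.
Proof. by rewrite gsum_mul gsum_star opnorm_starM. Qed.

End StarRep.
End GroupSums.

(** * Fell absorption *)

Section Fell.
Context {R : realType} (F : groupType) (H : hilbertType R) (delta : F -> H).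
Hypothesis dd : forall g h, dot (delta g) (delta h) = (g == h)%:R.
Hypothesis dt : total delta.

Lemma total_delta_l (K T : hilbertType R) (tau : H -> K -> T) : tensor_model tau ->
  total (fun p : F * K => tau (delta p.1) p.2).
Proof.
move=> ht; have tt := tm_total ht; apply/seteqP; split=> // z _.
apply/closureP_nr => e e0; have e2 : 0 < e / 2 by rewrite divr_gt0.
suff key : exists2 y, lin_span (range (fun p : F * K => tau (delta p.1) p.2)) y &
    nr (z - y) < e by [].
have [s hs] := total_near tt z e2.
have addS (u v : T) : lin_span (range (fun p : F * K => tau (delta p.1) p.2)) u ->
    lin_span (range (fun p : F * K => tau (delta p.1) p.2)) v ->
    lin_span (range (fun p : F * K => tau (delta p.1) p.2)) (u + v).
  move=> [a [ha ->]] [b [hb ->]]; exists (a ++ b); split; last by rewrite big_cat.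
  by move=> p; rewrite mem_cat => /orP[/ha|/hb].
have step (t : seq (R[i] * (H * K))) (d : R) : 0 < d -> exists2 y,
    lin_span (range (fun p : F * K => tau (delta p.1) p.2)) y &
    nr (\sum_(p <- t) p.1 *: tau p.2.1 p.2.2 - y) < d.
  elim: t d => [|[k [x y]] t ih] d d0.
    exists 0; last by rewrite big_nil subrr nr0.
    by exists [::]; rewrite big_nil.
  have d2 : 0 < d / 2 by rewrite divr_gt0.
  have [y1 h1 h1'] := ih _ d2.
  have c0 : 0 < nr y + 1 by rewrite ltr_wpDl ?nr_ge0.
  have d3 : 0 < d / 2 / (nr y + 1) by rewrite divr_gt0.
  have [r] := total_near dt (k *: x) d3; rewrite ltr_pdivlMr // => hr.
  exists (tau (\sum_(p <- r) p.1 *: delta p.2) y + y1).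
    apply: addS => //; elim: r {hr} => [|[c g] r [a [ha ea]]].
      by rewrite big_nil -(scale0r (0 : H)) (tm_Zl ht) scale0r; exists [::]; rewrite big_nil.
    rewrite big_cons (tm_Dl ht) (tm_Zl ht) ea /=.
    exists ((c, tau (delta g) y) :: a); split; last by rewrite big_cons.
    move=> p; rewrite inE => /orP[/eqP->|/ha//]; by exists (g, y).
  rewrite big_cons /= opprD addrACA -(tm_Zl ht).
  have -> : tau (k *: x) y - tau (\sum_(p <- r) p.1 *: delta p.2) y =
     tau (k *: x - \sum_(p <- r) p.1 *: delta p.2) y.
    have tN w : tau (- w) y = - tau w y by rewrite -scaleN1r (tm_Zl ht) scaleN1r.
    by rewrite (tm_Dl ht) tN.
  apply: le_lt_trans (nrD _ _) _; rewrite [d]splitr; apply: ltrD => //.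
  rewrite (tm_nr ht); apply: le_lt_trans hr.
  by rewrite ler_wpM2l ?nr_ge0 // lerDl.
have [y hy hy'] := step s _ e2; exists y => //.
by apply: le_lt_trans (nr_triangle _ _ _) _; last rewrite [e]splitr; apply: ltrD; eauto.
Qed.

(** A block diagonal operator with blocks [U x]; the blocks [adj (U x)] give its inverse. When [U]
    is a unitary representation, [D] intertwines the regular representation tensored with 1 and with
    [U]. *)
Lemma fell_unitary (K T : hilbertType R) (tau : H -> K -> T) (U : F -> 'B(K)) :
  tensor_model tau -> (forall x, adj (U x) * U x = 1) -> (forall x, U x * adj (U x) = 1) ->
  exists D : 'B(T), [/\ forall x v, D (tau (delta x) v) = tau (delta x) (U x v),
    adj D * D = 1 & D * adj D = 1].
Proof.
move=> ht U1 U2; have tt := total_delta_l ht.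
have ex (V : F -> 'B(K)) : (forall x, adj (V x) * V x = 1) -> exists D : 'B(T),
    (forall x v, D (tau (delta x) v) = tau (delta x) (V x v)) /\ adj D * D = 1.
  move=> V1.
  have [|D [hD hd]] := @isometry_extension _ _ _ _ _
    (fun p : F * K => tau (delta p.1) (V p.1 p.2)) 1 ler01 tt.
    move=> [x v] [y w] /=; rewrite !(tm_dot ht) dd mul1r.
    have [->|//] := eqVneq x y; last by rewrite !mul0r.
    by rewrite -adjPr -bop_mulE V1.
  exists D; split=> [x v|]; first exact: (hD (x, v)).
  apply: bopE => x; apply: dot_inj => y.
  by rewrite bop_mulE adjPr hd mul1r.
have [D [hD D1]] := ex U U1.
have [|E [hE _]] := ex (fun x => adj (U x)); first by move=> x; rewrite adjK U2.
have DE : D * E = 1.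
  by apply: (total_op_eq tt) => -[x v]; rewrite /= hE hD -bop_mulE U2.
exists D; split=> //.
have -> : adj D = E by rewrite -[LHS]mulr1 -DE mulrA D1 mul1r.
exact: DE.
Qed.

End Fell.

(** * Deformation of the regular representation *)

Section Deformation.
Context {R : realType} (F : groupType) (g1 g2 : F) (hF : free_on2 g1 g2).
Context (H : hilbertType R) (delta : F -> H) (lambda : F -> 'B(H)).
Hypothesis hl : unitary_rep lambda.
Hypothesis dd : forall g h, dot (delta g) (delta h) = (g == h)%:R.
Hypothesis dt : total delta.
Hypothesis ld : forall g h, lambda g (delta h) = delta (g * h)%g.

Definition swap (h x : F) : F := if x == 1%g then h else if x == h then 1%g else x.

Lemma swapK h : involutive (swap h).
Proof.
move=> x; rewrite /swap; have [->|x1] := eqVneq x 1%g.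
  by have [->//|h1] := eqVneq h 1%g; rewrite ?eqxx.
have [->|xh] := eqVneq x h; first by rewrite !eqxx.
by rewrite (negPf x1) (negPf xh).
Qed.

(* [(1 + z) / 2 + (1 - z) / 2 S] is a path of unitaries from [1] to the
   self-adjoint unitary [S] as [z] runs through the unit circle. *)
Lemma swap_path h : exists V : R[i] -> 'B(H),
  [/\ V 1 = 1, V (-1) (delta 1%g) = delta h,
      forall z x, x != 1%g -> x != h -> V z (delta x) = delta x,
      forall z, nr z = 1 -> adj (V z) * V z = 1 /\ V z * adj (V z) = 1 &
      forall z w, opnorm (V z - V w) <= nr (z - w)].
Proof.
have [|S [hS Sd]] := @isometry_extension _ _ _ delta _ (fun x => delta (swap h x)) 1 ler01 dt.
  by move=> i j; rewrite !dd (inj_eq (can_inj (swapK h))) mul1r.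
have SS : S * S = 1.
  by apply: (total_op_eq dt) => x; rewrite bop_mulE !hS swapK.
have S1 : adj S * S = 1.
  by apply: bopE => x; apply: dot_inj => y; rewrite bop_mulE adjPr Sd mul1r.
have Sa : adj S = S by rewrite -[LHS]mulr1 -SS mulrA S1 mul1r.
have Sn : opnorm S <= 1 by apply: opnorm_isometry_le1.
pose Q := S - 1; pose c (z : R[i]) := (1 - z) / 2.
have QQ : Q * Q = - 2 *: Q.
  rewrite /Q mulrBr mulrBl SS mulr1 mul1r -[in RHS]opprB scalerN scaleNr opprK.
  by rewrite -[2]/(1 + 1) scalerDl !scale1r opprB.
have Qa : adj Q = Q by rewrite /Q adjB Sa adj1.
have Qn : opnorm Q <= 2.
  apply: le_trans (opnormB _ _) _; have := opnorm1_le H; lra.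
pose V z : 'B(H) := 1 + c z *: Q.
(* By [QQ] the product equals 1 plus [a + b - 2 * (a * b)] times [Q]. *)
have VV (a b : R[i]) : a + b = 2 * (a * b) -> (1 + a *: Q) * (1 + b *: Q) = 1.
  move=> ab; rewrite mulrDl mul1r mulrDr mulr1 -bop_scaleAl -bop_scaleAr QQ !scalerA.
  rewrite -addrA -!scalerDl; have -> : b + (a + a * b * - 2) = 0.
    by rewrite addrA [b + a]addrC ab; ring.
  by rewrite scale0r addr0.
have Va z : adj (V z) = 1 + conjc (c z) *: Q by rewrite /V adjD adj1 adjZ Qa.
have n2 : (2 : R[i]) != 0 by rewrite pnatr_eq0.
(* The difference of the two sides is half of [1 - z * conjc z]. *)
have cz z : nr z = 1 -> conjc (c z) + c z = 2 * (conjc (c z) * c z).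
  move=> z1; have zz := nr_sq z; rewrite z1 expr1n in zz.
  have -> : conjc (c z) = (1 - conjc z) / 2.
    by rewrite /c conjcM conjcD conjcN conjc1 conjc_inv conjc_nat.
  apply: (mulfI n2); rewrite /c; apply/eqP; rewrite -subr_eq0; apply/eqP.
  have -> : 2 * ((1 - conjc z) / 2 + (1 - z) / 2) -
     2 * (2 * ((1 - conjc z) / 2 * ((1 - z) / 2))) = 1 - z * conjc z by field.
  by rewrite zz subrr.
exists V; split.
- by rewrite /V /c subrr mul0r scale0r addr0.
- have cm1 : c (-1) = 1 by rewrite /c opprK -[1 + 1]/2 mulfV.
  by rewrite /V cm1 scale1r /Q addrC subrK hS /swap eqxx.
- move=> z x x1 xh; rewrite /V bop_addE bop_scaleE /Q bop_addE bop_oppE !bop_oneE hS.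
  by rewrite /swap (negPf x1) (negPf xh) subrr scaler0 addr0.
- move=> z z1; rewrite Va; split; apply: VV; first exact: cz.
  by rewrite addrC cz // mulrC [c z * _]mulrC mulrC.
- move=> z w; rewrite /V opprD addrACA subrr add0r -scalerBl opnormZ.
  have -> : c z - c w = - (2^-1)%:C * (z - w).
    rewrite /c rmorphV ?unitfE ?pnatr_eq0 //= rmorph_nat; ring.
  rewrite nrM nrN nrR ger0_norm ?invr_ge0 // -mulrA mulrC -mulrA ler_piMr ?nr_ge0 //.
  by have := opnorm_ge0 Q; move: Qn; move: (opnorm Q) => q; lra.
Qed.

(** Each property passes to products and inverses, so it is checked on generators and spread by
    [free_generated]. The Lipschitz constants and the exceptional sets may depend on [g] but not on
    [z], which later permits a compactness argument along the circle. *)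
Lemma deformation : exists pi : R[i] -> F -> 'B(H),
  [/\ forall z, nr z = 1 -> unitary_rep (pi z),
      forall g, pi 1 g = lambda g,
      forall g, pi (-1) g (delta 1%g) = delta 1%g,
      forall g, exists2 C : R, 0 <= C & forall z w, nr z = 1 -> nr w = 1 ->
        opnorm (pi z g - pi w g) <= C * nr (z - w) &
      forall g, exists X : seq F, forall z x, nr z = 1 -> x \notin X ->
        pi z g (delta x) = lambda g (delta x)].
Proof.
(* Swapping 1 with the inverse generator is what makes [pi (-1) g1] fix [delta 1]: the swap moves it
   to [delta g1^-1], and [lambda g1] moves it back. *)
have [V1 [V11 V1m V1x V1u V1l]] := swap_path g1^-1%g.
have [V2 [V21 V2m V2x V2u V2l]] := swap_path g2^-1%g.
have uM (u v : 'B(H)) : adj u * u = 1 -> adj v * v = 1 -> adj (u * v) * (u * v) = 1.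
  by move=> hu hv; rewrite adjM -mulrA [adj u * _]mulrA hu mul1r.
have uM' (u v : 'B(H)) : u * adj u = 1 -> v * adj v = 1 -> u * v * adj (u * v) = 1.
  by move=> hu hv; rewrite adjM -mulrA [v * _]mulrA hv mul1r.
have lU g : adj (lambda g) * lambda g = 1 := urepUl hl g.
have lU' g : lambda g * adj (lambda g) = 1 := urepUr hl g.
have ex z : exists pi : F -> 'B(H), nr z = 1 -> [/\ unitary_rep pi,
    pi g1 = lambda g1 * V1 z & pi g2 = lambda g2 * V2 z].
  have [z1|z1] := eqVneq (nr z) 1; last by exists lambda => /eqP; rewrite (negPf z1).
  have [a1 b1] := V1u z z1; have [a2 b2] := V2u z z1.
  have [pi hpi] := free_representation hF (uM _ _ (lU g1) a1) (uM' _ _ (lU' g1) b1)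
    (uM _ _ (lU g2) a2) (uM' _ _ (lU' g2) b2).
  by exists pi.
have [pi hpi] := choice ex.
have pu z : nr z = 1 -> unitary_rep (pi z) by move=> /hpi[].
have pg1 z : nr z = 1 -> pi z g1 = lambda g1 * V1 z by move=> /hpi[].
have pg2 z : nr z = 1 -> pi z g2 = lambda g2 * V2 z by move=> /hpi[].
have pM z g h : nr z = 1 -> pi z (g * h)%g = pi z g * pi z h.
  by move=> /pu z1; apply: urepM.
have p1 z : nr z = 1 -> pi z 1%g = 1 by move=> /pu z1; apply: urep1.
have pV z g : nr z = 1 -> pi z g^-1%g = adj (pi z g).
  by move=> /pu/unitary_star_rep h; rewrite (srepV h).
have pn z g : nr z = 1 -> opnorm (pi z g) <= 1 by move=> /pu; apply: opnorm_urep.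
have n1 : nr (1 : R[i]) = 1 by apply: nr1.
have nm1 : nr (-1 : R[i]) = 1 by rewrite nrN nr1.
have lVi g x : lambda g^-1%g (lambda g x) = x.
  by rewrite -bop_mulE -[_ * _](urepM hl) mulVg (urep1 hl).
have pVi z g x : nr z = 1 -> pi z g^-1%g (pi z g x) = x.
  by move=> z1; rewrite -bop_mulE -pM // mulVg p1.
exists pi; split=> //.
- apply: (free_generated (P := fun g => pi 1 g = lambda g) _ _ _ hF).
  + by rewrite p1 // [RHS](urep1 hl).
  + by move=> x y hx hy; rewrite pM // hx hy [RHS](urepM hl).
  + by move=> x hx; rewrite pV // hx (srepV (unitary_star_rep hl)).
  + by rewrite pg1 // V11 mulr1.
  + by rewrite pg2 // V21 mulr1.
- apply: (free_generated (P := fun g => pi (-1) g (delta 1%g) = delta 1%g) _ _ _ hF).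
  + by rewrite p1.
  + by move=> x y hx hy; rewrite pM // bop_mulE hy hx.
  + by move=> x hx; rewrite -{1}hx pVi.
  + by rewrite pg1 // bop_mulE V1m ld mulgV.
  + by rewrite pg2 // bop_mulE V2m ld mulgV.
- have gen (V : R[i] -> 'B(H)) g : (forall z w, opnorm (V z - V w) <= nr (z - w)) ->
     (forall z, nr z = 1 -> pi z g = lambda g * V z) ->
     exists2 C : R, 0 <= C & forall z w, nr z = 1 -> nr w = 1 ->
        opnorm (pi z g - pi w g) <= C * nr (z - w).
    move=> hV hg; exists 1 => // z w z1 w1; rewrite !hg // -mulrBr mul1r.
    apply: le_trans (opnormM _ _) _; apply: le_trans (hV z w).
    by rewrite ler_piMl ?opnorm_ge0 ?opnorm_urep.
  apply: (free_generated (P := fun g => exists2 C : R, 0 <= C & forall z w,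
        nr z = 1 -> nr w = 1 -> opnorm (pi z g - pi w g) <= C * nr (z - w)) _ _ _ hF).
  + by exists 0 => // z w z1 w1; rewrite !p1 // subrr opnorm0 mul0r.
  + move=> x y [C C0 hC] [D D0 hD]; exists (C + D); first exact: addr_ge0.
    move=> z w z1 w1; rewrite !pM //.
    apply: le_trans (opnorm_triangle (pi w x * pi z y) _ _) _.
    rewrite -mulrBl -mulrBr [leRHS]mulrDl; apply: lerD; apply: le_trans (opnormM _ _) _.
      by apply: le_trans (hC z w z1 w1); rewrite ler_piMr ?opnorm_ge0 ?pn.
    by apply: le_trans (hD z w z1 w1); rewrite ler_piMl ?opnorm_ge0 ?pn.
  + move=> x [C C0 hC]; exists C => // z w z1 w1.
    by rewrite !pV // -adjB opnorm_adj hC.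
  + exact: (gen V1 _ V1l pg1).
  + exact: (gen V2 _ V2l pg2).
- have gen (V : R[i] -> 'B(H)) g h :
      (forall z x, x != 1%g -> x != h -> V z (delta x) = delta x) ->
     (forall z, nr z = 1 -> pi z g = lambda g * V z) ->
     exists X : seq F, forall z x, nr z = 1 -> x \notin X ->
        pi z g (delta x) = lambda g (delta x).
    move=> hV hg; exists [:: 1%g; h] => z x z1.
    by rewrite !inE negb_or => /andP[x1 xh]; rewrite hg // bop_mulE hV.
  apply: (free_generated (P := fun g => exists X : seq F, forall z x, nr z = 1 ->
        x \notin X -> pi z g (delta x) = lambda g (delta x)) _ _ _ hF).
  + by exists [::] => z x z1 _; rewrite p1 // (urep1 hl).
  + move=> x y [X hX] [Y hY]; exists (Y ++ [seq (y^-1 * u)%g | u <- X]) => z u z1.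
    rewrite mem_cat negb_or => /andP[uY uX].
    rewrite pM // bop_mulE hY // ld hX // ?[lambda (_ * _)%g](urepM hl) ?bop_compE ?ld //.
    apply: contra uX => h; apply/mapP; exists (y * u)%g => //.
    by rewrite mulgA mulVg mul1g.
  + move=> x [X hX]; exists [seq (x * u)%g | u <- X] => z u z1 uX.
    have xX : (x^-1 * u)%g \notin X.
      apply: contra uX => h; apply/mapP; exists (x^-1 * u)%g => //.
      by rewrite mulgA mulgV mul1g.
    have e : pi z x (delta (x^-1 * u)%g) = delta u by rewrite hX // ld mulgA mulgV mul1g.
    by rewrite -{1}e pVi // ld.
  + exact: (gen V1 _ _ V1x pg1).
  + exact: (gen V2 _ _ V2x pg2).
Qed.

End Deformation.

(** * Strong convergence with matrix coefficients *)

Section PowerTrick.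
Context {R : realType}.

(** Here [sq] stands for passing from an element to its adjoint times itself, which squares [f] and
    [N] but keeps [C]. After [k] steps the constant enters only through its root of order [2 ^ k]. A
    single large [k] suffices for given [s] and [e], so upward closure of [Fi] is all that is asked;
    this covers eventual bounds in [n] that are uniform in a further parameter. *)
Lemma power_trick (J S : Type) (Fi : set (set J)) (P : S -> Prop) (sq : S -> S)
    (f : S -> J -> R) (N : S -> R) (C : S -> R) :
  (forall V W : set J, V `<=` W -> Fi V -> Fi W) ->
  (forall s j, 0 <= f s j) -> (forall s, 0 <= N s) -> (forall s, 0 <= C s) ->
  (forall s j, f (sq s) j = f s j ^+ 2) -> (forall s, N (sq s) = N s ^+ 2) ->
  (forall s, C (sq s) = C s) -> (forall s, P s -> P (sq s)) ->
  (forall s e, P s -> 0 < e -> Fi [set j | f s j <= C s * N s + e]) ->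
  forall s e, P s -> 0 < e -> Fi [set j | f s j <= N s + e].
Proof.
move=> mono f0 N0 C0 fsq Nsq Csq Psq h s e Ps e0.
have Ne : 0 < N s + e by rewrite ltr_wpDl.
pose q := N s / (N s + e).
have q0 : 0 <= q by rewrite divr_ge0 // ltW.
have q1 : q < 1 by rewrite ltr_pdivrMr // mul1r ltrDl.
(* [k] is chosen so that [C s] times the power of [q] stays below one half; the other half of the
   power of [N s + e] is left for the additive error [e1]. *)
have c0 : 0 < (2 * (C s + 1))^-1 by rewrite invr_gt0 mulr_gt0 // ltr_wpDl.
have [k hk] := exp_small q0 q1 c0.
have hq : q ^+ (2 ^ k) < (2 * (C s + 1))^-1 by apply: hk; apply/ltnW/ltn_expl.
have it m j : [/\ f (iter m sq s) j = f s j ^+ (2 ^ m),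
    N (iter m sq s) = N s ^+ (2 ^ m), C (iter m sq s) = C s & P (iter m sq s)].
  elim: m => [|m [h1 h2 h3 h4]] /=; first by rewrite expn0 !expr1.
  by rewrite fsq Nsq Csq h1 h2 expnSr !exprM; split=> //; apply: Psq.
have e1 : 0 < (N s + e) ^+ (2 ^ k) / 2 by rewrite divr_gt0 // exprn_gt0.
have Pk : P (iter k sq s) by elim: (k) => //= m ih; apply: Psq.
apply: mono (h _ _ Pk e1) => j /=; have [-> -> -> _] := it k j => hj.
rewrite -(ler_pXn2r (n := 2 ^ k)) ?expn_gt0 ?nnegrE ?(ltW Ne) //.
apply: le_trans hj _; rewrite -lerBrDr.
have -> : (N s + e) ^+ (2 ^ k) - (N s + e) ^+ (2 ^ k) / 2 = (N s + e) ^+ (2 ^ k) / 2.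
  by rewrite [X in X - _]splitr addrK.
have -> : N s ^+ (2 ^ k) = q ^+ (2 ^ k) * (N s + e) ^+ (2 ^ k).
  by rewrite -exprMn /q mulfVK // gt_eqF.
rewrite mulrA [leRHS]mulrC ler_wpM2r ?exprn_ge0 ?(ltW Ne) //.
have := hq; move: (q ^+ _) (exprn_ge0 (2 ^ k) q0) => x x0.
have := C0 s; move: (C s) => c cc0 hx.
have {}hx : x * (2 * (c + 1)) < 1.
  by rewrite -ltr_pdivlMr ?mulr_gt0 ?ltr_wpDl // mul1r.
nra.
Qed.

End PowerTrick.

Section Corner.
Context {R : realType} (F : groupType) (H : hilbertType R) (delta : F -> H).
Hypothesis dd : forall g h, dot (delta g) (delta h) = (g == h)%:R.
Hypothesis dt : total delta.
Context (tau : {bilinear H -> H -> H}) (ht : hilbert_tensor tau).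
Local Notation "a \ox b" := (tensor_op tau a b) (at level 40, left associativity).

Lemma rank_one_exists x y : exists E : 'B(H),
  forall v, E v = dot v (delta y) *: delta x.
Proof.
apply: (@mkbop _ _ _ (fun v => dot v (delta y) *: delta x) 1).
  by move=> a u v; rewrite dotP scalerDl scalerA.
move=> v; have n1 z : nr (delta z) = 1.
  apply/eqP; rewrite -(eqrXn2 (n := 2)) ?nr_ge0 ?ler01 // expr1n; apply/eqP/complexI.
  by rewrite -dot_nr dd eqxx.
rewrite nrZ n1 mulr1 mul1r; apply: le_trans (CauchySchwarz _ _) _.
by rewrite n1 mulr1.
Qed.

Definition matrix_unit x y : 'B(H) := xget 0 [set E : 'B(H) |
  forall v, E v = dot v (delta y) *: delta x].

Lemma matrix_unitE x y v : matrix_unit x y v = dot v (delta y) *: delta x.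
Proof.
have [E hE] := rank_one_exists x y.
exact: (@xgetI _ 0 [set E : 'B(H) | forall v, E v = dot v (delta y) *: delta x] E hE).
Qed.

Lemma opnorm_matrix_unit x y : opnorm (matrix_unit x y) <= 1.
Proof.
have n1 z : nr (delta z) = 1.
  apply/eqP; rewrite -(eqrXn2 (n := 2)) ?nr_ge0 ?ler01 // expr1n; apply/eqP/complexI.
  by rewrite -dot_nr dd eqxx.
apply: opnorm_le => // v; rewrite matrix_unitE nrZ n1 mulr1 mul1r.
by apply: le_trans (CauchySchwarz _ _) _; rewrite n1 mulr1.
Qed.

Lemma matrix_unit_corner x y a :
  matrix_unit x x * a * matrix_unit y y = dot (a (delta y)) (delta x) *: matrix_unit x y.
Proof.
apply: bopE => v; rewrite !bop_mulE bop_scaleE !matrix_unitE !bopZ.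
by rewrite dotZl scalerA mulrC.
Qed.

Context (X : seq F) (uX : uniq X).

Definition basis_proj : 'B(H) := \sum_(x <- X) matrix_unit x x.

Lemma basis_projE x : basis_proj (delta x) = if x \in X then delta x else 0.
Proof.
rewrite bop_sumE; case: ifP => xX.
  rewrite (bigD1_seq x) //= matrix_unitE dd eqxx scale1r big1 ?addr0 // => y yx.
  by rewrite matrix_unitE dd eq_sym (negPf yx) scale0r.
rewrite big1_seq // => y /andP[_ yX]; rewrite matrix_unitE dd.
by have [xy|_] := eqVneq x y; [rewrite xy yX in xX|rewrite scale0r].
Qed.

Lemma basis_proj_adj : adj basis_proj = basis_proj.
Proof.
rewrite adj_sum; apply: eq_bigr => x _; apply: adj_unique => u v.
by rewrite !matrix_unitE dotZl dotZr -dotC mulrC.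
Qed.

Lemma basis_proj_idem : basis_proj * basis_proj = basis_proj.
Proof.
apply: (total_op_eq dt) => x; rewrite bop_mulE basis_projE.
by case: ifP => h; rewrite ?basis_projE ?h // bop0.
Qed.

Implicit Types s t : seq ('B(H) * F).

(** A list [s] is an element of the tensor product of B(H) with the group algebra, and [ev rho]
    applies [rho] to its second leg. When [cornered], [s] is a matrix indexed by [X] with entries in
    the group algebra. *)
Definition ev (rho : F -> 'B(H)) s := \sum_(p <- s) p.1 \ox rho p.2.

Definition ev_sq s :=
  [seq (adj p.1 * q.1, (p.2^-1 * q.2)%g) | p <- s, q <- s].

Lemma ev_sqE (rho : F -> 'B(H)) s : star_rep rho -> ev rho (ev_sq s) = adj (ev rho s) * ev rho s.
Proof.
move=> hr; rewrite /ev big_allpairs_dep adj_sum mulr_suml; apply: eq_bigr => p _.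
rewrite mulr_sumr; apply: eq_bigr => q _ /=.
by rewrite tensor_op_adj // (srepV hr) (srepM hr) tensor_opM.
Qed.

Definition cornered s := forall p, p \in s -> basis_proj * p.1 * basis_proj = p.1.

Definition entry (s : seq ('B(H) * F)) x y : seq (R[i] * F) :=
  [seq (dot (p.1 (delta y)) (delta x), p.2) | p : 'B(H) * F <- s].

Lemma ev_corner (rho : F -> 'B(H)) s : cornered s ->
  ev rho s = \sum_(x <- X) \sum_(y <- X) matrix_unit x y \ox gsum rho (entry s x y).
Proof.
move=> hs; rewrite /ev.
rewrite [RHS](eq_bigr (fun x => \sum_(p <- s) \sum_(y <- X)
   (matrix_unit x x * p.1 * matrix_unit y y) \ox rho p.2)); last first.
  move=> x _; rewrite exchange_big; apply: eq_bigr => y _.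
  rewrite /gsum big_map tensor_op_sumr //; apply: eq_bigr => p _ /=.
  by rewrite matrix_unit_corner tensor_opZl // tensor_opZr.
rewrite exchange_big; apply: eq_big_seq => p ps /=.
rewrite -{1}(hs p ps) /basis_proj !mulr_suml tensor_op_suml //; apply: eq_bigr => x _.
by rewrite mulr_sumr tensor_op_suml.
Qed.

(** An entry is a compression of the whole operator by the isometries that tensor with [delta x] and
    [delta y]. *)
Lemma entry_le (rho : F -> 'B(H)) s x y : opnorm (gsum rho (entry s x y)) <= opnorm (ev rho s).
Proof.
have n1 z : nr (delta z) = 1.
  apply/eqP; rewrite -(eqrXn2 (n := 2)) ?nr_ge0 ?ler01 // expr1n; apply/eqP/complexI.
  by rewrite -dot_nr dd eqxx.
set A := gsum rho _.
have hA v w : dot (A v) w = dot (ev rho s (tau (delta y) v)) (tau (delta x) w).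
  rewrite /A /gsum big_map /ev !bop_sumE !dot_suml; apply: eq_bigr => p _.
  by rewrite tensor_opE // (tensor_dot ht) bop_scaleE dotZl.
apply: opnorm_le => [|v]; first exact: opnorm_ge0.
have [->|v0] := eqVneq (A v) 0; first by rewrite nr0 mulr_ge0 ?opnorm_ge0 ?nr_ge0.
have nv : 0 < nr (A v) by rewrite lt_neqAle nr_ge0 eq_sym nr_eq0 v0.
rewrite -(ler_pM2r nv) -expr2.
have -> : nr (A v) ^+ 2 = nr (dot (A v) (A v)).
  by rewrite dot_nr nrR ger0_norm ?exprn_ge0 ?nr_ge0.
rewrite hA; apply: le_trans (CauchySchwarz _ _) _.
rewrite (tm_nr (hilbert_tensor_model ht)) n1 mul1r ler_wpM2r ?nr_ge0 //.
by apply: le_trans (opnormP _ _) _; rewrite (tm_nr (hilbert_tensor_model ht)) n1 mul1r.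
Qed.

Context (lambda : F -> 'B(H)) (hl : star_rep lambda).
Context (rho : nat -> F -> 'B(H)) (hr : forall n, star_rep (rho n)).
Hypothesis hrho : forall (s : seq (R[i] * F)) (e : R), 0 < e ->
  \forall n \near \oo, opnorm (gsum (rho n) s) <= opnorm (gsum lambda s) + e.

(* Matrices over the group algebra: [ev] of a corner is a matrix of size
   [size X], whose norm is comparable to its entries up to a factor that the
   power trick removes. *)
Lemma corner_limsup s (e : R) : cornered s -> 0 < e ->
  \forall n \near \oo, opnorm (ev (rho n) s) <= opnorm (ev lambda s) + e.
Proof.
(* The number of matrix entries. Each entry is an ordinary group sum, to which [hrho] applies, and
   is at most the whole matrix in norm by [entry_le]. *)
pose C : R := (size X * size X)%:R.
move: s e; apply: (@power_trick R nat _ \oo cornered ev_sq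
  (fun s n => opnorm (ev (rho n) s)) (fun s => opnorm (ev lambda s)) (fun=> C)) => //.
- by move=> V W VW; apply: filterS.
- by move=> s n; apply: opnorm_ge0.
- by move=> s; apply: opnorm_ge0.
- by move=> s n; rewrite ev_sqE // opnorm_starM.
- by move=> s; rewrite ev_sqE // opnorm_starM.
- move=> s hs _ /allpairsP[[p q] [ps qs ->]] /=.
  have aP (a : 'B(H)) : basis_proj * a * basis_proj = a -> a * basis_proj = a.
    by move=> ha; rewrite -{1}ha -mulrA basis_proj_idem ha.
  have Pp : basis_proj * adj p.1 = adj p.1.
    by rewrite -{1}basis_proj_adj -adjM aP //; apply: hs.
  by rewrite mulrA Pp -mulrA aP //; apply: hs.
- move=> s e hs e0.
  pose d := e / (C + 1).
  have d0 : 0 < d by rewrite divr_gt0 // ltr_wpDl.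
  have all_xy (Y Z : seq F) : \forall n \near \oo, forall x y, x \in Y -> y \in Z ->
      opnorm (gsum (rho n) (entry s x y)) <= opnorm (gsum lambda (entry s x y)) + d.
    elim: Y => [|x Y ihY]; first exact: nearW.
    have hx : \forall n \near \oo, forall y, y \in Z ->
      opnorm (gsum (rho n) (entry s x y)) <= opnorm (gsum lambda (entry s x y)) + d.
      elim: Z {ihY} => [|y Z ihZ]; first exact: nearW.
      apply: filterS2 ihZ (hrho (entry s x y) d0) => n h1 h2 z.
      by rewrite inE => /orP[/eqP->|/h1].
    apply: filterS2 ihY hx => n h1 h2 z y.
    by rewrite inE => /orP[/eqP->|/h1]; [apply: h2|apply].
  apply: filterS (all_xy X X) => n hn /=.
  rewrite (ev_corner _ hs); apply: le_trans (opnorm_sum _ _ _) _.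
  apply: (@le_trans _ _ (\sum_(x <- X) \sum_(y <- X) (opnorm (ev lambda s) + d))).
    rewrite big_seq [leRHS]big_seq; apply: ler_sum => x xX.
    apply: le_trans (opnorm_sum _ _ _) _.
    rewrite big_seq [leRHS]big_seq; apply: ler_sum => y yX.
    apply: le_trans (opnorm_tensor_op ht _ _) _.
    apply: (@le_trans _ _ (1 * opnorm (gsum (rho n) (entry s x y)))).
      by rewrite ler_wpM2r ?opnorm_ge0 ?opnorm_matrix_unit.
    by rewrite mul1r; apply: le_trans (hn _ _ xX yX) _; rewrite lerD2r entry_le.
  rewrite !big_const_seq !count_predT !iter_addr_0 -mulrnA -mulr_natl -/C mulrDr lerD2l.
  by rewrite /d mulrA ler_pdivrMr ?ltr_wpDl // mulrC ler_wpM2l ?(ltW e0) // lerDl.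
Qed.

End Corner.

(** * Loops of representations *)

Section StarRepTheory.
Context {R : realType} {F : groupType} (H : hilbertType R).

Lemma star_unitary_rep (rho : F -> 'B(H)) :
  star_rep rho -> rho 1%g = 1 -> unitary_rep rho.
Proof.
move=> h h1; split=> [|g k|g|g]; first exact: h1.
- exact: (srepM h).
- have -> : bop_comp (adj (rho g)) (rho g) = adj (rho g) * rho g by [].
  by rewrite (srepV h) -(srepM h) mulVg h1.
- have -> : bop_comp (rho g) (adj (rho g)) = rho g * adj (rho g) by [].
  by rewrite (srepV h) -(srepM h) mulgV h1.
Qed.

Lemma opnorm_proj_le1 (p : 'B(H)) : adj p * p = p -> opnorm p <= 1.
Proof.
move=> h; have := opnorm_starM p; rewrite h.
have := opnorm_ge0 p; move: (opnorm p) => q q0 hq.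
by clear h; rewrite leNgt; apply/negP => q1; nra.
Qed.

Section Rho.
Context (rho : F -> 'B(H)) (h : star_rep rho).

Lemma star_rep_id_l g : rho 1%g * rho g = rho g.
Proof. by rewrite -(srepM h) mul1g. Qed.
Lemma star_rep_id_r g : rho g * rho 1%g = rho g.
Proof. by rewrite -(srepM h) mulg1. Qed.
Lemma star_rep_id_adj : adj (rho 1%g) = rho 1%g.
Proof. by rewrite (srepV h) invg1. Qed.
Lemma star_rep_cid_l g : (1 - rho 1%g) * rho g = 0.
Proof. by rewrite mulrBl mul1r star_rep_id_l subrr. Qed.
Lemma star_rep_cid_r g : rho g * (1 - rho 1%g) = 0.
Proof. by rewrite mulrBr mulr1 star_rep_id_r subrr. Qed.
Lemma star_rep_cid_adj : adj (1 - rho 1%g) = 1 - rho 1%g.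
Proof. by rewrite adjB adj1 star_rep_id_adj. Qed.
Lemma star_rep_cid_idem : (1 - rho 1%g) * (1 - rho 1%g) = 1 - rho 1%g.
Proof. by rewrite mulrBr mulr1 star_rep_cid_l subr0. Qed.

Lemma opnorm_star_rep g : opnorm (rho g) <= 1.
Proof.
have p1 : opnorm (rho 1%g) <= 1.
  by apply: opnorm_proj_le1; rewrite star_rep_id_adj star_rep_id_l.
rewrite -(ler_pXn2r (n := 2)) ?nnegrE ?opnorm_ge0 // expr1n -opnorm_starM.
by rewrite (srepV h) -(srepM h) mulVg.
Qed.

Lemma opnorm_cid : opnorm (1 - rho 1%g) <= 1.
Proof. by apply: opnorm_proj_le1; rewrite star_rep_cid_adj star_rep_cid_idem. Qed.

(** Adds the trivial representation on the kernel of the projection [rho 1], which gives a unitary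
    representation to which Fell absorption applies. *)
Definition unitize g := rho g + (1 - rho 1%g).

Lemma unitize_rep : unitary_rep unitize.
Proof.
apply: star_unitary_rep; last by rewrite /unitize addrC subrK.
split=> [g k|g]; rewrite /unitize.
  have := star_rep_cid_idem; have := star_rep_cid_l k; have := star_rep_cid_r g.
  move: (1 - rho 1%g) => c h1 h2 h3.
  by rewrite mulrDl !mulrDr h1 h2 h3 (srepM h) addr0 add0r.
by rewrite adjD star_rep_cid_adj (srepV h).
Qed.

End Rho.
End StarRepTheory.

Lemma sqr_add_le (R : realDomainType) (q N e : R) : 0 <= q -> q <= N -> 0 < e ->
  q ^+ 2 + e ^+ 2 <= (N + e) ^+ 2.
Proof. by move=> *; nra. Qed.

(** * Fell absorption and perturbations of finite rank *)

Section Twist.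
Context {R : realType} (F : groupType) (H : hilbertType R) (delta : F -> H).
Context (lambda : F -> 'B(H)).
Hypothesis hl : unitary_rep lambda.
Hypothesis dd : forall g h, dot (delta g) (delta h) = (g == h)%:R.
Hypothesis dt : total delta.
Hypothesis ld : forall g h, lambda g (delta h) = delta (g * h)%g.
Context (tau : {bilinear H -> H -> H}) (ht : hilbert_tensor tau).
Local Notation "a \ox b" := (tensor_op tau a b) (at level 40, left associativity).

Lemma tensor_star_rep (pi rho : F -> 'B(H)) : star_rep pi -> star_rep rho ->
  star_rep (fun g => pi g \ox rho g).
Proof.
move=> hp hr; split=> [g h|g].
  by rewrite (srepM hp) (srepM hr) -tensor_opM.
by rewrite tensor_op_adj // (srepV hp) (srepV hr).
Qed.

Lemma opnorm_conj_le (D A : 'B(H)) : adj D * D = 1 -> opnorm (D * A * adj D) <= opnorm A.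
Proof.
move=> h; have D1 : opnorm D <= 1 by apply: opnorm_isometry_le1.
apply: le_trans (opnormM _ _) _; rewrite opnorm_adj.
apply: (@le_trans _ _ (opnorm A * 1)); last by rewrite mulr1.
rewrite ler_pM ?opnorm_ge0 //; apply: le_trans (opnormM _ _) _.
by rewrite ler_piMl ?opnorm_ge0.
Qed.

Lemma gsum_conj (D E : 'B(H)) (r : F -> 'B(H)) s :
  gsum (fun g => D * r g * E) s = D * gsum r s * E.
Proof.
rewrite /gsum mulr_sumr mulr_suml; apply: eq_bigr => p _.
by rewrite -bop_scaleAr -bop_scaleAl.
Qed.

Lemma gsum_tensor_l (r : F -> 'B(H)) (b : 'B(H)) s :
  gsum (fun g => r g \ox b) s = gsum r s \ox b.
Proof. by rewrite /gsum tensor_op_suml //; apply: eq_bigr => p _; rewrite tensor_opZl. Qed.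

Lemma gsum_tensor_r (r : F -> 'B(H)) (b : 'B(H)) s :
  gsum (fun g => b \ox r g) s = b \ox gsum r s.
Proof. by rewrite /gsum tensor_op_sumr //; apply: eq_bigr => p _; rewrite tensor_opZr. Qed.

Lemma gsum_mulr (r : F -> 'B(H)) (b : 'B(H)) s :
  gsum (fun g => r g * b) s = gsum r s * b.
Proof. by rewrite /gsum mulr_suml; apply: eq_bigr => p _; rewrite bop_scaleAl. Qed.

(** The values of [D] on basis vectors are kept in the conclusion: [representation_family] uses that
    [D] does not move a tensor with first leg [delta 1]. *)
Lemma untwist (rho : F -> 'B(H)) : unitary_rep rho -> exists D : 'B(H),
  [/\ forall x v, D (tau (delta x) v) = tau (delta x) (rho x v),
      adj D * D = 1, D * adj D = 1 &
      forall g, lambda g \ox rho g = D * (lambda g \ox 1) * adj D].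
Proof.
move=> hr; have hm := hilbert_tensor_model ht.
have [D [hD D1 D2]] := fell_unitary dd dt hm (urepUl hr) (urepUr hr).
exists D; split=> // g.
have e : lambda g \ox rho g * D = D * (lambda g \ox 1).
  apply: (total_op_eq (total_delta_l dt hm)) => -[x v].
  have : (lambda g \ox rho g) (D (tau (delta x) v)) = D ((lambda g \ox 1) (tau (delta x) v)).
    rewrite hD !(tensor_opE ht) ld hD; congr (tau _ _).
    by rewrite (urepM hr).
  by [].
by rewrite -e -mulrA D2 mulr1.
Qed.

(** A degenerate [rho] is its unitization cut down by the projection [rho 1]; Fell absorption
    handles the former, and the projection has norm at most 1. *)
Lemma twisted_regular_le (rho : F -> 'B(H)) s : star_rep rho ->
  opnorm (gsum (fun g => lambda g \ox rho g) s) <= opnorm (gsum lambda s).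
Proof.
move=> hr; have [D [_ D1 D2 hD]] := untwist (unitize_rep hr).
have -> : (fun g => lambda g \ox rho g) =
    (fun g => D * (lambda g \ox 1) * adj D * (1 \ox rho 1%g)).
  apply/funext => g; rewrite -hD tensor_opM // mulr1 /unitize mulrDl.
  by rewrite (star_rep_cid_l hr) star_rep_id_r // addr0.
rewrite gsum_mulr gsum_conj gsum_tensor_l.
apply: le_trans (opnormM _ _) _.
apply: (@le_trans _ _ (opnorm (gsum lambda s) * 1)); last by rewrite mulr1.
rewrite ler_pM ?opnorm_ge0 //.
  apply: le_trans (opnorm_conj_le _ D1) _; apply: le_trans (opnorm_tensor_op ht _ _) _.
  by rewrite ler_piMr ?opnorm_ge0 ?opnorm1_le.
apply: le_trans (opnorm_tensor_op ht _ _) _.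
rewrite -[leRHS]mulr1; apply: ler_pM; rewrite ?opnorm_ge0 ?opnorm1_le //.
exact: (opnorm_star_rep hr).
Qed.

Lemma fell_le (pi : F -> 'B(H)) s : unitary_rep pi ->
  opnorm (gsum (fun g => pi g \ox lambda g) s) <= opnorm (gsum lambda s).
Proof.
move=> hp; have hm := tensor_model_flip (hilbert_tensor_model ht).
have [D [hD D1 D2]] := fell_unitary dd dt hm (urepUl hp) (urepUr hp).
have -> : (fun g => pi g \ox lambda g) = (fun g => D * (1 \ox lambda g) * adj D).
  apply/funext => g.
  have e : pi g \ox lambda g * D = D * (1 \ox lambda g).
    apply: (total_op_eq (total_delta_l dt hm)) => -[x v].
    have : (pi g \ox lambda g) (D (tau v (delta x))) = D ((1 \ox lambda g) (tau v (delta x))).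
      rewrite hD !(tensor_opE ht) ld hD; congr (tau _ _).
      by rewrite (urepM hp).
    by [].
  by rewrite -e -mulrA D2 mulr1.
rewrite gsum_conj gsum_tensor_r.
apply: le_trans (opnorm_conj_le _ D1) _; apply: le_trans (opnorm_tensor_op ht _ _) _.
by rewrite ler_piMl ?opnorm_ge0 ?opnorm1_le.
Qed.

Context (rho : nat -> F -> 'B(H)) (hr : forall n, star_rep (rho n)).
Hypothesis hrho : forall (s : seq (R[i] * F)) (e : R), 0 < e ->
  \forall n \near \oo, opnorm (gsum (rho n) s) <= opnorm (gsum lambda s) + e.

(* On the range of a finite basis projection [P] the corner estimate and Fell
   absorption apply; off it [pi] agrees with [lambda]. *)
Lemma perturbed_limsup (pi : F -> 'B(H)) s (e : R) : unitary_rep pi ->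
  (forall g, exists X : seq F, forall x, x \notin X ->
     pi g (delta x) = lambda g (delta x)) -> 0 < e ->
  \forall n \near \oo, opnorm (gsum (fun g => pi g \ox rho n g) s) <=
    2 * opnorm (gsum lambda s) + e.
Proof.
move=> hp hX e0.
have [X0 hX0] : exists X : seq F, forall p x, p \in s -> x \notin X ->
    pi p.2 (delta x) = lambda p.2 (delta x).
  elim: s => [|p s [X ihX]]; first by exists [::].
  have [Y hY] := hX p.2; exists (X ++ Y) => q x.
  rewrite inE mem_cat negb_or => /orP[/eqP->|qs] /andP[xX xY]; first exact: hY.
  exact: ihX.
pose X := undup X0; pose P := basis_proj delta X.
have uX : uniq X := undup_uniq _.
have PP : P * P = P := basis_proj_idem dd dt uX.
have Pa : adj P = P := basis_proj_adj dd X.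
have hl' := unitary_star_rep hl; have hp' := unitary_star_rep hp.
(* The operators [pi g] do not preserve the range of [P], so the sum itself is not [cornered]. Its
   adjoint times itself, compressed by [P] on both sides, is, and by [evc] it records the square of
   the wanted norm. *)
pose c := [seq (p.1 *: (P * pi p.2 * P), p.2) | p <- gmul (gstar s) s].
have cc : cornered delta X c.
  move=> _ /mapP[p _ ->] /=; rewrite -/P -bop_scaleAr -bop_scaleAl; congr (_ *: _).
  by rewrite !mulrA PP -!mulrA PP.
have evc (r : F -> 'B(H)) : star_rep r ->
    opnorm (ev tau r c) = opnorm (gsum (fun g => pi g \ox r g) s * (P \ox 1)) ^+ 2.
  move=> hr'; have hpr := tensor_star_rep hp' hr'.
  rewrite -opnorm_starM adjM tensor_op_adj // adj1 Pa -mulrA [adj _ * _]mulrA.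
  rewrite -(gsum_star hpr) -(gsum_mul hpr) /ev /c big_map /gsum mulr_suml mulr_sumr.
  apply: (congr1 (fun a : 'B(H) => opnorm a)); apply: eq_bigr => p _ /=.
  by rewrite tensor_opZl // -bop_scaleAl -bop_scaleAr !tensor_opM // mul1r mulr1 mulrA.
have PX (x : F) : x \in X = (x \in X0) by rewrite mem_undup.
have off n : gsum (fun g => pi g \ox rho n g) s * ((1 - P) \ox 1) =
    gsum (fun g => lambda g \ox rho n g) s * ((1 - P) \ox 1).
  rewrite /gsum !mulr_suml; apply: eq_big_seq => p ps.
  have e1 : pi p.2 * (1 - P) = lambda p.2 * (1 - P).
    apply: (total_op_eq dt) => x; rewrite !bop_mulE bop_addE bop_oppE bop_oneE.
    rewrite basis_projE // PX; case: ifP => xX; first by rewrite subrr !bop0.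
    by rewrite subr0 hX0 // xX.
  by rewrite -[LHS]bop_scaleAl -[RHS]bop_scaleAl (tensor_opM ht) (tensor_opM ht) e1.
have n1P : opnorm (1 - P) <= 1.
  apply: opnorm_proj_le1; rewrite adjB adj1 Pa mulrBr mulr1 mulrBl mul1r PP.
  by rewrite subrr subr0.
have P1 : opnorm P <= 1 by apply: opnorm_proj_le1; rewrite Pa.
have t1 (a b : 'B(H)) : opnorm a <= 1 -> opnorm b <= 1 -> opnorm (a \ox b) <= 1.
  move=> ha hb; apply: le_trans (opnorm_tensor_op ht _ _) _.
  by rewrite -[leRHS]mulr1 ler_pM ?opnorm_ge0.
(* The corner estimate concerns squared norms, hence the squared error. *)
have e2 : 0 < e ^+ 2 by rewrite exprn_gt0.
apply: filterS (corner_limsup dd dt ht uX hl' hr hrho cc e2) => n.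
rewrite !evc // => h1.
set N := opnorm (gsum lambda s).
have N0 : 0 <= N := opnorm_ge0 _.
have h2 : opnorm (gsum (fun g => pi g \ox lambda g) s * (P \ox 1)) <= N.
  apply: le_trans (opnormM _ _) _.
  apply: (@le_trans _ _ (N * 1)); last by rewrite mulr1.
  by rewrite ler_pM ?opnorm_ge0 ?fell_le ?t1 ?opnorm1_le.
have h3 : opnorm (gsum (fun g => pi g \ox rho n g) s * (P \ox 1)) <= N + e.
  rewrite -(ler_pXn2r (n := 2)) ?nnegrE ?opnorm_ge0 ?addr_ge0 ?(ltW e0) //.
  by apply: le_trans h1 _; apply: sqr_add_le; rewrite ?opnorm_ge0.
have -> : gsum (fun g => pi g \ox rho n g) s =
   gsum (fun g => pi g \ox rho n g) s * (P \ox 1) +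
   gsum (fun g => pi g \ox rho n g) s * ((1 - P) \ox 1).
  by rewrite -mulrDr -tensor_opDl // addrC subrK tensor_op1 // mulr1.
(* The factor 2 comes from adding the bound on the range of [P] and the bound off it. *)
apply: le_trans (opnormD _ _) _; rewrite off mulr_natl mulr2n addrAC; apply: lerD => //.
apply: le_trans (opnormM _ _) _.
apply: (@le_trans _ _ (N * 1)); last by rewrite mulr1.
by rewrite ler_pM ?opnorm_ge0 ?twisted_regular_le ?t1 ?opnorm1_le.
Qed.

End Twist.

Section Circle.
Context {R : realType}.

Definition circle (t : R) : R[i] := cos (2 * trigo.pi * t) +i* sin (2 * trigo.pi * t).

Lemma circle_nr t : nr (circle t) = 1.
Proof. by rewrite /nr normc_def /= cos2Dsin2 sqrtr1. Qed.

Lemma circle0 : circle 0 = 1.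
Proof. by rewrite /circle mulr0 cos0 sin0. Qed.

Lemma circle_half : circle 2^-1 = -1.
Proof.
rewrite /circle mulrAC mulfV // mul1r cospi sinpi.
by apply/eqP; rewrite eq_complex /= oppr0 !eqxx.
Qed.

Lemma circleD1 t : circle (t + 1) = circle t.
Proof.
rewrite /circle mulrDr mulr1 mulr_natl mulr2n addrA.
by rewrite cosDpi cosDpi sinDpi sinDpi !opprK.
Qed.

Lemma circleDn t n : circle (t + n%:R) = circle t.
Proof. by elim: n => [|n ih]; rewrite ?addr0 // -addn1 natrD addrA circleD1. Qed.

Lemma circle_cts t (e : R) : 0 < e -> \forall u \near t, nr (circle u - circle t) < e.
Proof.
move=> e0; have e2 : 0 < e / 2 by rewrite divr_gt0.
have lin : (fun u => 2 * trigo.pi * u) u @[u --> t] --> 2 * trigo.pi * t.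
  by apply: cvgM; [apply: cvg_cst|apply: cvg_id].
have hc : cos (2 * trigo.pi * u) @[u --> t] --> cos (2 * trigo.pi * t).
  by apply: continuous_cvg lin; apply: continuous_cos.
have hs : sin (2 * trigo.pi * u) @[u --> t] --> sin (2 * trigo.pi * t).
  by apply: continuous_cvg lin; apply: continuous_sin.
move/cvgrPdist_lt : hc => /(_ _ e2) hc; move/cvgrPdist_lt : hs => /(_ _ e2) hs.
apply: filterS2 hc hs => u h1 h2.
have -> : circle u - circle t = (cos (2 * trigo.pi * u) - cos (2 * trigo.pi * t))%:C +
   'i * (sin (2 * trigo.pi * u) - sin (2 * trigo.pi * t))%:C.
  by rewrite /circle [LHS]complexE.
apply: le_lt_trans (nrD _ _) _; rewrite nrM !nrR.
have -> : nr ('i : R[i]) = 1 by rewrite /nr normc_def /= expr0n add0r expr1n sqrtr1.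
by rewrite mul1r [e]splitr ltrD // distrC.
Qed.

End Circle.

Section Family.
Context {R : realType} (F : groupType) (g1 g2 : F) (hF : free_on2 g1 g2).
Context (H : hilbertType R) (delta : F -> H) (lambda : F -> 'B(H)).
Hypothesis hl : unitary_rep lambda.
Hypothesis dd : forall g h, dot (delta g) (delta h) = (g == h)%:R.
Hypothesis dt : total delta.
Hypothesis ld : forall g h, lambda g (delta h) = delta (g * h)%g.
Context (tau : {bilinear H -> H -> H}) (ht : hilbert_tensor tau).
Local Notation "a \ox b" := (tensor_op tau a b) (at level 40, left associativity).
Context (rho : nat -> F -> 'B(H)) (hr : forall n, star_rep (rho n)).
Hypothesis hrho : forall (s : seq (R[i] * F)) (e : R), 0 < e ->
  \forall n \near \oo, opnorm (gsum (rho n) s) <= opnorm (gsum lambda s) + e.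

(** The summand of [B] with second leg [1 - rho n 1] compensates for the degeneracy of [rho n]. At
    [z = 1] the two summands combine to [lambda] tensored with the unitization of [rho n], and
    conjugation by [D n] turns this into [lambda] tensored with 1 for every [n]. The Lipschitz
    constants do not depend on [n]. *)
Lemma representation_family : exists Phi : nat -> R[i] -> F -> 'B(H),
  [/\ forall n z, nr z = 1 -> unitary_rep (Phi n z),
      forall n g, Phi n 1 g = lambda g \ox 1,
      forall n g v, rho n 1%g v = v ->
        Phi n (-1) g (tau (delta 1%g) v) = tau (delta 1%g) (rho n g v),
      forall g, exists2 C : R, 0 <= C & forall n z w, nr z = 1 -> nr w = 1 ->
        opnorm (Phi n z g - Phi n w g) <= C * nr (z - w) &
      forall s (e : R), 0 < e -> \forall n \near \oo, forall t, 0 <= t <= 1 ->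
        opnorm (gsum (Phi n (circle t)) s) <= opnorm (gsum lambda s) + e].
Proof.
have [pi [pu p1 pm pL pX]] := deformation hF hl dd dt ld.
have exD (n : nat) := untwist dd dt ld ht (unitize_rep (hr n)).
have [D hD] := choice exD.
pose B n z g := pi z g \ox rho n g + lambda g \ox (1 - rho n 1%g).
pose Phi n z g := adj (D n) * B n z g * D n.
have hlS := unitary_star_rep hl.
have D1 n : adj (D n) * D n = 1 by case: (hD n).
have D2 n : D n * adj (D n) = 1 by case: (hD n).
have BS n z : nr z = 1 -> star_rep (B n z).
  move=> /pu/unitary_star_rep hp; split=> [g h|g]; rewrite /B.
    have := star_rep_cid_idem (hr n); have := star_rep_cid_l (hr n) h.
    have := star_rep_cid_r (hr n) g; move: (1 - rho n 1%g) => c c1 c2 c3.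
    rewrite mulrDl !mulrDr !tensor_opM // c1 c2 c3 !tensor_op0r // addr0 add0r.
    by rewrite -(srepM hp) -(srepM (hr n)) -(srepM hlS).
  rewrite adjD !tensor_op_adj // star_rep_cid_adj // (srepV hp) (srepV (hr n)).
  by rewrite (srepV hlS).
have PhiS n z : nr z = 1 -> star_rep (Phi n z).
  move=> /(BS n) hB; split=> [g h|g]; rewrite /Phi.
    by rewrite (srepM hB) -!mulrA [D n * (adj _ * _)]mulrA D2 mul1r.
  by rewrite !adjM adjK (srepV hB) mulrA.
have PhiU n z : nr z = 1 -> unitary_rep (Phi n z).
  move=> z1; apply: star_unitary_rep; first exact: PhiS.
  rewrite /Phi /B (urep1 (pu z z1)) (urep1 hl) -tensor_opDr // addrC subrK.
  by rewrite tensor_op1 // mulr1 D1.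
exists Phi; split=> //.
- move=> n g; rewrite /Phi /B p1 -tensor_opDr //.
  have [_ _ _ ->] := hD n.
  by rewrite -!mulrA D1 mulr1 mulrA D1 mul1r.
- move=> n g v hv; rewrite /Phi !bop_mulE; have [hDv _ _ _] := hD n.
  have Dv w : rho n 1%g w = w -> D n (tau (delta 1%g) w) = tau (delta 1%g) w.
    by move=> hw; rewrite hDv (urep1 (unitize_rep (hr n))).
  rewrite Dv // /B bop_addE !tensor_opE // pm bop_addE bop_oppE bop_oneE hv subrr.
  rewrite linear0r addr0 -{1}(Dv (rho n g v)); first by rewrite -bop_mulE D1.
  by rewrite -bop_mulE star_rep_id_l.
- move=> g; have [C C0 hC] := pL g; exists C => // n z w z1 w1.
  have -> : Phi n z g - Phi n w g = adj (D n) * ((pi z g - pi w g) \ox rho n g) * D n.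
    rewrite /Phi -mulrBl -mulrBr /B opprD addrACA subrr addr0.
    by rewrite tensor_opDl // tensor_opNl.
  rewrite -{2}[D n]adjK; apply: le_trans (opnorm_conj_le _ _) _.
    by rewrite adjK D2.
  apply: le_trans (opnorm_tensor_op ht _ _) _; apply: le_trans (hC z w z1 w1).
  by rewrite ler_piMr ?opnorm_ge0 // (opnorm_star_rep (hr n)).
(* The constant 3 is the 2 of [perturbed_limsup] plus 1 for the compensating summand, which is
   bounded by the reduced norm. *)
have crude s (e : R) : 0 < e -> \forall n \near \oo, forall t, 0 <= t <= 1 ->
    opnorm (gsum (Phi n (circle t)) s) <= 3 * opnorm (gsum lambda s) + e.
  move=> e0; have e2 : 0 < e / 2 by rewrite divr_gt0.
  have [C C0 hC] : exists2 C : R, 0 <= C & forall n z w, nr z = 1 -> nr w = 1 ->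
      opnorm (gsum (fun g => pi z g \ox rho n g) s -
              gsum (fun g => pi w g \ox rho n g) s) <= C * nr (z - w).
    elim: (s) => [|p r [C C0 hC]].
      by exists 0 => // n z w _ _; rewrite /gsum !big_nil subrr opnorm0 mul0r.
    have [E E0 hE] := pL p.2; exists (nr p.1 * E + C).
      by rewrite addr_ge0 ?mulr_ge0 ?nr_ge0.
    move=> n z w z1 w1; rewrite /gsum !big_cons opprD addrACA -scalerBr.
    apply: le_trans (opnormD _ _) _; rewrite [leRHS]mulrDl; apply: lerD; last exact: hC.
    rewrite opnormZ -mulrA ler_wpM2l ?nr_ge0 // -tensor_opNl // -tensor_opDl //.
    apply: le_trans (opnorm_tensor_op ht _ _) _; apply: le_trans (hE z w z1 w1).
    by rewrite ler_piMr ?opnorm_ge0 // (opnorm_star_rep (hr n)).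
  have twoN : \forall n \near \oo, [set t : R | 0 <= t <= 1] `<=` (fun t =>
      opnorm (gsum (fun g => pi (circle t) g \ox rho n g) s) <=
      2 * opnorm (gsum lambda s) + e).
    have : compact [set t : R | 0 <= t <= 1].
      have -> : [set t : R | 0 <= t <= 1] = `[0, 1]%classic.
        by apply/seteqP; split=> t /=; rewrite in_itv.
      exact: segment_compact.
    (* The estimate at one [t] extends to a neighbourhood of [t] with the same threshold in [n],
       because [C] is independent of [n]; compactness of the unit interval makes the threshold
       uniform. *)
    move/compact_near_coveringP; apply=> t _.
    have hpt : \forall n \near \oo, opnorm (gsum (fun g => pi (circle t) g \ox rho n g) s) <=
        2 * opnorm (gsum lambda s) + e / 2.
      apply: (perturbed_limsup hl dd dt ld ht hr hrho) => //.
        exact/pu/circle_nr.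
      by move=> g; have [X hX] := pX g; exists X => x; apply: hX; apply: circle_nr.
    have c1 : 0 < e / 2 / (C + 1) by rewrite divr_gt0 // ltr_wpDl.
    have hn := circle_cts t c1.
    near=> u n.
    have h1 : nr (circle u - circle t) < e / 2 / (C + 1) by near: u; exact: hn.
    have h2 : opnorm (gsum (fun g => pi (circle t) g \ox rho n g) s) <=
        2 * opnorm (gsum lambda s) + e / 2 by near: n; exact: hpt.
    have h3 := hC n _ _ (circle_nr u) (circle_nr t).
    apply: le_trans (opnorm_le_dist _ (gsum (fun g => pi (circle t) g \ox rho n g) s)) _.
    rewrite [e in leRHS]splitr addrA; apply: lerD => //.
    apply: le_trans h3 _; move: h1; rewrite ltr_pdivlMr ?ltr_wpDl //.
    have := nr_ge0 (circle u - circle t); move: (nr _) => q q0 h1; nra.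
  apply: filterS twoN => n hn t t01.
  have e1 : gsum (Phi n (circle t)) s = adj (D n) * gsum (B n (circle t)) s * adj (adj (D n)).
    by rewrite adjK -gsum_conj.
  rewrite e1; apply: le_trans (opnorm_conj_le _ _) _; first by rewrite adjK D2.
  have -> : gsum (B n (circle t)) s = gsum (fun g => pi (circle t) g \ox rho n g) s +
      gsum lambda s \ox (1 - rho n 1%g).
    rewrite -gsum_tensor_l // /gsum -big_split; apply: eq_bigr => p _.
    by rewrite /B scalerDr.
  have -> : 3 * opnorm (gsum lambda s) + e =
      (2 * opnorm (gsum lambda s) + e) + opnorm (gsum lambda s) by ring.
  apply: le_trans (opnormD _ _) _; apply: lerD; first exact: hn.
  apply: le_trans (opnorm_tensor_op ht _ _) _.
  by rewrite ler_piMr ?opnorm_ge0 // (opnorm_cid (hr n)).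
move=> s e e0.
(* The index is a pair of [n] and [t], and the large sets are those containing all [t] of the unit
   interval for eventually every [n]. Squaring thus removes the factor 3 uniformly along the
   loop. *)
have := @power_trick R (nat * R) (seq (R[i] * F))
  (fun V => \forall n \near \oo, forall t, 0 <= t <= 1 -> V (n, t)) (fun=> True)
  (fun s => gmul (gstar s) s) (fun s j => opnorm (gsum (Phi j.1 (circle j.2)) s))
  (fun s => opnorm (gsum lambda s)) (fun=> 3) _ _ _ _ _ _ _ _ _ s e I e0.
apply.
- by move=> V W VW; apply: filterS => n h t t01; apply/VW/h.
- by move=> r j; apply: opnorm_ge0.
- by move=> r; apply: opnorm_ge0.
- by [].
- by move=> r j; rewrite gsum_square //; apply/PhiS/circle_nr.
- by move=> r; rewrite gsum_square.
- by [].
- by [].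
- by move=> r d _ d0; apply: crude.
Unshelve. all: by end_near.
Qed.

End Family.

(** * Extension to asymptotic representations *)

Section Lift.
Context {R : realType} (F : groupType) (H K : hilbertType R).
Context (lambda : F -> 'B(H)) (hl : unitary_rep lambda).
Context (Phi : R -> F -> 'B(K)) (hPhi : forall t, unitary_rep (Phi t)).
Hypothesis Phi_cts : forall (g : F) (t e : R), 0 <= t -> 0 < e ->
  \forall s \near within [set s | 0 <= s] (nbhs t), opnorm (Phi s g - Phi t g) <= e.
Hypothesis Phi_le : forall (s : seq (R[i] * F)) (e : R), 0 < e ->
  \forall t \near +oo, opnorm (gsum (Phi t) s) <= opnorm (gsum lambda s) + e.

Let hlS := unitary_star_rep hl.
Let PhiS t := unitary_star_rep (hPhi t).

Lemma gsum_diff (V : lmodType R[i]) (r : F -> V) s t :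
  gsum r (s ++ [seq (-1 * p.1, p.2) | p <- t]) = gsum r s - gsum r t.
Proof. by rewrite gsum_cat gsum_scale scaleN1r. Qed.

(** Limits of group sums already form a C*-subalgebra containing the generators, so they exhaust the
    smallest one. *)
Lemma cstar_of_approx x : cstar_of lambda x -> forall e : R, 0 < e ->
  exists s, opnorm (x - gsum lambda s) < e.
Proof.
move=> hx; pose A := [set x : 'B(H) | forall e : R, 0 < e ->
  exists s, opnorm (x - gsum lambda s) < e].
suff : A x by [].
apply: hx; split; last first.
  move=> _ [g _ <-] e e0; exists [:: (1, g)].
  by rewrite /gsum big_seq1 scale1r subrr opnorm0.
split.
- by move=> e e0; exists [::]; rewrite /gsum big_nil subrr opnorm0.
- move=> mu a b ha hb e e0.
  have c0 : 0 < nr mu + 1 by rewrite ltr_wpDl ?nr_ge0.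
  have e2 : 0 < e / 2 by rewrite divr_gt0.
  have e3 : 0 < e / 2 / (nr mu + 1) by rewrite divr_gt0.
  have [s hs] := ha _ e2; have [t ht] := hb _ e3.
  exists (s ++ [seq (mu * p.1, p.2) | p <- t]).
  rewrite gsum_cat gsum_scale opprD addrACA -scalerBr.
  apply: le_lt_trans (opnormD _ _) _; rewrite [e]splitr; apply: ltrD => //.
  rewrite opnormZ; move: ht; rewrite (ltr_pdivlMr _ _ c0) => /le_lt_trans; apply.
  by rewrite mulrC ler_wpM2l ?opnorm_ge0 // lerDl.
- move=> a b ha hb e e0.
  have e2 : 0 < e / 2 by rewrite divr_gt0.
  have b0 : 0 < opnorm b + 1 by rewrite ltr_wpDl ?opnorm_ge0.
  have [|s hs] := ha (e / 2 / (opnorm b + 1)); first by rewrite divr_gt0.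
  have s0 : 0 < opnorm (gsum lambda s) + 1 by rewrite ltr_wpDl ?opnorm_ge0.
  have [|t ht] := hb (e / 2 / (opnorm (gsum lambda s) + 1)); first by rewrite divr_gt0.
  exists (gmul s t); rewrite gsum_mul //.
  have -> : bop_comp a b - gsum lambda s * gsum lambda t =
      (a - gsum lambda s) * b + gsum lambda s * (b - gsum lambda t).
    by rewrite mulrBl mulrBr addrA subrK.
  move: hs ht; rewrite (ltr_pdivlMr _ _ b0) (ltr_pdivlMr _ _ s0) => hs ht.
  apply: le_lt_trans (opnormD _ _) _; rewrite [e]splitr; apply: ltrD.
    apply: le_lt_trans (opnormM _ _) _; apply: le_lt_trans hs.
    by rewrite ler_wpM2l ?opnorm_ge0 // lerDl.
  apply: le_lt_trans (opnormM _ _) _; rewrite mulrC; apply: le_lt_trans ht.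
  by rewrite ler_wpM2l ?opnorm_ge0 // lerDl.
- move=> a ha e e0; have [s hs] := ha _ e0; exists (gstar s).
  by rewrite gsum_star // -adjB opnorm_adj.
- move=> a ha e e0; have e2 : 0 < e / 2 by rewrite divr_gt0.
  have [b Ab hb] := ha _ e2; have [s hs] := Ab _ e2; exists s.
  by apply: le_lt_trans (opnorm_triangle b _ _) _; rewrite [e]splitr ltrD.
Qed.

(** [G] behaves for large [t] as the value of [Phi t] at [x] would, although [Phi t] is defined on
    group sums only and need not extend to the completion. *)
Definition shadows (G : R -> 'B(K)) (x : 'B(H)) := forall e : R, 0 < e ->
  exists2 s, opnorm (x - gsum lambda s) <= e &
    \forall t \near +oo, opnorm (G t - gsum (Phi t) s) <= e.

(** Two approximating sums of [x] are close under [lambda], hence by [Phi_le] eventually close under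
    [Phi t]. The five errors are two for approximating [x], two for [G] and [G'], and one from
    [Phi_le]. *)
Lemma shadows_unique G G' x : shadows G x -> shadows G' x -> vanishes (fun t => G t - G' t).
Proof.
move=> hG hG' e e0; have e5 : 0 < e / 5 by rewrite divr_gt0.
have [s hs hs'] := hG _ e5; have [r hr hr'] := hG' _ e5.
apply: filterS3 hs' hr' (Phi_le (s ++ [seq (-1 * p.1, p.2) | p <- r]) e5) => t h1 h2.
rewrite !gsum_diff => h3.
apply: le_trans (opnorm_triangle (gsum (Phi t) s) _ _) _.
apply: le_trans (lerD (lexx _) (opnorm_triangle (gsum (Phi t) r) _ _)) _.
rewrite [opnorm (_ - G' t)]opnorm_dist.
have := opnorm_triangle x (gsum lambda s) (gsum lambda r).
rewrite [opnorm (gsum lambda s - x)]opnorm_dist;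
move: h1 h2 h3 hs hr; move: (opnorm _) (opnorm _) (opnorm _) (opnorm _) (opnorm _) (opnorm _).
move=> a b c d f g; lra.
Qed.

Lemma shadows_lin G G' mu a b : shadows G a -> shadows G' b ->
  shadows (fun t => G t + mu *: G' t) (a + mu *: b).
Proof.
move=> ha hb e e0.
have e1 : 0 < e / (nr mu + 2) by rewrite divr_gt0 // ltr_wpDl ?nr_ge0.
have key (V : normedModType R[i]) (u v : bop V V) : opnorm u <= e / (nr mu + 2) ->
    opnorm v <= e / (nr mu + 2) -> opnorm (u + mu *: v) <= e.
  rewrite !ler_pdivlMr ?ltr_wpDl ?nr_ge0 // => h1 h2.
  apply: le_trans (opnormD _ _) _; rewrite opnormZ.
  have := nr_ge0 mu; have := opnorm_ge0 u; have := opnorm_ge0 v.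
  move: h1 h2; move: (opnorm u) (opnorm v) (nr mu) => p q m h1 h2 q0 p0 m0.
  have := ler_wpM2l m0 h2; have := mulr_ge0 m0 p0;
  have [h|h] := lerP p q; nra.
have [s hs hs'] := ha _ e1; have [r hr hr'] := hb _ e1.
exists (s ++ [seq (mu * p.1, p.2) | p <- r]).
  by rewrite gsum_cat gsum_scale opprD addrACA -scalerBr key.
apply: filterS2 hs' hr' => t h1 h2.
by rewrite gsum_cat gsum_scale opprD addrACA -scalerBr key.
Qed.

Lemma shadows_adj G a : shadows G a -> shadows (fun t => adj (G t)) (adj a).
Proof.
move=> ha e e0; have [s hs hs'] := ha _ e0; exists (gstar s).
  by rewrite gsum_star // -adjB opnorm_adj.
by apply: filterS hs' => t; rewrite gsum_star // -adjB opnorm_adj.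
Qed.

Lemma shadows_mul G G' a b : shadows G a -> shadows G' b ->
  shadows (fun t => G t * G' t) (a * b).
Proof.
(* The two terms of the product estimate carry the factors [opnorm b + 3] and [opnorm a + 2], whose
   sum is [c]. *)
move=> ha hb e e0; pose c := opnorm a + opnorm b + 5.
have c0 : 0 < c by rewrite ltr_wpDl // addr_ge0 ?opnorm_ge0.
pose d := Num.min 1 (e / c).
have d0 : 0 < d by rewrite lt_min ltr01 divr_gt0.
have d1 : d <= 1 by rewrite /d ge_min lexx.
have dc : d * c <= e by rewrite -ler_pdivlMr // /d ge_min lexx orbT.
have key (V : normedModType R[i]) (u v u' v' : bop V V) :
    opnorm (u - u') <= d -> opnorm (v - v') <= d -> opnorm u' <= opnorm a + 2 ->
    opnorm v <= opnorm b + 3 -> opnorm (u * v - u' * v') <= e.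
  move=> h1 h2 h3 h4.
  have -> : u * v - u' * v' = (u - u') * v + u' * (v - v').
    by rewrite mulrBl mulrBr addrA subrK.
  apply: le_trans (opnormD _ _) _; apply: le_trans (lerD (opnormM _ _) (opnormM _ _)) _.
  apply: le_trans dc.
  apply: (@le_trans _ _ (d * (opnorm b + 3) + (opnorm a + 2) * d)).
    by apply: lerD; rewrite ler_pM ?opnorm_ge0.
  by rewrite le_eqVlt; apply/orP; left; apply/eqP; rewrite /c; ring.
have [s hs hs'] := ha _ d0; have [r hr hr'] := hb _ d0.
have sa : opnorm (gsum lambda s) <= opnorm a + 1.
  by apply: le_trans (opnorm_le_dist _ a) _; rewrite lerD2l opnorm_dist (le_trans hs).
have rb : opnorm (gsum lambda r) <= opnorm b + 1.
  by apply: le_trans (opnorm_le_dist _ b) _; rewrite lerD2l opnorm_dist (le_trans hr).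
exists (gmul s r).
  rewrite gsum_mul //; apply: key => //; first by apply: le_trans sa _; rewrite lerD2l; lra.
  by rewrite lerDl.
apply: filterS3 hs' hr' (filterI (Phi_le s ltr01) (Phi_le r ltr01)) => t h1 h2 [h3 h4].
rewrite gsum_mul //; apply: key => //; first lra.
have := opnorm_le_dist (G' t) (gsum (Phi t) r); lra.
Qed.

Lemma gsum_cts s (t e : R) : 0 <= t -> 0 < e ->
  \forall u \near within [set u | 0 <= u] (nbhs t),
    opnorm (gsum (Phi u) s - gsum (Phi t) s) <= e.
Proof.
move=> t0; elim: s e => [|p s ih] e e0.
  by apply: nearW => u; rewrite /gsum !big_nil subrr opnorm0 ltW.
have e2 : 0 < e / 2 by rewrite divr_gt0.
have c0 : 0 < nr p.1 + 1 by rewrite ltr_wpDl ?nr_ge0.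
have e3 : 0 < e / 2 / (nr p.1 + 1) by rewrite divr_gt0.
apply: filterS2 (ih _ e2) (Phi_cts p.2 t0 e3) => u h1.
rewrite (ler_pdivlMr _ _ c0) => h2.
rewrite /gsum !big_cons opprD addrACA -scalerBr [e]splitr.
apply: le_trans (opnormD _ _) _; apply: lerD => //.
rewrite opnormZ mulrC; apply: le_trans h2.
by rewrite ler_wpM2l ?opnorm_ge0 // lerDl.
Qed.

Definition ramp (u : R) : R := Num.min 1 (Num.max 0 u).

Lemma ramp_ge0 u : 0 <= ramp u.
Proof. by rewrite /ramp le_min ler01 le_max lexx. Qed.
Lemma ramp_le1 u : ramp u <= 1.
Proof. by rewrite /ramp ge_min lexx. Qed.
Lemma ramp0 u : u <= 0 -> ramp u = 0.
Proof. by move=> h; rewrite /ramp max_l // min_r. Qed.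
Lemma ramp1 u : 1 <= u -> ramp u = 1.
Proof. by move=> h; rewrite /ramp min_l // le_max h orbT. Qed.
Lemma ramp_lip u v : `|ramp u - ramp v| <= `|u - v|.
Proof.
have rE w : [\/ w <= 0 /\ ramp w = 0, 0 <= w <= 1 /\ ramp w = w | 1 <= w /\ ramp w = 1].
  have [w0|/ltW w0] := lerP w 0; first by constructor 1; rewrite ramp0.
  have [w1|/ltW w1] := lerP 1 w; first by constructor 3; rewrite ramp1.
  by constructor 2; rewrite w0 w1 /ramp max_r // min_r.
have := ler_norm (u - v); have := ler_norm (v - u); rewrite distrC ler_norml.
have [[? ->]|[/andP[? ?] ->]|[? ->]] := rE u;
  have [[? ->]|[/andP[? ?] ->]|[? ->]] := rE v => *; apply/andP; split; lra.
Qed.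

Lemma pinfty_ex (P : R -> Prop) : (\forall t \near +oo, P t) ->
  forall T0, exists T, T0 <= T /\ forall t, T < t -> P t.
Proof.
move=> [M [_ hM]] T0; exists (Num.max M T0); split; first by rewrite le_max lexx orbT.
by move=> t ht; apply: hM; apply: le_lt_trans ht; rewrite le_max lexx.
Qed.

(* The slowly growing interpolation: the increment towards the [k.+1]-st
   approximant is switched on only after the time from which it is small. *)
Lemma continuous_shadow x : cstar_of lambda x -> exists f : R -> 'B(K),
  (forall t e : R, 0 <= t -> 0 < e ->
     \forall s \near within [set s | 0 <= s] (nbhs t), opnorm (f s - f t) <= e) /\
  shadows f x.
Proof.
move=> hx; pose eps (k : nat) : R := 2^-1 ^+ k.
have eps0 k : 0 < eps k by rewrite exprn_gt0 // invr_gt0.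
have epsS k : eps k.+1 = eps k / 2 by rewrite /eps exprSr.
have exs k : exists s, opnorm (x - gsum lambda s) < eps k by apply: cstar_of_approx.
have [s hs] := choice exs.
pose d k := s k.+1 ++ [seq (-1 * p.1, p.2) | p <- s k].
have dk k : opnorm (gsum lambda (d k)) <= 2 * eps k.
  rewrite /d gsum_diff; apply: le_trans (opnorm_triangle x _ _) _.
  rewrite [opnorm (_ - x)]opnorm_dist; have := hs k; have := hs k.+1.
  rewrite epsS; have := eps0 k; lra.
(* [k%:R <= T k] keeps the later sum locally finite in time. The bound [3 * eps k] is [dk] plus an
   error [eps k] from [Phi_le]. *)
have exT (k : nat) : exists T : R, k%:R <= T /\ forall t, T < t ->
    opnorm (gsum (Phi t) (d k)) <= 3 * eps k.
  have [T [kT hT]] := pinfty_ex (Phi_le (d k) (eps0 k)) k%:R.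
  exists T; split=> // t /hT h; have := dk k; lra.
have [T hT] := choice exT.
pose fM (M : nat) t := gsum (Phi t) (s 0%N) +
  \sum_(0 <= k < M) (ramp (t - T k))%:C *: gsum (Phi t) (d k).
have fM_ext M M' t : (M <= M')%N -> t <= M%:R -> fM M t = fM M' t.
  move=> MM tM; rewrite /fM (big_cat_nat (n := M) (leq0n M) MM) /=.
  suff -> : \sum_(M <= k < M') (ramp (t - T k))%:C *: gsum (Phi t) (d k) = 0 by rewrite addr0.
  rewrite big_nat big1 // => k /andP[Mk _].
  rewrite ramp0 ?scale0r // subr_le0; apply: le_trans tM _.
  by apply: le_trans (proj1 (hT k)); rewrite ler_nat.
have exM (t : R) : exists M : nat, t <= M%:R.
  by exists (Num.truncn `|t|).+1; apply: ltW; apply: le_lt_trans (ler_norm t) (truncnS_gt _).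
have [Mt hMt] := choice exM.
pose f t := fM (Mt t) t.
have fE M t : t <= M%:R -> f t = fM M t.
  move=> tM; rewrite /f; have [h|/ltnW h] := leqP (Mt t) M; first exact: fM_ext.
  by apply/esym/fM_ext.
exists f; split.
- move=> t e t0 e0; have [M hM] := exM (t + 1).
  have tM : t <= M%:R by apply: le_trans hM; rewrite lerDl.
  have cM : forall e : R, 0 < e -> \forall u \near within [set u | 0 <= u] (nbhs t),
      opnorm (fM M u - fM M t) <= e.
    elim: (M) => [|m ih] {e e0} e e0.
      by apply: filterS (gsum_cts (s 0%N) t0 e0) => u; rewrite /fM !big_geq // !addr0.
    have e3 : 0 < e / 3 by rewrite divr_gt0.
    pose N := opnorm (gsum (Phi t) (d m)) + 1.
    have N0 : 0 < N by rewrite ltr_wpDl ?opnorm_ge0.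
    have e4 : 0 < e / 3 / N by rewrite divr_gt0.
    have near_u : \forall u \near within [set u | 0 <= u] (nbhs t), `|u - t| < e / 3 / N.
      apply: cvg_within; have /cvgrPdist_lt/(_ _ e4) : id @ t --> t by apply: cvg_id.
      by apply: filterS => u; rewrite distrC.
    apply: filterS3 (ih _ e3) (gsum_cts (d m) t0 e3) near_u => u h1 h2 h3.
    have fS v : fM m.+1 v = fM m v + (ramp (v - T m))%:C *: gsum (Phi v) (d m).
      by rewrite /fM big_nat_recr //= addrA.
    pose w := (ramp (u - T m))%:C *: (gsum (Phi u) (d m) - gsum (Phi t) (d m)) +
       (ramp (u - T m) - ramp (t - T m))%:C *: gsum (Phi t) (d m).
    have -> : fM m.+1 u - fM m.+1 t = (fM m u - fM m t) + w.
      have rB : (ramp (u - T m) - ramp (t - T m))%:C =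
        (ramp (u - T m))%:C - (ramp (t - T m))%:C by exact: rmorphB.
      by rewrite !fS opprD addrACA /w rB scalerBr scalerBl subrKA.
    apply: le_trans (opnormD _ _) _.
    have -> : e = e / 3 + (e / 3 + e / 3) by field.
    rewrite /w; apply: lerD => //; apply: le_trans (opnormD _ _) _; apply: lerD.
      rewrite opnormZ nrR ger0_norm ?ramp_ge0 //; apply: le_trans h2.
      by rewrite ler_piMl ?opnorm_ge0 ?ramp_le1.
    rewrite opnormZ nrR; move: h3; rewrite (ltr_pdivlMr _ _ N0) => h3.
    apply: le_trans (ltW h3); rewrite ler_pM ?opnorm_ge0 //.
      by apply: le_trans (ramp_lip _ _) _; rewrite opprB addrA subrK.
    by rewrite /N lerDl.
  have near1 : \forall u \near within [set u | 0 <= u] (nbhs t), u < t + 1.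
    by apply: cvg_within; apply: lt_nbhsl; rewrite ltrDl.
  apply: filterS2 (cM _ e0) near1 => u h1 h2.
  by rewrite (fE M) ?(fE M t tM) // (le_trans (ltW h2)).
- move=> e e0.
  have h2 : (2^-1 : R) < 1 by lra.
  have h2' : 0 <= (2^-1 : R) by lra.
  have e6 : 0 < e / 6 by rewrite divr_gt0.
  (* The increments still being switched on add up to at most three times the geometric tail
     [2 * eps k], hence the 6. *)
  have [k /(_ k (leqnn k)) hk] := exp_small h2' h2 e6.
  exists (s k).
    apply: le_trans (ltW (hs k)) _; apply: le_trans (ltW hk) _.
    by rewrite ler_pdivrMr //; lra.
  have late : \forall t \near +oo, forall j, (j < k)%N -> T j + 1 <= t.
    elim: (k) => [|m ih]; first by apply: nearW.
    apply: filterS2 ih (nbhs_pinfty_ge (num_real (T m + 1))) => t h1 h3 j.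
    by rewrite ltnS leq_eqVlt => /orP[/eqP->|/h1].
  apply: filterS late => t ht.
  have [M0 hM0] := exM t; pose M := maxn k M0.
  have kM : (k <= M)%N := leq_maxl _ _.
  have tM : t <= M%:R by apply: le_trans hM0 _; rewrite ler_nat leq_maxr.
  (* Once all ramps below [k] equal 1, the increments telescope to the approximant [s k]. *)
  have headE : fM k t = gsum (Phi t) (s k).
    elim: (k) ht => [|m ih] ht; first by rewrite /fM big_geq ?addr0.
    rewrite /fM big_nat_recr //= addrA -/(fM m t) ih; last first.
      by move=> j jm; apply: ht; apply: ltnW.
    have T1 : 1 <= t - T m by rewrite lerBrDr addrC; apply: ht.
    by rewrite ramp1 // scale1r /d gsum_diff addrC subrK.
  have fME : fM M t = fM k t + \sum_(k <= j < M) (ramp (t - T j))%:C *: gsum (Phi t) (d j).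
    by rewrite /fM (big_cat_nat (n := k) (leq0n k) kM) /= addrA.
  rewrite (fE M t tM) fME headE addrC addKr; apply: le_trans (opnorm_sum _ _ _) _.
  apply: (@le_trans _ _ (\sum_(k <= j < M) 3 * eps j)).
    apply: ler_sum => j _; rewrite opnormZ nrR ger0_norm ?ramp_ge0 //.
    have [jt|tj] := ltP (T j) t.
      apply: le_trans (proj2 (hT j) _ jt).
      by rewrite ler_piMl ?opnorm_ge0 ?ramp_le1.
    by rewrite ramp0 ?subr_le0 // mul0r mulr_ge0 // ltW.
  rewrite -mulr_sumr.
  have geo m : \sum_(k <= j < k + m) eps j <= 2 * eps k - 2 * eps (k + m)%N.
    elim: m => [|m ih]; first by rewrite addn0 big_geq // subrr.
    rewrite addnS big_nat_recr ?leq_addr //= epsS; have := ih; lra.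
  have := geo (M - k)%N; rewrite subnKC // => hgeo.
  have := eps0 M; rewrite -/(eps k) ltr_pdivlMr // in hk *.
  move: hgeo; move: (\sum_(_ <= _ < _) _) => S; lra.
Qed.

(** A continuous shadow is chosen for each element independently. The algebraic relations then hold
    asymptotically because both sides shadow the same element. *)
Lemma lift_asymptotic : exists phi : R -> 'B(H) -> 'B(K),
  asymptotic_representation (cstar_of lambda) phi /\
  forall g, vanishes (fun t => phi t (lambda g) - Phi t g).
Proof.
have ex x : exists f : R -> 'B(K), cstar_of lambda x ->
  (forall t e : R, 0 <= t -> 0 < e ->
     \forall s \near within [set s | 0 <= s] (nbhs t), opnorm (f s - f t) <= e) /\
  shadows f x.
  have [hx|hx] := pselect (cstar_of lambda x); last by exists (fun=> 0).
  by have [f hf] := continuous_shadow hx; exists f.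
have [f hf] := choice ex; exists (fun t x => f x t).
have hA := cstar_of_subalgebra lambda.
have sh x : cstar_of lambda x -> shadows (f x) x by move=> /hf[].
split; last first.
  move=> g; apply: shadows_unique (sh _ (@cstar_of_gen _ _ _ lambda g)) _.
  move=> e e0; exists [:: (1, g)].
    by rewrite /gsum big_seq1 scale1r subrr opnorm0 ltW.
  by apply: nearW => t; rewrite /gsum big_seq1 scale1r subrr opnorm0 ltW.
split.
- move=> a Aa t t0; apply/cvgrPdist_le => e e0.
  have [hc _] := hf a Aa; apply: filterS (hc t e t0 e0) => s.
  by rewrite sub0r normrN ger0_norm ?opnorm_ge0.
- move=> mu a b Aa Ab; apply/cvg_vanishes.
  have := shadows_unique (sh _ (cstar_lin hA mu Aa Ab))
    (shadows_lin mu (sh _ Aa) (sh _ Ab)).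
  by apply: vanishes_eq => t; rewrite opprD addrA.
- move=> a b Aa Ab; apply/cvg_vanishes.
  exact: shadows_unique (sh _ (cstar_mul hA Aa Ab)) (shadows_mul (sh _ Aa) (sh _ Ab)).
- move=> a Aa; apply/cvg_vanishes.
  exact: shadows_unique (sh _ (cstar_adj hA Aa)) (shadows_adj (sh _ Aa)).
Qed.

End Lift.

(** * Concatenation of the loops *)

Section AsymptoticFamily.
Context {R : realType} (F : groupType) (g1 g2 : F) (hF : free_on2 g1 g2).
Context (H : hilbertType R) (delta : F -> H) (lambda : F -> 'B(H)).
Hypothesis hl : unitary_rep lambda.
Hypothesis dd : forall g h, dot (delta g) (delta h) = (g == h)%:R.
Hypothesis dt : total delta.
Hypothesis ld : forall g h, lambda g (delta h) = delta (g * h)%g.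
Context (tau : {bilinear H -> H -> H}) (ht : hilbert_tensor tau).

Lemma conj_star_rep (K : hilbertType R) (J : bop K H) (sigma : F -> 'B(K)) :
  unitary_rep sigma -> bop_comp (adj J) J = bop_id K ->
  star_rep (fun g => bop_comp J (bop_comp (sigma g) (adj J))).
Proof.
move=> hs hJ; have hs' := unitary_star_rep hs; split=> [g h|g].
  apply: bopE => x; rewrite bop_mulE !bop_compE (srepM hs') bop_mulE.
  have JJ y : adj J (J y) = y by rewrite -bop_compE hJ.
  by rewrite JJ.
by rewrite !adj_comp adjK (srepV hs'); apply: bopE.
Qed.

Lemma opnorm_conj_gsum (K : hilbertType R) (J : bop K H) (sigma : F -> 'B(K)) s :
  bop_comp (adj J) J = bop_id K ->
  opnorm (gsum (fun g => bop_comp J (bop_comp (sigma g) (adj J))) s) <=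
  opnorm (gsum sigma s).
Proof.
move=> hJ; have J1 : opnorm J <= 1 by apply: opnorm_isometry_le1.
have -> : gsum (fun g => bop_comp J (bop_comp (sigma g) (adj J))) s =
    bop_comp J (bop_comp (gsum sigma s) (adj J)).
  apply: bopE => x; rewrite !bop_compE /gsum !bop_sumE bop_suml.
  by apply: eq_bigr => p _; rewrite !bop_scaleE !bop_compE bopZ.
apply: le_trans (opnorm_comp _ _) _.
apply: (@le_trans _ _ (1 * opnorm (gsum sigma s))); last by rewrite mul1r.
rewrite ler_pM ?opnorm_ge0 //; apply: le_trans (opnorm_comp _ _) _.
by rewrite opnorm_adj ler_piMr ?opnorm_ge0.
Qed.

(* At time [n + 1/2] the representation [Psi] contains [sigma n], acting on
   [delta 1 (x) J n]. *)
Lemma asymptotic_family (K : nat -> hilbertType R) (sigma : forall n, F -> 'B(K n))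
    (J : forall n, bop (K n) H) :
  (forall n, unitary_rep (sigma n)) ->
  (forall n, bop_comp (adj (J n)) (J n) = bop_id (K n)) ->
  (forall s (e : R), 0 < e -> \forall n \near \oo,
     opnorm (gsum (sigma n) s) <= opnorm (gsum lambda s) + e) ->
  exists phi : R -> 'B(H) -> 'B(H), exists Psi : R -> F -> 'B(H),
  [/\ asymptotic_representation (cstar_of lambda) phi,
      forall t, unitary_rep (Psi t),
      forall g, vanishes (fun t => phi t (lambda g) - Psi t g) &
      forall (n : nat) g v, Psi (n%:R + 2^-1) g (tau (delta 1%g) (J n v)) =
        tau (delta 1%g) (J n (sigma n g v))].
Proof.
move=> hs hJ hlim.
pose rho n g := bop_comp (J n) (bop_comp (sigma n g) (adj (J n))).
have hr (n : nat) : star_rep (rho n) by apply: conj_star_rep.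
have hrho (s : seq (R[i] * F)) (e : R) : 0 < e ->
    \forall n \near \oo, opnorm (gsum (rho n) s) <= opnorm (gsum lambda s) + e.
  move=> e0; apply: filterS (hlim s e e0) => n; apply: le_trans.
  exact: opnorm_conj_gsum.
have [Phi [PU P1 Pm PL Ple]] := representation_family hF hl dd dt ld ht hr hrho.
(* The loop of index [n] is run through on the time interval from [n] to [n + 1]. *)
pose Psi t := Phi (Num.truncn t) (circle t).
have PsiU t : unitary_rep (Psi t) by apply/PU/circle_nr.
have JJ n v : adj (J n) (J n v) = v by rewrite -bop_compE hJ.
have [||phi [hphi hv]] := lift_asymptotic hl PsiU.
- move=> g t e t0 e0; have [C C0 hC] := PL g.
  have c1 : 0 < e / (C + 1) by rewrite divr_gt0 // ltr_wpDl.
  have lip (n : nat) z w : nr z = 1 -> nr w = 1 -> nr (z - w) < e / (C + 1) ->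
      opnorm (Phi n z g - Phi n w g) <= e.
    move=> z1 w1; rewrite ltr_pdivlMr ?ltr_wpDl // => h.
    apply: le_trans (hC n z w z1 w1) _; apply: le_trans (ltW h).
    by rewrite mulrC ler_wpM2l ?nr_ge0 // lerDl.
  have n1 : nr (1 : R[i]) = 1 := nr1.
  have /andP[nt tn] := truncn_itv t0.
  have near_c : \forall u \near within [set u | 0 <= u] (nbhs t),
      nr (circle u - circle t) < e / (C + 1).
    by apply: cvg_within; apply: circle_cts.
  (* At an integer time the index jumps, but all loops share the base point, so a nearby value is
     compared with the base point of its own loop. At other times the index is locally constant. *)
  move: nt; rewrite le_eqVlt => /orP[/eqP nt|nt].
    have ct : circle t = 1 by rewrite -nt -[_%:R]add0r circleDn circle0.
    apply: filterS near_c => u; rewrite /Psi ct => hu.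
    by rewrite (P1 (Num.truncn t)) -(P1 (Num.truncn u)) lip // circle_nr.
  have near_n : \forall u \near within [set u | 0 <= u] (nbhs t),
      (Num.truncn t)%:R < u < (Num.truncn t).+1%:R.
    apply: cvg_within; near=> u; apply/andP; split; near: u.
      exact: lt_nbhsr.
    exact: lt_nbhsl.
  apply: filterS2 near_c near_n => u hu /andP[h1 h2].
  have e1 : Num.truncn u = Num.truncn t by apply: truncn_def; rewrite (ltW h1).
  by rewrite /Psi e1 lip // circle_nr.
- move=> s e e0; have [N _ hN] := Ple s e e0.
  apply: filterS (nbhs_pinfty_ge (num_real N%:R)) => t hNt.
  have t0 : 0 <= t by apply: le_trans hNt.
  have /andP[h1 h2] := truncn_itv t0.
  (* By periodicity the position on the loop is given by the fractional part of [t], which lies in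
     the interval covered by [Ple]. *)
  have -> : Psi t = Phi (Num.truncn t) (circle (t - (Num.truncn t)%:R)).
    by rewrite /Psi -{2}[t](subrK (Num.truncn t)%:R) circleDn.
  apply: hN; first by rewrite /= truncn_ge_nat.
  by rewrite subr_ge0 h1 lerBlDr nat1r ltW.
exists phi, Psi; split=> // n g v.
have e1 : Num.truncn (n%:R + 2^-1 : R) = n.
  apply: truncn_def; have -> : n.+1%:R = n%:R + 1 :> R by rewrite natr1.
  lra.
have e2 : circle (n%:R + 2^-1 : R) = -1 by rewrite addrC circleDn circle_half.
rewrite /Psi e1 e2 Pm; last by rewrite /rho !bop_compE JJ (urep1 (hs n)).
by rewrite /rho !bop_compE JJ.
Unshelve. all: by end_near.
Qed.

End AsymptoticFamily.

(** * Contragredient representations *)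

Section Orthonormal.
Context {R : realType}.

Lemma gram_schmidt (K : hilbertType R) (X : seq K) : exists e : seq K,
  [/\ uniq e, {in e &, forall a b, dot a b = (a == b)%:R} &
      forall x, x \in X -> x = \sum_(a <- e) dot x a *: a].
Proof.
elim: X => [|x X [e [ue oe he]]]; first by exists [::].
pose r := x - \sum_(a <- e) dot x a *: a.
have re a : a \in e -> dot r a = 0.
  move=> ae; rewrite /r dotBl dot_suml (bigD1_seq a) //= dotZl (oe a a ae ae) eqxx mulr1.
  rewrite big1_seq ?addr0 ?subrr // => b /andP[ba be].
  by rewrite dotZl (oe b a be ae) (negPf ba) mulr0.
have [r0|r0] := eqVneq r 0.
  exists e; split=> // y; rewrite inE => /orP[/eqP->|/he//].
  by apply/eqP; rewrite -subr_eq0; apply/eqP.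
have nr0 : 0 < nr r by rewrite lt_neqAle nr_ge0 eq_sym nr_eq0 r0.
pose q := (nr r)^-1%:C *: r.
have qq : dot q q = 1.
  rewrite dot_nr /q nrZ nrR ger0_norm ?invr_ge0 ?(ltW nr0) //.
  by rewrite mulVf ?gt_eqF // expr1n.
have qe a : a \in e -> dot q a = 0 by move=> ae; rewrite dotZl re // mulr0.
have eq' a : a \in e -> dot a q = 0 by move=> ae; rewrite dotC qe // conjc0.
have qne : q \notin e.
  by apply/negP => /qe; rewrite qq => /eqP; rewrite oner_eq0.
have xq : dot x q = (nr r)%:C.
  have -> : x = r + \sum_(a <- e) dot x a *: a by rewrite subrK.
  rewrite dotDl dot_suml big1_seq ?addr0; last first.
    by move=> a /andP[_ ae]; rewrite dotZl eq' // mulr0.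
  rewrite /q dotZr conjc_real dot_nr -realcM expr2 mulrA mulVf ?gt_eqF //.
  by rewrite mul1r.
exists (q :: e); split.
- by rewrite /= qne.
- move=> a b; rewrite !inE => /orP[/eqP->|ae] /orP[/eqP->|be].
  + by rewrite qq eqxx.
  + by rewrite qe //; case: eqVneq => // h; rewrite -h (negPf qne) in be.
  + by rewrite eq' //; case: eqVneq => // h; rewrite h (negPf qne) in ae.
  + exact: oe.
- move=> y; rewrite inE big_cons => /orP[/eqP->|yX].
    rewrite xq /q scalerA -realcM mulfV ?gt_eqF // scale1r.
    by rewrite subrK.
  have yq : dot y q = 0.
    rewrite (he y yX) dot_suml big1_seq // => a /andP[_ ae].
    by rewrite dotZl eq' // mulr0.
  by rewrite yq scale0r add0r -he.
Qed.

Lemma finite_orthonormal_basis (K : hilbertType R) : finite_dimensional K ->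
  exists d : nat, exists e : 'I_d -> K,
    (forall i j, dot (e i) (e j) = (i == j)%:R) /\
    forall x, x = \sum_i dot x (e i) *: e i.
Proof.
case=> X /finite_seqP[s ->] hs.
have [e [ue oe he]] := gram_schmidt s.
exists (size e), (fun i => nth 0 e i); split.
  by move=> i j; rewrite oe ?mem_nth // nth_uniq.
move=> x; have : [set: K] x by [].
rewrite -hs => -[t [ht ->]].
have key y : y \in s -> y = \sum_(i < size e) dot y (nth 0 e i) *: nth 0 e i.
  by move=> ys; rewrite {1}(he y ys) (big_nth 0) big_mkord.
transitivity (\sum_(p <- t) \sum_(i < size e)
    dot (p.1 *: p.2) (nth 0 e i) *: nth 0 e i).
  apply: eq_big_seq => p pt; rewrite {1}(key p.2 (ht p pt)) scaler_sumr.
  by apply: eq_bigr => i _; rewrite dotZl scalerA.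
rewrite exchange_big; apply: eq_bigr => i _.
by rewrite dot_suml scaler_suml.
Qed.

End Orthonormal.

Section Contragredient.
Context {R : realType} {F : groupType}.

(** [C y] is the functional given by the inner product with [y]. By Riesz it is an antiunitary
    bijection, which identifies the contragredient with the complex conjugate representation. *)
Lemma contragredient_conjugation (H K : hilbertType R) (pi : F -> 'B(H))
    (pi' : F -> 'B(K)) : unitary_rep pi -> contragredient pi pi' ->
  exists C : H -> K,
  [/\ forall a x y, C (a *: x + y) = conjc a *: C x + C y,
      forall x y, dot (C x) (C y) = dot y x,
      forall f, exists y, f = C y &
      forall g y, pi' g (C y) = C (pi g y)].
Proof.
move=> hpi [p [pc pn ps] ppi].
have pbop f : exists b : bop H R[i]^o, forall x, b x = p f x.
  have pf : (p f : H -> R[i]^o) \in @bop_pred R H R[i]^o.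
    by apply/asboolP; split; [move=> a u v; rewrite linearPr|apply: pc].
  by exists (Bop pf).
have pnr f (b : bop H R[i]^o) : (forall x, b x = p f x) -> nr f = opnorm b.
  move=> hb; apply: complexI; rewrite -nrE pn.
  by congr ((opnorm _)%:C); apply/funext => x; rewrite hb.
have pinj f f' : (forall x, p f x = p f' x) -> f = f'.
  move=> h; apply/eqP; rewrite -subr_eq0 -nr_eq0.
  rewrite (pnr _ (0 : bop H R[i]^o)) ?opnorm0 // => x.
  by rewrite linearBl h subrr.
have ex y : exists f, forall x, p f x = dot x y.
  have lin : linear (fun x => dot x y : R[i]^o) by move=> a u v; rewrite dotP.
  pose u : {linear H -> R[i]^o} := HB.pack (fun x => dot x y : R[i]^o)
    (GRing.isLinear.Build _ _ _ _ (fun x => dot x y : R[i]^o) lin).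
  have uc : continuous u.
    have ub x : nr (u x) <= nr y * nr x by rewrite mulrC; apply: CauchySchwarz.
    by have /asboolP[_ uc] := @bounded_bop _ _ _ (u : H -> R[i]^o) (nr y) lin ub.
  by have [f hf] := ps u uc; exists f => x; rewrite hf.
have [C hC] := choice ex.
have CZ a x y : C (a *: x + y) = conjc a *: C x + C y.
  apply: pinj => z; rewrite linearPl !hC dotDr dotZr //.
have Cn y : nr (C y) = nr y.
  have [b hb] := pbop (C y); rewrite (pnr _ b hb).
  apply/eqP; rewrite eq_le; apply/andP; split.
    apply: opnorm_le => [|x]; first exact: nr_ge0.
    by rewrite hb hC mulrC; apply: CauchySchwarz.
  have [->|y0] := eqVneq y 0; first by rewrite nr0 opnorm_ge0.
  have ny : 0 < nr y by rewrite lt_neqAle nr_ge0 eq_sym nr_eq0 y0.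
  rewrite -(ler_pM2r ny) -expr2; have := opnormP b y; rewrite hb hC.
  apply: le_trans.
  by have := nrR (nr y ^+ 2); rewrite -dot_nr ger0_norm ?exprn_ge0 ?nr_ge0 // => <-.
have CD x y : C (x + y) = C x + C y by rewrite -{1}[x]scale1r CZ conjc1 scale1r.
have C0 : C 0 = 0 by apply: nr0_eq; rewrite Cn nr0.
have Cs a x : C (a *: x) = conjc a *: C x by rewrite -[a *: x]addr0 CZ C0 addr0.
(* Polarisation: an additive isometry preserves real parts of inner products. The imaginary part
   follows by multiplying [x] by the imaginary unit, where conjugate linearity reverses the sign and
   so exchanges the arguments. *)
have CRe x y : complex.Re (dot (C x) (C y)) = complex.Re (dot x y).
  have := nr_sqD (C x) (C y); rewrite -CD !Cn nr_sqD => h.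
  by apply: (mulfI (x := 2)); rewrite ?pnatr_eq0 //; move: h => /addrI.
exists C; split=> //.
- move=> x y; apply: eq_ReIm; first by rewrite CRe dotC Re_conjc.
  rewrite -Re_mulNi -dotZl.
  have -> : - 'i *: C x = C ('i *: x).
    by rewrite Cs; congr (_ *: _); apply/eqP; rewrite eq_complex /= oppr0 !eqxx.
  by rewrite CRe dotZl (dotC x y); case: (dot x y) => a b /=; rewrite mul0r mul1r sub0r.
- move=> f; have [b hb] := pbop f.
  have [||y hy] := @riesz _ H (p f) (opnorm b).
  + by move=> a u v; rewrite linearPr.
  + by move=> x; have := opnormP b x; rewrite hb.
  by exists y; apply: pinj => x; rewrite hC hy.
- move=> g y; apply: pinj => x; rewrite ppi !hC.
  by rewrite -(srepV (unitary_star_rep hpi)) adjPr.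
Qed.

End Contragredient.

(** * Invariant vectors *)

Section LowerBound.
Context {R : realType}.

Lemma lin_span_trans (V : normedModType R[i]) (X Y : set V) :
  X `<=` lin_span Y -> lin_span X `<=` lin_span Y.
Proof.
move=> XY v [s [hs ->]]; elim: s hs => [|p s ih] hs.
  by exists [::]; rewrite !big_nil.
have [|t [ht et]] := ih; first by move=> q qs; apply: hs; rewrite inE qs orbT.
have [r [hr er]] := XY _ (hs p (mem_head _ _)).
exists ([seq (p.1 * q.1, q.2) | q <- r] ++ t); split.
  by move=> q; rewrite mem_cat => /orP[/mapP[q' q'r ->]|/ht//]; apply: (hr q' q'r).
rewrite big_cons big_cat big_map et er scaler_sumr; congr (_ + _).
by apply: eq_bigr => q _; rewrite scalerA.
Qed.

Lemma sum_lin_span (I : finType) (V : normedModType R[i]) (u : I -> V) (c : I -> R[i])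
    (X : set V) : (forall i, X (u i)) -> lin_span X (\sum_i c i *: u i).
Proof.
move=> hX; exists [seq (c i, u i) | i <- index_enum I]; split; last by rewrite big_map.
by move=> p /mapP[i _ ->]; apply: hX.
Qed.

Lemma opnorm_total_le (I : Type) (H K : hilbertType R) (u : I -> H) (A : bop H K) (M : R) :
  total u -> 0 <= M ->
  (forall s : seq (R[i] * I), nr (A (\sum_(p <- s) p.1 *: u p.2)) <=
     M * nr (\sum_(p <- s) p.1 *: u p.2)) -> opnorm A <= M.
Proof.
move=> tu M0 h; apply: opnorm_le => // x; apply: le_eps => e e0.
have c0 : 0 < opnorm A + M + 1 by rewrite ltr_wpDl // addr_ge0 ?opnorm_ge0.
have e1 : 0 < e / (opnorm A + M + 1) by rewrite divr_gt0.
have [s] := total_near tu x e1; rewrite (ltr_pdivlMr _ _ c0).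
have := h s; set y := \sum_(p <- s) _ => hy hs.
have h1 := nr_le_dist (A x) (A y); rewrite -bopB in h1.
have h2 := opnormP A (x - y).
have h3 := ler_wpM2l M0 (nr_le_dist y x); rewrite [nr (y - x)]nr_dist mulrDr in h3.
have D0 := nr_ge0 (x - y); rewrite mulrC !mulrDl mul1r in hs.
lra.
Qed.

Section ConjugateSums.
Context (F : groupType) (H : hilbertType R) (delta : F -> H) (lambda : F -> 'B(H)).
Hypothesis dd : forall g h, dot (delta g) (delta h) = (g == h)%:R.
Hypothesis dt : total delta.
Hypothesis ld : forall g h, lambda g (delta h) = delta (g * h)%g.

Definition gconj (s : seq (R[i] * F)) := [seq (conjc p.1, p.2) | p <- s].

Lemma nr_gconj s : nr (gsum delta (gconj s)) = nr (gsum delta s).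
Proof.
apply/eqP; rewrite -(eqrXn2 (n := 2)) ?nr_ge0 //; apply/eqP/complexI.
rewrite -!dot_nr; have : dot (gsum delta (gconj s)) (gsum delta (gconj s)) =
    conjc (dot (gsum delta s) (gsum delta s)).
  rewrite /gsum big_map !dot_suml rmorph_sum; apply: eq_bigr => p _.
  rewrite !dot_sumr rmorph_sum; apply: eq_bigr => q _ /=.
  by rewrite !dotZl !dotZr !dd !conjcM conjc_nat.
by rewrite [dot (gsum delta s) _]dot_nr conjc_real.
Qed.

(** The operators [lambda g] permute the basis [delta], so conjugating coordinates in this basis
    carries the action of a sum to that of its conjugate. *)
Lemma gsum_gconj_le s : opnorm (gsum lambda (gconj s)) <= opnorm (gsum lambda s).
Proof.
have act r t : gsum lambda r (gsum delta t) = gsum delta (gmul r t).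
  rewrite /gsum bop_sumE big_allpairs_dep; apply: eq_bigr => p _.
  rewrite bop_scaleE bop_suml scaler_sumr; apply: eq_bigr => q _ /=.
  by rewrite bopZ ld scalerA.
have gmulC r t : gconj (gmul r t) = gmul (gconj r) (gconj t).
  rewrite /gconj /gmul; elim: r => //= p r ih; rewrite map_cat ih -!map_comp.
  by congr (_ ++ _); apply: eq_map => q /=; rewrite conjcM.
have gconjK r : gconj (gconj r) = r.
  rewrite /gconj -map_comp; apply: map_id_in => -[c g] _ /=.
  by rewrite conjcK.
apply: (opnorm_total_le dt (opnorm_ge0 _)) => t; rewrite -/(gsum delta t) act.
rewrite -nr_gconj gmulC gconjK -act -(nr_gconj t).
exact: opnormP.
Qed.

(** The antiunitary [C] carries the image of the conjugated sum under [sigma] to the image of [s]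
    under [sigma']. With [gsum_gconj_le] the norm estimate passes from [sigma] to [sigma']. *)
Lemma contragredient_gsum_le (K K' : hilbertType R) (sigma : F -> 'B(K))
    (sigma' : F -> 'B(K')) (C : K -> K') :
  (forall a x y, C (a *: x + y) = conjc a *: C x + C y) ->
  (forall x y, dot (C x) (C y) = dot y x) -> (forall f, exists y, f = C y) ->
  (forall g y, sigma' g (C y) = C (sigma g y)) ->
  forall s, opnorm (gsum sigma' s) <= opnorm (gsum sigma (gconj s)).
Proof.
move=> CZ Cd Cs Cg s.
have Cn y : nr (C y) = nr y.
  apply/eqP; rewrite -(eqrXn2 (n := 2)) ?nr_ge0 //; apply/eqP/complexI.
  by rewrite -!dot_nr Cd.
have C0 : C 0 = 0 by apply: nr0_eq; rewrite Cn nr0.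
apply: opnorm_le => [|f]; first exact: opnorm_ge0.
have [y ->] := Cs f.
have -> : gsum sigma' s (C y) = C (gsum sigma (gconj s) y).
  rewrite /gsum big_map !bop_sumE; elim: s => [|p s ih].
    by rewrite !big_nil C0.
  rewrite !big_cons ih bop_scaleE Cg -{1}[p.1]conjcK -CZ.
  by [].
by rewrite !Cn; apply: opnormP.
Qed.

End ConjugateSums.

(* The vector [Omega = sum_j e_j (x) C e_j] is invariant under [sigma (x) sigma']. *)
Lemma invariant_vector_bound (F : groupType) (K K' H T : hilbertType R)
    (tau : {bilinear H -> H -> T}) (d : nat) (e : 'I_d -> K) (C : K -> K')
    (sigma : F -> 'B(K)) (sigma' : F -> 'B(K')) (V : K -> H) (V' : K' -> H)
    (A B : F -> 'B(H)) (s : seq (R[i] * F)) :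
  hilbert_tensor tau -> (0 < d)%N ->
  (forall i j, dot (e i) (e j) = (i == j)%:R) ->
  (forall x, x = \sum_i dot x (e i) *: e i) ->
  (forall x y, dot (C x) (C y) = dot y x) ->
  unitary_rep sigma -> (forall g y, sigma' g (C y) = C (sigma g y)) ->
  (forall x y, dot (V x) (V y) = dot x y) ->
  (forall x y, dot (V' x) (V' y) = dot x y) ->
  (forall g y, A g (V y) = V (sigma g y)) ->
  (forall g y, B g (V' y) = V' (sigma' g y)) ->
  \sum_(p <- s) p.1 = 1 ->
  1 <= opnorm (\sum_(p <- s) p.1 *: tensor_op tau (A p.2) (B p.2)).
Proof.
move=> ht d0 oe ee Cd hs Cg Vd V'd AV BV s1.
set X := \sum_(p <- s) _.
pose Om := \sum_i tau (V (e i)) (V' (C (e i))).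
have OO : dot Om Om = d%:R.
  rewrite /Om dot_suml (eq_bigr (fun=> 1)) ?sumr_const ?card_ord // => i _.
  rewrite dot_sumr (bigD1 i) //= (tensor_dot ht) Vd V'd Cd !oe eqxx mulr1.
  rewrite big1 ?addr0 // => j ji.
  by rewrite (tensor_dot ht) Vd V'd Cd !oe (negPf ji) mulr0.
have parseval x : \sum_j dot x (e j) * dot (e j) x = dot x x.
  transitivity (dot (\sum_j dot x (e j) *: e j) x); last by rewrite -ee.
  by rewrite dot_suml; apply: eq_bigr => j _; rewrite dotZl.
(* The inner product is the sum over [i] of the squared norms of [sigma g (e i)], each equal to 1;
   the antiunitary second leg is what makes the two factors conjugate to each other. *)
have gO g : dot (tensor_op tau (A g) (B g) Om) Om = d%:R.
  rewrite /Om bop_suml dot_suml (eq_bigr (fun=> 1)) ?sumr_const ?card_ord // => i _.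
  rewrite tensor_opE // AV BV Cg dot_sumr.
  rewrite (eq_bigr (fun j => dot (sigma g (e i)) (e j) * dot (e j) (sigma g (e i)))).
    by rewrite parseval adjP -bop_compE (urepUl hs) oe eqxx.
  by move=> j _; rewrite (tensor_dot ht) Vd V'd Cd.
have XO : dot (X Om) Om = d%:R.
  rewrite /X bop_sumE dot_suml (eq_bigr (fun p => p.1 * d%:R)).
    by rewrite -mulr_suml s1 mul1r.
  by move=> p _; rewrite bop_scaleE dotZl gO.
have nO : nr Om ^+ 2 = d%:R.
  by apply: complexI; rewrite -dot_nr OO rmorph_nat.
have dR : 0 < d%:R :> R by rewrite ltr0n.
rewrite -(ler_pM2r dR) mul1r -nO expr2 mulrA.
apply: (@le_trans _ _ (nr (X Om) * nr Om)).
  rewrite -expr2 nO; apply: le_trans (CauchySchwarz _ _); rewrite XO.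
  by have := nrR (d%:R : R); rewrite rmorph_nat ger0_norm ?ler0n // => ->.
by rewrite ler_wpM2r ?nr_ge0 ?opnormP.
Qed.

(** The families [Phi] and [Psi] replace the values of [phi] and [psi] at three null costs: pulling
    the scalar out of [phi], exchanging the first leg, and exchanging the second. A bound at
    arbitrarily late times is enough for the limsup. *)
Lemma limsup_ge1 (F : groupType) (H1 H2 H T : hilbertType R)
    (tau : {bilinear H -> H -> T}) (pi : F -> 'B(H1)) (pi' : F -> 'B(H2))
    (phi : R -> 'B(H1) -> 'B(H)) (psi : R -> 'B(H2) -> 'B(H))
    (Phi Psi : R -> F -> 'B(H)) (s : seq (R[i] * F)) :
  hilbert_tensor tau -> unitary_rep pi -> unitary_rep pi' ->
  asymptotic_representation (cstar_of pi) phi ->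
  asymptotic_representation (cstar_of pi') psi ->
  (forall g, vanishes (fun t => phi t (pi g) - Phi t g)) ->
  (forall g, vanishes (fun t => psi t (pi' g) - Psi t g)) ->
  (forall g, ev_bounded (fun t => Phi t g)) ->
  (forall N : nat, exists2 t : R, N%:R <= t &
     1 <= opnorm (\sum_(p <- s) p.1 *: tensor_op tau (Phi t p.2) (Psi t p.2))) ->
  (1 <= limf_esup (fun t : R => (opnorm (\sum_(q <- [seq (p.1 *: pi p.2, pi' p.2) | p <- s])
       tensor_op tau (phi t q.1) (psi t q.2)))%:E) (pinfty_nbhs R))%E.
Proof.
move=> ht hpi hpi' hphi hpsi v1 v2 bPhi hbig.
have hA := cstar_of_subalgebra pi; have hB := cstar_of_subalgebra pi'.
have vs : vanishes (fun t => \sum_(p <- s)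
    (tensor_op tau (phi t (p.1 *: pi p.2)) (psi t (pi' p.2)) -
     p.1 *: tensor_op tau (Phi t p.2) (Psi t p.2))).
  apply: vanishes_sum => p.
  have bpsi : ev_bounded (fun t => psi t (pi' p.2)).
    by apply: (asym_bounded hB (cstar_of1 hpi') hpsi); apply: cstar_of_gen.
  have w1 := vanishes_tensor_l ht (asymZ hA hphi p.1 (@cstar_of_gen _ _ _ pi p.2)) bpsi.
  have w2 := vanishesZ p.1 (vanishes_tensor_l ht (v1 p.2) bpsi).
  have w3 := vanishesZ p.1 (vanishes_tensor_r ht (bPhi p.2) (v2 p.2)).
  have := vanishesD (vanishesD w1 w2) w3; apply: vanishes_eq => t.
  rewrite !(tensor_opDl ht, tensor_opDr ht, tensor_opNl ht, tensor_opNr ht, tensor_opZl ht).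
  by rewrite !scalerBr !subrKA.
apply: limf_esup_ge => e U e0 [M [_ hM]].
have [M' [_ hM']] := vs e e0.
have [N hN] : exists N : nat, Num.max M M' < N%:R.
  exists (Num.truncn `|Num.max M M'|).+1.
  by apply: le_lt_trans (ler_norm _) (truncnS_gt _).
have [t Nt ht1] := hbig N; move: hN; rewrite gt_max => /andP[h1 h2].
exists t; first by apply: hM; apply: lt_le_trans h1 Nt.
rewrite lerBlDr big_map; have h3 := hM' t (lt_le_trans h2 Nt).
apply: le_trans ht1 _; apply: le_trans (opnorm_le_dist _ _) (lerD (lexx _) _).
by rewrite opnorm_dist -sumrB.
Qed.

End LowerBound.

Section Embeddings.
Context {R : realType} (F : groupType) (H : hilbertType R) (delta : F -> H).
Hypothesis dd : forall g h, dot (delta g) (delta h) = (g == h)%:R.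

Lemma span_total (I : finType) (K : hilbertType R) (u : I -> K) :
  (forall x, exists c : I -> R[i], x = \sum_i c i *: u i) -> total u.
Proof.
move=> h; rewrite /total -subTset => x _; apply: subset_closure.
by have [c ->] := h x; apply: sum_lin_span => i; exists i.
Qed.

(** Basis vectors of [K] are sent to the vectors [delta (f i)]; the hypothesis on inner products
    combines orthonormality with the separation of indices by [f]. *)
Lemma embedding (I : Type) (K : hilbertType R) (u : I -> K) (f : I -> F) : total u ->
  (forall i j, dot (u i) (u j) = (f i == f j)%:R) ->
  exists J : bop K H, bop_comp (adj J) J = bop_id K /\
    forall x y, dot (J x) (J y) = dot x y.
Proof.
move=> tu hf; have [|J [_ hJ]] := @isometry_extension _ _ _ u H (delta \o f) 1 ler01 tu.
  by move=> i j; rewrite mul1r hf dd.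
have Jd x y : dot (J x) (J y) = dot x y by rewrite hJ mul1r.
exists J; split=> //; apply: bopE => x; apply: dot_inj => y.
by rewrite bop_compE adjPr Jd.
Qed.

End Embeddings.

(** * Computation of the two norms *)

Lemma generator_average_freeg (R : realType) (F : groupType) (g1 g2 : F) :
  4^-1 *: (<< g1 >> + << g1^-1%g >> + << g2 >> + << g2^-1%g >>) =
  Freeg [:: (4^-1, g1); (4^-1, g1^-1%g); (4^-1, g2); (4^-1, g2^-1%g)] :> {freeg F / R[i]}.
Proof.
apply/eqP/freeg_eqP => x; rewrite coeffZ !coeffD !coeffU coeff_Freeg !precoeff_cons.
rewrite precoeff_nil !mul1r /=.
by do 4! case: (_ == x) => /=; rewrite ?mulr1n ?mulr0n ?addr0 ?add0r; ring.
Qed.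

Theorem proposition6 (R : realType)
  (F : groupType) (g1 g2 : F) (hF : free_on2 g1 g2)
  (Hl : hilbertType R) (lambda : F -> 'B(Hl))
  (hlambda : unitary_rep lambda) (hreg : left_regular lambda)
  (K : nat -> hilbertType R) (sigma : forall n, F -> 'B(K n))
  (hsigma : forall n, unitary_rep (sigma n))
  (hfin : forall n, finite_dimensional (K n))
  (hlim : forall b : {freeg F / R[i]},
     (opnorm (rep_ext lambda b))%:E
       = limn_esup (fun n => (opnorm (rep_ext (sigma n) b))%:E))
  (K' : nat -> hilbertType R) (sigma' : forall n, F -> 'B(K' n))
  (hsigma' : forall n, unitary_rep (sigma' n))
  (hcontra : forall n, contragredient (sigma n) (sigma' n))
  (Hs : hilbertType R) (rho : F -> 'B(Hs))
  (hrho : unitary_rep rho) (hsum : direct_sum sigma' rho) :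
  let a : {freeg F / R[i]} :=
    4^-1 *: (<< g1 >> + << g1^-1%g >> + << g2 >> + << g2^-1%g >>) in
  left_asymptotic_norm (cstar_of lambda) (cstar_of rho) (Delta lambda rho a)
    = 1%E /\
  symmetric_asymptotic_norm (cstar_of lambda) (cstar_of lambda)
    (Delta lambda lambda a) = 1%E.
Proof.
move=> a; have [delta [dd dt ld]] := hreg.
pose s0 : seq (R[i] * F) :=
  [:: (4^-1, g1); (4^-1, g1^-1%g); (4^-1, g2); (4^-1, g2^-1%g)].
have ea : a = Freeg s0 by apply: generator_average_freeg.
have s1 : \sum_(p <- s0) p.1 = 1 by rewrite !big_cons big_nil /=; field.
have s1n : \sum_(p <- s0) nr p.1 <= 1.
  have e4 : nr (4^-1 : R[i]) = 4^-1.
    apply: (mulfI (x := 4)); first by rewrite pnatr_eq0.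
    have -> : 4 = nr (4%:R : R[i]) by have := nrR (4%:R : R); rewrite rmorph_nat ger0_norm ?ler0n.
    rewrite -nrM mulfV // nr1; have := nrR (4%:R : R).
    by rewrite rmorph_nat ger0_norm ?ler0n // => ->; rewrite mulfV // pnatr_eq0.
  by rewrite !big_cons big_nil /= e4; lra.
rewrite {}ea.
have [b [bI bS]] := free_square_bij hF.
have [tau ht] := basis_tensor dd dt bI bS.
have powI := free_pow_inj hF.
pose d1 := delta 1%g.
have d11 : dot d1 d1 = 1 by rewrite dd eqxx.
have hs (s : seq (R[i] * F)) (e : R) : 0 < e -> \forall n \near \oo,
    opnorm (gsum (sigma n) s) <= opnorm (gsum lambda s) + e.
  move=> e0; have h := hlim (Freeg s); rewrite rep_ext_gsum in h.
  have := limn_esup_lt e0 (esym h); apply: filterS => n.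
  by rewrite rep_ext_gsum.
pose basis n (q : {d : nat & 'I_d -> K n}) :=
  (forall i j, dot (tagged q i) (tagged q j) = (i == j)%:R) /\
  forall x, x = \sum_i dot x (tagged q i) *: tagged q i.
have exb n : exists q, @basis n q.
  have [d [e he]] := finite_orthonormal_basis (hfin n).
  by exists (existT _ d e).
pose d n := tag (sval (cid (exb n))).
pose e n : 'I_(d n) -> K n := tagged (sval (cid (exb n))).
have oe n i j : dot (e n i) (e n j) = (i == j)%:R.
  by have [h _] := svalP (cid (exb n)); exact: h.
have ee n x : x = \sum_i dot x (e n i) *: e n i.
  by have [_ h] := svalP (cid (exb n)); exact: h.
pose conj n (C : K n -> K' n) :=
  [/\ forall a x y, C (a *: x + y) = conjc a *: C x + C y,
      forall x y, dot (C x) (C y) = dot y x,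
      forall f, exists y, f = C y &
      forall g y, sigma' n g (C y) = C (sigma n g y)].
have exC n : exists C, @conj n C by apply: contragredient_conjugation.
pose C n := sval (cid (exC n)).
have CZ n a0 x y : C n (a0 *: x + y) = conjc a0 *: C n x + C n y
  by have [h _ _ _] := svalP (cid (exC n)); exact: h.
have Cd n x y : dot (C n x) (C n y) = dot y x
  by have [_ h _ _] := svalP (cid (exC n)); exact: h.
have Cs n f : exists y, f = C n y
  by have [_ _ h _] := svalP (cid (exC n)); exact: h.
have Cg n g y : sigma' n g (C n y) = C n (sigma n g y)
  by have [_ _ _ h] := svalP (cid (exC n)); exact: h.
have Csum n (c : 'I_(d n) -> R[i]) : C n (\sum_i c i *: e n i) = \sum_i conjc (c i) *: C n (e n i).
  have C0 : C n 0 = 0.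
    apply: nr0_eq; apply/eqP; rewrite -sqrf_eq0; apply/eqP/complexI.
    by rewrite -dot_nr Cd dot0l.
  by elim/big_rec2: _ => [//|i x y _ <-]; rewrite CZ.
have Cspan n f : f = \sum_i dot f (C n (e n i)) *: C n (e n i).
  have [y ->] := Cs n f; rewrite {1}(ee n y) Csum; apply: eq_bigr => i _.
  by rewrite Cd [in RHS]dotC.
have hs' (s : seq (R[i] * F)) (r : R) : 0 < r -> \forall n \near \oo,
    opnorm (gsum (sigma' n) s) <= opnorm (gsum lambda s) + r.
  move=> r0; apply: filterS (hs (gconj s) r r0) => n h.
  apply: le_trans (contragredient_gsum_le (@CZ n) (@Cd n) (@Cs n) (@Cg n) s) _.
  by apply: le_trans h _; rewrite lerD2r (gsum_gconj_le dd dt ld).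
have exJ n : exists J : bop (K n) Hl, bop_comp (adj J) J = bop_id (K n) /\
    forall x y, dot (J x) (J y) = dot x y.
  (* The powers of [g1] are pairwise distinct and so supply as many basis vectors as needed. *)
  apply: (@embedding _ _ _ _ dd _ _ (e n) (fun i => g1 ^+ (nat_of_ord i))%g).
    by apply: span_total => x; exists (fun i => dot x (e n i)); exact: ee.
  by move=> i j; rewrite oe (inj_eq powI).
have exJ' n : exists J : bop (K' n) Hl, bop_comp (adj J) J = bop_id (K' n) /\
    forall x y, dot (J x) (J y) = dot x y.
  apply: (@embedding _ _ _ _ dd _ _ (C n \o e n) (fun i => g1 ^+ (nat_of_ord i))%g).
    by apply: span_total => x; exists (fun i => dot x (C n (e n i))); exact: Cspan.
  by move=> i j; rewrite /= Cd oe (inj_eq powI) eq_sym.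
pose J n := sval (cid (exJ n)); pose J' n := sval (cid (exJ' n)).
have JJ n : bop_comp (adj (J n)) (J n) = bop_id (K n)
  by have [h _] := svalP (cid (exJ n)); exact: h.
have Jd n x y : dot (J n x) (J n y) = dot x y
  by have [_ h] := svalP (cid (exJ n)); exact: h.
have JJ' n : bop_comp (adj (J' n)) (J' n) = bop_id (K' n)
  by have [h _] := svalP (cid (exJ' n)); exact: h.
have Jd' n x y : dot (J' n x) (J' n y) = dot x y
  by have [_ h] := svalP (cid (exJ' n)); exact: h.
have [phi [Phi [hphi PhiU vphi PhiJ]]] :=
  asymptotic_family hF hlambda dd dt ld ht hsigma JJ hs.
have [psi [Psi [hpsi PsiU vpsi PsiJ]]] :=
  asymptotic_family hF hlambda dd dt ld ht hsigma' JJ' hs'.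
have bPhi g : ev_bounded (fun t => Phi t g).
  by exists 1 => //; apply: nearW => t; apply: opnorm_urep.
have Vd (L : hilbertType R) (V : L -> Hl) : (forall x y, dot (V x) (V y) = dot x y) ->
    forall x y, dot (tau d1 (V x)) (tau d1 (V y)) = dot x y.
  by move=> hV x y; rewrite (tensor_dot ht) hV d11 mul1r.
(* Some of the spaces [K n] may be 0 and carry no invariant unit vector. Testing [hlim] at the group
   unit, whose reduced norm is 1, gives nonzero spaces for arbitrarily large [n]. *)
have dpos N : exists2 n, (N <= n)%N & (0 < d n)%N.
  have h := hlim (Freeg [:: (1, 1%g)]); rewrite rep_ext_gsum in h.
  have l1 : opnorm (gsum lambda [:: (1, 1%g)]) = 1.
    rewrite /gsum big_seq1 scale1r (urep1 hlambda).
    apply/eqP; rewrite eq_le (opnorm1_le Hl) /=.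
    have := opnormP (1 : 'B(Hl)) d1; rewrite bop_oneE.
    have -> : nr d1 = 1.
      apply/eqP; rewrite -(eqrXn2 (n := 2)) ?nr_ge0 ?ler01 // expr1n; apply/eqP/complexI.
      by rewrite -dot_nr d11.
    by rewrite mulr1.
  rewrite l1 in h; have h2 : 0 < 2^-1 :> R by rewrite invr_gt0.
  have [n Nn hn] := limn_esup_frequently h2 (esym h) N.
  exists n => //; rewrite lt0n; apply/eqP => dn0.
  have x0 (x : K n) : x = 0.
    by rewrite (ee n x) big1 // => i; have := ltn_ord i; rewrite {2}dn0.
  suff : opnorm (rep_ext (sigma n) (Freeg [:: (1, 1%g)])) <= 0 by lra.
  by apply: opnorm_le => // x; rewrite (x0 (_ x)) nr0 mul0r.
have halfN (n N : nat) : (N <= n)%N -> N%:R <= n%:R + 2^-1 :> R.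
  move=> Nn; apply: (@le_trans _ _ n%:R); first by rewrite ler_nat.
  by rewrite lerDl invr_ge0.
have decomp (H2 : hilbertType R) (pi' : F -> 'B(H2)) :
    tensor_decomposition (cstar_of lambda) (cstar_of pi') (Delta lambda pi' (Freeg s0))
      [seq (p.1 *: lambda p.2, pi' p.2) | p <- s0].
  split; last by rewrite Delta_freeg big_map.
  move=> _ /mapP[p _ ->]; split; last exact: cstar_of_gen.
  by apply: (cstar_scale (cstar_of_subalgebra lambda)); apply: cstar_of_gen.
split; apply/eqP; rewrite eq_le; apply/andP; split.
- by apply: le_trans (left_le_symmetric _ _ _) _; apply: symmetric_norm_le1.
- have [iota [id_ io idense irho]] := hsum.
  (* The vectors [u] collect the conjugated bases of all summands into an orthonormal basis of [Hs];
     countability of [I] then embeds [Hs] into l^2(F). *)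
  pose I := {n : nat & 'I_(d n)}.
  pose u (p : I) : Hs := iota (tag p) (C (tag p) (e (tag p) (tagged p))).
  have tu : total u.
    rewrite /total -subTset -idense; apply: closure_subset; apply: lin_span_trans.
    move=> _ [n _ [f _ <-]]; rewrite (Cspan n f) linear_sum.
    under eq_bigr do rewrite linearZ.
    apply: (@sum_lin_span _ _ _ (fun i => u (existT (fun m => 'I_(d m)) n i))
      (fun i => dot f (C n (e n i)))) => i.
    by exists (existT _ n i).
  have [||Js [JJs Jds]] := @embedding _ _ _ _ dd _ _ u (fun p => g1 ^+ (pickle p))%g.
  + exact: tu.
  + move=> [n i] [m j]; rewrite (inj_eq powI) (inj_eq (pcan_inj pickleK)) /u /=.
    have [nm|nm] := eqVneq n m; last by rewrite io // -tag_eqE /tag_eq /= (negPf nm).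
    by subst m; rewrite id_ Cd oe eq_Tagged /= eq_sym.
  pose Psi' g : 'B(Hl) := bop_comp Js (bop_comp (rho g) (adj Js)).
  (* Both legs must act on the same space, so the identity representation of [cstar_of rho] is
     transported by the isometry [Js]. *)
  pose psi' x : 'B(Hl) := bop_comp Js (bop_comp x (adj Js)).
  have JJsE x : adj Js (Js x) = x by rewrite -bop_compE JJs.
  have rpsi' : representation (cstar_of rho) psi'.
    split.
    * move=> mu x y _ _; apply: bopE => v; rewrite /psi'.
      by rewrite !(bop_compE, bop_addE, bop_scaleE) bopD bopZ.
    * by move=> x y _ _; apply: bopE => v; rewrite /psi' !bop_compE JJsE.
    * by move=> x _; rewrite /psi' !adj_comp adjK; apply: bopE.
  pose s' := [seq (p.1 *: lambda p.2, rho p.2) | p <- s0].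
  have big := @limsup_ge1 _ _ _ _ _ _ tau lambda rho phi (fun=> psi') Phi (fun=> Psi') s0
    ht hlambda hrho hphi (representation_asymptotic rpsi') vphi.
  apply: le_trans (big _ bPhi _) _.
  + by move=> g; apply: vanishes_eq (@vanishes0 _ _ _) => t; rewrite subrr.
  + move=> N; have [n Nn dn] := dpos N; exists (n%:R + 2^-1); first exact: halfN.
    apply: (invariant_vector_bound (V := fun x => tau d1 (J n x))
      (V' := fun f => Js (iota n f)) (C := C n) (sigma := sigma n) (sigma' := sigma' n)
      (e := e n)) => //.
    * exact: Vd (Jd n).
    * by move=> x y; rewrite Jds id_.
    * by move=> g y; rewrite /Psi' !bop_compE JJsE irho.
  + apply: ereal_sup_ubound; exists Hl, Hl, tau, phi, psi', s'.
    by split=> //; apply: decomp.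
- by apply: symmetric_norm_le1.
(* Both families reach their [n]-th representations at the same time [n + 1/2], so the invariant
   vector of [sigma n] tensor [sigma' n] is available there. *)
- have big := @limsup_ge1 _ _ _ _ _ _ tau lambda lambda phi psi Phi Psi s0
    ht hlambda hlambda hphi hpsi vphi vpsi bPhi.
  apply: le_trans (big _) _.
  + move=> N; have [n Nn dn] := dpos N; exists (n%:R + 2^-1); first exact: halfN.
    apply: (invariant_vector_bound (V := fun x => tau d1 (J n x))
      (V' := fun x => tau d1 (J' n x)) (C := C n) (sigma := sigma n) (sigma' := sigma' n)
      (e := e n)) => //.
    * exact: Vd (Jd n).
    * exact: Vd (Jd' n).
  + apply: ereal_sup_ubound.
    exists Hl, Hl, tau, phi, psi, [seq (p.1 *: lambda p.2, lambda p.2) | p <- s0].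
    by split=> //; apply: decomp.
Qed.
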